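(* Let $T>0$ be fixed and $h_n=T/n$. Assume that each of the drifts $B_1,\dots,B_4$ is globally Lipschitz and of class $C^4$ with all partial derivatives of order $0$ to $4$ of polynomial growth, and that $\sup_t\mathbb{E}[|Y_t|^{\ell}]<\infty$ for all $\ell\ge 0$ and each $Y\in\{\xi_0,\delta_0,\varepsilon_0,\zeta_0\}$. Then, as $h_n\to 0$ (that is, $n\to\infty$), $\mathbb{Q}_{\mathbb{XX}}\to\mathbf{\Sigma}_0$ in probability, and $$\sqrt{n}\,(\operatorname{vech}\mathbb{Q}_{\mathbb{XX}}-\operatorname{vech}\mathbf{\Sigma}_0)\ \to\ N_{\bar p}\bigl(0,\ 2\mathbb{D}_p^{+}(\mathbf{\Sigma}_0\otimes\mathbf{\Sigma}_0)\mathbb{D}_p^{+\top}\bigr)\quad\text{in distribution.}$$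
   Context: Notation: for a symmetric $p\times p$ matrix $A$, $\operatorname{vech}A$ is the half-vectorization and $\mathbb{D}_p$ is the $p^2\times\bar p$ duplication matrix, $\operatorname{vec}A=\mathbb{D}_p\operatorname{vech}A$; $A^{+}$ is the Moore-Penrose inverse. True model and data: $p_1,p_2,k_1,k_2,r_1,\dots,r_4\ge 1$ are fixed integers with $k_1\le p_1$, $k_2\le p_2$; $p=p_1+p_2$, $\bar p=p(p+1)/2$. $W_1,\dots,W_4$ are independent standard Wiener processes of dimensions $r_1,\dots,r_4$. The latent processes $\xi_0,\delta_0,\varepsilon_0,\zeta_0$, with values in $\mathbb{R}^{k_1},\mathbb{R}^{p_1},\mathbb{R}^{p_2},\mathbb{R}^{k_2}$, solve $d\xi_{0,t}=B_1(\xi_{0,t})dt+\mathbf{S}_{1,0}dW_{1,t}$, $d\delta_{0,t}=B_2(\delta_{0,t})dt+\mathbf{S}_{2,0}dW_{2,t}$, $d\varepsilon_{0,t}=B_3(\varepsilon_{0,t})dt+\mathbf{S}_{3,0}dW_{3,t}$, $d\zeta_{0,t}=B_4(\zeta_{0,t})dt+\mathbf{S}_{4,0}dW_{4,t}$ on $[0,T]$, with deterministic initial values $c_1,\dots,c_4$ and constant matrices $\mathbf{S}_{i,0}$. Put $\mathbf{\Sigma}_{\xi\xi,0}=\mathbf{S}_{1,0}\mathbf{S}_{1,0}^\top$, $\mathbf{\Sigma}_{\delta\delta,0}=\mathbf{S}_{2,0}\mathbf{S}_{2,0}^\top$, $\mathbf{\Sigma}_{\varepsilon\varepsilon,0}=\mathbf{S}_{3,0}\mathbf{S}_{3,0}^\top$,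 $\mathbf{\Sigma}_{\zeta\zeta,0}=\mathbf{S}_{4,0}\mathbf{S}_{4,0}^\top$; $\mathbf{\Sigma}_{\delta\delta,0}$ and $\mathbf{\Sigma}_{\varepsilon\varepsilon,0}$ are positive definite. Constant matrices: $\mathbf{\Lambda}_{x_1,0}\in\mathbb{R}^{p_1\times k_1}$ of full column rank, $\mathbf{\Lambda}_{x_2,0}\in\mathbb{R}^{p_2\times k_2}$, $\mathbf{\Gamma}_0\in\mathbb{R}^{k_2\times k_1}$, $\mathbf{B}_0\in\mathbb{R}^{k_2\times k_2}$ with zero diagonal, $\mathbf{\Psi}_0=\mathbb{I}_{k_2}-\mathbf{B}_0$ non-singular. The observed process is $\mathbb{X}_t=(\mathbb{X}_{1,t}^\top,\mathbb{X}_{2,t}^\top)^\top$ with $\mathbb{X}_{1,t}=\mathbf{\Lambda}_{x_1,0}\xi_{0,t}+\delta_{0,t}$, $\mathbb{X}_{2,t}=\mathbf{\Lambda}_{x_2,0}\eta_{0,t}+\varepsilon_{0,t}$, $\eta_{0,t}=\mathbf{B}_0\eta_{0,t}+\mathbf{\Gamma}_0\xi_{0,t}+\zeta_{0,t}$. Set $$\mathbf{\Sigma}_0=\begin{pmatrix}\mathbf{\Sigma}_0^{11}&\mathbf{\Sigma}_0^{12}\\ \mathbf{\Sigma}_0^{12\top}&\mathbf{\Sigma}_0^{22}\end{pmatrix},$$ $\mathbf{\Sigma}_0^{11}=\mathbf{\Lambda}_{x_1,0}\mathbf{\Sigma}_{\xi\xi,0}\mathbf{\Lambda}_{x_1,0}^\top+\mathbf{\Sigma}_{\delta\delta,0}$,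 $\mathbf{\Sigma}_0^{12}=\mathbf{\Lambda}_{x_1,0}\mathbf{\Sigma}_{\xi\xi,0}\mathbf{\Gamma}_0^\top\mathbf{\Psi}_0^{-1\top}\mathbf{\Lambda}_{x_2,0}^\top$, $\mathbf{\Sigma}_0^{22}=\mathbf{\Lambda}_{x_2,0}\mathbf{\Psi}_0^{-1}(\mathbf{\Gamma}_0\mathbf{\Sigma}_{\xi\xi,0}\mathbf{\Gamma}_0^\top+\mathbf{\Sigma}_{\zeta\zeta,0})\mathbf{\Psi}_0^{-1\top}\mathbf{\Lambda}_{x_2,0}^\top+\mathbf{\Sigma}_{\varepsilon\varepsilon,0}$. With $t_i^n=ih_n$ and $T=nh_n$, the realized covariance is $\mathbb{Q}_{\mathbb{XX}}=\frac1T\sum_{i=1}^n(\mathbb{X}_{t_i^n}-\mathbb{X}_{t_{i-1}^n})(\mathbb{X}_{t_i^n}-\mathbb{X}_{t_{i-1}^n})^\top$. *)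

(* Defs.v *)
From HB Require Import structures.
From mathcomp Require Export all_boot all_order all_algebra.
From mathcomp Require Export all_classical all_reals all_analysis.
From mathcomp.real_closed Require Export mxtens.

Set Implicit Arguments.
Unset Strict Implicit.
Unset Printing Implicit Defensive.

Import Order.TTheory GRing.Theory Num.Theory.
Import numFieldNormedType.Exports.

Local Open Scope classical_set_scope.
Local Open Scope ring_scope.

(* Frobenius norm; on column vectors, the Euclidean norm (the library norm
   on matrices is the maximum of the entries). *)
Definition enorm (R : realType) (m n : nat) (A : 'M[R]_(m, n)) : R :=
  Num.sqrt (\sum_i \sum_j A i j ^+ 2).

Definition posdefmx (R : realType) (n : nat) (A : 'M[R]_n) : Prop :=
  A^T = A /\ forall v : 'cV[R]_n, v != 0 -> 0 < (v^T *m A *m v) 0 0.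

(* The column-stacking vectorization (mxvec stacks the rows). *)
Definition vec (R : realType) (m n : nat) (A : 'M[R]_(m, n)) :
  'cV[R]_(n * m) := (mxvec A^T)^T.

(* The positions (i, j), j <= i, of the lower triangular part, column after
   column and from top to bottom in each column. *)
Definition vech_pos (p : nat) : seq ('I_p * 'I_p) :=
  [seq (i, j) | j : 'I_p <- enum 'I_p,
                i : 'I_p <- [seq i : 'I_p <- enum 'I_p | (j <= i)%N]].

Lemma size_vech_pos (p : nat) : size (vech_pos p) == (p * p.+1)./2.
Proof.
rewrite /vech_pos size_allpairs_dep sumnE big_map big_enum /=.
rewrite (eq_bigr (fun j : 'I_p => p - j)%N) => [|j _]; last first.
  rewrite size_filter -(count_map val (leq j)) val_enum_ord.
  have jp := ltnW (ltn_ord j); move: (j : nat) jp => {}j jp.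
  rewrite -[X in iota 0 X](subnKC jp) iotaD count_cat add0n.
  have /eqP -> : (count (leq j) (iota 0 j) == 0)%N.
    rewrite -leqn0 leqNgt -has_count; apply/hasPn => i.
    by rewrite mem_iota add0n /= -ltnNge.
  rewrite add0n -[RHS](size_iota j); apply/eqP; rewrite -all_count.
  by apply/allP => i; rewrite mem_iota => /andP[].
apply/eqP; elim: p => [|p IHp]; first by rewrite big_ord0.
rewrite big_ord_recl subn0 (eq_bigr (fun j : 'I_p => p - j)%N)// IHp.
have -> : (p.+1 * p.+2 = p.+1.*2 + p * p.+1)%N.
  by rewrite -muln2 -[p.+2]addn2 mulnDr addnC (mulnC p).
by rewrite halfD doubleK odd_double.
Qed.

Definition vech_tuple (p : nat) : ((p * p.+1)./2).-tuple ('I_p * 'I_p) :=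
  Tuple (size_vech_pos p).

Lemma vech_pos_uniq (p : nat) : uniq (vech_pos p).
Proof.
apply: allpairs_uniq_dep; first exact: enum_uniq.
- by move=> j _; rewrite filter_uniq// enum_uniq.
- by move=> [j i] [j' i'] _ _ /= [-> ->].
Qed.

Lemma mem_vech_pos (p : nat) (i j : 'I_p) :
  ((i, j) \in vech_pos p) = (j <= i)%N.
Proof.
apply/allpairsPdep/idP => [[j' [i' [_]]]|ji].
  by rewrite mem_filter => /andP[ji _] [-> ->].
exists j, i; split; rewrite ?mem_enum//.
by rewrite (@mem_filter _ (fun i : 'I_p => (j <= i)%N)) ji mem_enum.
Qed.

Definition vech (R : realType) (p : nat) (A : 'M[R]_p) :
    'cV[R]_((p * p.+1)./2) :=
  \col_k A (tnth (vech_tuple p) k).1 (tnth (vech_tuple p) k).2.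

(* Column k is the vectorization of the symmetric 0-1 matrix whose
   half-vectorization is the k-th basis vector. *)
Definition duplication_mx (R : realType) (p : nat) :
    'M[R]_(p * p, (p * p.+1)./2) :=
  \matrix_(u, k) vec (\matrix_(a, b)
    (((a, b) == tnth (vech_tuple p) k) || ((b, a) == tnth (vech_tuple p) k))%:R
    : 'M[R]_p) u 0.

Lemma duplication_mxP (R : realType) (p : nat) (A : 'M[R]_p) :
  A^T = A -> vec A = duplication_mx R p *m vech A.
Proof.
move=> symA; apply/colP => u; rewrite !mxE.
case/mxvec_indexP: u => b a; rewrite mxvecE mxE.
under eq_bigr do rewrite !mxE mxvecE !mxE.
wlog ba : a b / (b <= a)%N => [hw|].
  have [/hw//|/ltnW/hw] := leqP b a.
  rewrite -{1}symA mxE => ->; apply: eq_bigr => k _.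
  by rewrite orbC.
have /tnthP[k kE] : (a, b) \in vech_tuple p by rewrite mem_vech_pos.
rewrite (bigD1 k)//= -kE eqxx mul1r big1 ?addr0// => l lk.
have tl : (tnth (vech_tuple p) l) \in vech_tuple p by exact: mem_tnth.
have ntl : (a, b) != tnth (vech_tuple p) l.
  apply: contra_neq lk => e; apply/esym.
  have inj := elimT (tuple_uniqP (vech_tuple p)) (vech_pos_uniq p).
  by apply: inj; rewrite -kE.
rewrite (negbTE ntl) /=; case: eqP => [e|_]; last by rewrite mul0r.
move: tl; rewrite -e mem_vech_pos => ab; exfalso; move: ntl; rewrite -e.
have -> : a = b by apply/val_inj/eqP; rewrite /= eqn_leq ab ba.
by rewrite eqxx.
Qed.

Definition penrose (R : realType) (m n : nat) (A : 'M[R]_(m, n))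
    (X : 'M[R]_(n, m)) : Prop :=
  [/\ A *m X *m A = A, X *m A *m X = X,
      (A *m X)^T = A *m X & (X *m A)^T = X *m A].

Definition mpinvmx (R : realType) (m n : nat) (A : 'M[R]_(m, n)) :
  'M[R]_(n, m) := xget 0 [set X | penrose A X].

Lemma penrose_uniq (R : realType) (m n : nat) (A : 'M[R]_(m, n)) X Y :
  penrose A X -> penrose A Y -> X = Y.
Proof.
move=> [aX xX sX tX] [aY yY sY tY].
have AXY : A *m X = A *m Y.
  rewrite -{1}aY -mulmxA -sX -{1}sY -trmx_mul.
  by rewrite mulmxA aX sY.
have XAY : X *m A = Y *m A.
  rewrite -{1}aY !mulmxA -tX -(mulmxA _ Y) -{1}tY -trmx_mul -(mulmxA Y).
  by rewrite (mulmxA A) aX tY.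
by rewrite -xX XAY -mulmxA AXY mulmxA yY.
Qed.

Lemma gram_unitmx (R : realType) (m n : nat) (A : 'M[R]_(m, n)) :
  row_free A -> A *m A^T \in unitmx.
Proof.
move=> fA; rewrite -row_free_unit; apply/inj_row_free => v vAA.
apply: (row_free_inj fA); rewrite mul0mx.
have : (v *m A) *m (v *m A)^T = 0 by rewrite trmx_mul mulmxA -(mulmxA v) vAA mul0mx.
move=> /matrixP/(_ 0 0); rewrite !mxE.
under eq_bigr do rewrite [X in _ * X]mxE -expr2.
move=> e; have h := psumr_eq0P (fun i _ => sqr_ge0 ((v *m A) 0 i)) e.
by apply/rowP => j; rewrite [RHS]mxE; apply/eqP; rewrite -sqrf_eq0 h.
Qed.

Lemma mpinvmxP (R : realType) (m n : nat) (A : 'M[R]_(m, n)) :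
  penrose A (mpinvmx A).
Proof.
suff [Z pZ] : exists Z, penrose A Z.
  by rewrite /mpinvmx; case: xgetP => [Y _ //|/(_ Z)].
have [r [C [F [-> uF uC]]]] : exists r (C : 'M[R]_(m, r)) (F : 'M[R]_(r, n)),
    [/\ A = C *m F, F *m F^T \in unitmx & C^T *m C \in unitmx].
  exists (\rank A), (col_base A), (row_base A); split.
  - by rewrite mulmx_base.
  - by apply: gram_unitmx; exact: row_base_free.
  - rewrite -[X in _ *m X]trmxK; apply: gram_unitmx.
    by rewrite /row_free mxrank_tr; exact: col_base_full.
exists (F^T *m invmx (F *m F^T) *m (invmx (C^T *m C) *m C^T)).
set IF := invmx (F *m F^T); set IC := invmx (C^T *m C).
have sIF : IF^T = IF by rewrite trmx_inv trmx_mul trmxK.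
have sIC : IC^T = IC by rewrite trmx_inv trmx_mul trmxK.
have AX : C *m F *m (F^T *m IF *m (IC *m C^T)) = C *m IC *m C^T.
  by rewrite !mulmxA -(mulmxA C F) -(mulmxA C _ IF) mulmxV// mulmx1.
have XA : F^T *m IF *m (IC *m C^T) *m (C *m F) = F^T *m IF *m F.
  rewrite !mulmxA -(mulmxA _ C^T C) -(mulmxA _ IC) mulVmx//.
  by rewrite mulmx1.
split; rewrite ?AX ?XA.
- rewrite !mulmxA -(mulmxA _ C^T C) -(mulmxA C IC) mulVmx//.
  by rewrite mulmx1.
- rewrite !mulmxA -(mulmxA _ F F^T) -(mulmxA _ _ IF) mulmxV//.
  by rewrite mulmx1.
- by rewrite !trmx_mul trmxK sIC !mulmxA.
- by rewrite !trmx_mul trmxK sIF !mulmxA.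
Qed.

(* partials [:: j1; ...; jm] f is the iterated partial derivative
   d_j1 ... d_jm f. *)
Definition partials (R : realType) (k : nat) (s : seq 'I_k)
    (f : 'cV[R]_k -> R) : 'cV[R]_k -> R :=
  foldr (fun j g x => derive g x (delta_mx j 0)) f s.

(* Since derive is total, the existence of the derivatives of order at most m
   is a separate requirement. *)
Definition class_C (R : realType) (k m : nat) (f : 'cV[R]_k -> R) : Prop :=
  (forall s : seq 'I_k, (size s < m)%N ->
     forall x j, derivable (partials s f) x (delta_mx j 0)) /\
  (forall s : seq 'I_k, (size s <= m)%N -> continuous (partials s f)).

Definition poly_growth (R : realType) (k : nat) (f : 'cV[R]_k -> R) : Prop :=
  exists (C : R) (q : nat), forall x, `|f x| <= C * (1 + enorm x) ^+ q.

Definition lipschitz_map (R : realType) (k l : nat)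
    (B : 'cV[R]_k -> 'cV[R]_l) : Prop :=
  exists L : R, forall x y, enorm (B x - B y) <= L * enorm (x - y).

Definition regular_drift (R : realType) (k : nat)
    (B : 'cV[R]_k -> 'cV[R]_k) : Prop :=
  lipschitz_map B /\
  forall i : 'I_k, class_C 4 (fun x => B x i 0) /\
    forall s : seq 'I_k, (size s <= 4)%N ->
      poly_growth (partials s (fun x => B x i 0)).

Definition random_vector (R : realType) (d : measure_display)
    (Omega : measurableType d) (q : nat) (Z : Omega -> 'cV[R]_q) : Prop :=
  forall i, measurable_fun setT (fun w => Z w i 0).

(* The normal law with mean m and variance v >= 0. The library density is that
   of the uniform law on [0, 1] when the standard deviation is 0, hence the
   separate case. *)
Definition normal_law (R : realType) (m v : R) (A : set R) : \bar R :=
  if v == 0 then \d_m A else normal_prob m (Num.sqrt v) A.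

(* Z has the law N_q(m, V): every linear combination a^T Z of the coordinates
   has the (possibly degenerate) law N(a^T m, a^T V a). *)
Definition normal_vector (R : realType) (d : measure_display)
    (Omega : measurableType d) (P : probability Omega R) (q : nat)
    (Z : Omega -> 'cV[R]_q) (m : 'cV[R]_q) (V : 'M[R]_q) : Prop :=
  random_vector Z /\
  forall (a : 'cV[R]_q) (A : set R), measurable A ->
    P ((fun w => (a^T *m Z w) 0 0) @^-1` A) =
    normal_law ((a^T *m m) 0 0) ((a^T *m V *m a) 0 0) A.

Definition cvg_probability (R : realType) (d : measure_display)
    (Omega : measurableType d) (P : probability Omega R) (m n : nat)
    (Z : nat -> Omega -> 'M[R]_(m, n)) (M : 'M[R]_(m, n)) : Prop :=
  forall e : R, 0 < e ->
    P [set w | e < enorm (Z k w - M)] @[k --> \oo] --> 0%E.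

Definition cvg_distribution (R : realType) (d : measure_display)
    (Omega : measurableType d) (P : probability Omega R)
    (d' : measure_display) (Omega' : measurableType d')
    (P' : probability Omega' R) (q : nat)
    (Z : nat -> Omega -> 'cV[R]_q) (Y : Omega' -> 'cV[R]_q) : Prop :=
  forall f : 'cV[R]_q -> R, continuous f ->
    (exists M : R, forall x, `|f x| <= M) ->
    ('E_P[fun w => f (Z k w)] @[k --> \oo] --> 'E_P'[fun w => f (Y w)])%E.

(* Z_k converges in distribution to the law N_q(m, V), represented by a random
   vector Y which may live on another probability space. *)
Definition cvg_normal (R : realType) (d : measure_display)
    (Omega : measurableType d) (P : probability Omega R) (q : nat)
    (Z : nat -> Omega -> 'cV[R]_q) (m : 'cV[R]_q) (V : 'M[R]_q) : Prop :=
  exists (d' : measure_display) (Omega' : measurableType d')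
    (P' : probability Omega' R) (Y : Omega' -> 'cV[R]_q),
    normal_vector P' Y m V /\ cvg_distribution P P' Z Y.

Definition mutual_independence (R : realType) (d : measure_display)
    (Omega : measurableType d) (P : probability Omega R) (I : finType)
    (F : I -> set (set Omega)) : Prop :=
  forall (J : {set I}) (A : I -> set Omega), (forall i, i \in J -> F i (A i)) ->
    P (\bigcap_(i in [set` J]) A i) = (\prod_(i in J) P (A i))%E.

Definition sigma_family (R : realType) (Omega K : Type) (q : nat) (D : set K)
    (Z : K -> Omega -> 'cV[R]_q) : set (set Omega) :=
  <<s [set A | exists t i (B : set R),
         [/\ D t, measurable B & A = (fun w => Z t w i 0) @^-1` B]] >>.

Record wiener (R : realType) (d : measure_display)
    (Omega : measurableType d) (P : probability Omega R) (r : nat)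
    (W : R -> Omega -> 'cV[R]_r) : Prop := {
  wiener_rv : forall t : R, 0 <= t -> random_vector (W t) ;
  wiener0 : {ae P, forall w, W 0 w = 0} ;
  wiener_continuous :
    {ae P, forall w, {within `[0, +oo[, continuous (fun t => W t w)}} ;
  wiener_normal : forall s t : R, 0 <= s -> s < t ->
    normal_vector P (fun w => W t w - W s w) 0 (t - s)%:M ;
  wiener_independent : forall (m : nat) (t : nat -> R), 0 <= t 0%N ->
    (forall i, t i <= t i.+1) ->
    mutual_independence P (fun i : 'I_m =>
      sigma_family [set: unit] (fun _ w => W (t i.+1) w - W (t i) w))
}.

(* Y solves dY_t = B(Y_t) dt + S dW_t on [0, T], Y_0 = c. As the diffusion
   matrix S is constant, the stochastic integral is S (W_t - W_0). *)
Definition sde_solution (R : realType) (d : measure_display)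
    (Omega : measurableType d) (P : probability Omega R) (k r : nat) (T : R)
    (B : 'cV[R]_k -> 'cV[R]_k) (S : 'M[R]_(k, r)) (c : 'cV[R]_k)
    (W : R -> Omega -> 'cV[R]_r) (Y : R -> Omega -> 'cV[R]_k) : Prop :=
  (forall t : R, t \in `[0, T] -> random_vector (Y t)) /\
  {ae P, forall w, {within `[0, T], continuous (fun t => Y t w)} /\
    forall t : R, t \in `[0, T] ->
      Y t w = c
        + \col_i (\int[lebesgue_measure]_(s in `[0, t]) (B (Y s w) i 0))
        + S *m (W t w - W 0 w)}.

Definition bounded_moments (R : realType) (d : measure_display)
    (Omega : measurableType d) (P : probability Omega R) (k : nat) (T : R)
    (Y : R -> Omega -> 'cV[R]_k) : Prop :=
  forall l : R, 0 <= l ->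
    (ereal_sup [set 'E_P[fun w => (enorm (Y t w) `^ l)%R] | t in `[0%R, T]]
      < +oo)%E.

Definition model_cov (R : realType) (p1 p2 k1 k2 : nat)
    (Lambda1 : 'M[R]_(p1, k1)) (Lambda2 : 'M[R]_(p2, k2))
    (Gamma : 'M[R]_(k2, k1)) (Psi : 'M[R]_k2)
    (Sxi : 'M[R]_k1) (Sdelta : 'M[R]_p1) (Seps : 'M[R]_p2) (Szeta : 'M[R]_k2) :
    'M[R]_(p1 + p2) :=
  let S12 := Lambda1 *m Sxi *m Gamma^T *m (invmx Psi)^T *m Lambda2^T in
  block_mx
    (Lambda1 *m Sxi *m Lambda1^T + Sdelta) S12
    S12^T
    (Lambda2 *m invmx Psi *m (Gamma *m Sxi *m Gamma^T + Szeta)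
       *m (invmx Psi)^T *m Lambda2^T + Seps).

Definition realized_cov (R : realType) (Omega : Type) (p : nat) (T : R)
    (X : R -> Omega -> 'cV[R]_p) (n : nat) (w : Omega) : 'M[R]_p :=
  let incr i := X (i.+1%:R * (T / n%:R)) w - X (i%:R * (T / n%:R)) w in
  T^-1 *: \sum_(i < n) incr i *m (incr i)^T.

(* Main.v *)
From HB Require Import structures.
From mathcomp Require Import measurable_realfun ring lra zify.
Require Import Defs.

Set Implicit Arguments.
Unset Strict Implicit.
Unset Printing Implicit Defensive.

Import Order.TTheory GRing.Theory Num.Theory.
Import numFieldNormedType.Exports.

Local Open Scope classical_set_scope.
Local Open Scope ring_scope.

(** Solving the structural equations gives X = U + M. Here M is a fixed linear combination of the
    four Wiener processes, a Gaussian process with independent increments and covariance [Sigma] per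
    unit time ([wiener_noise], [model_covE]). U collects the drift integrals: almost every path of U
    is a constant plus the integral of a continuous function ([sde_smooth_path]).

    Suppose first that X = M. The increments over the grid, divided by the square root of T/n, are
    independent with law N(0, [Sigma]). For a fixed vector a, the scaled error a^T sqrt(n) (vech Q -
    vech Sigma) is then n^(-1/2) times a sum of n independent centred quadratic forms in such
    Gaussian vectors ([vech_error_sum]). Isserlis' formula gives their variance, which the algebra
    of the duplication matrix identifies with the quadratic form of the limit covariance at a
    ([vech_form_cov]); eighth Gaussian moments bound their fourth moment. A central limit theorem
    under fourth moments, proved by Taylor expansion of cosine and sine ([cf_clt]), gives the limit
    of the characteristic functions.

    The drift is negligible: sqrt(n) times the difference of the realized covariances of X and M
    tends to 0 in probability ([realized_drift]). Products of two increments of U are of order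
    n^(-2). In the products of increments of U and M, the difference quotients of U are frozen on
    blocks of about n^(3/4) cells. The remainder is bounded by Young's inequality in terms of the
    oscillation of the quotients inside a block, which vanishes by uniform continuity, and of the
    squared increments of M, whose sum has bounded expectation ([smooth_noise_prob]).

    Characteristic functions yield convergence in distribution through [cvg_distribution_cf]: on a
    large box a bounded continuous function is uniformly close to a trigonometric polynomial with
    the same bound ([trig_approx]), and tightness comes from Chebyshev's inequality. Tightness of
    sqrt(n) (vech Q - vech Sigma) also yields consistency. The facts about normal variables (sums,
    moments, characteristic function) are read off Wiener increments and the scaling of the
    density. *)

Section independence.
Context (R : realType) (d : measure_display) (Omega : measurableType d)
  (P : probability Omega R).
Implicit Types (A B : set Omega) (G : set (set Omega)).

(** * Independence of generated sigma-algebras *)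

Lemma dynkin_indep B : measurable B ->
  dynkin [set A | measurable A /\ P (A `&` B) = (P A * P B)%E].
Proof.
move=> mB; split => /=.
- by rewrite setTI probability_setT mul1e.
- move=> A [mA AB]; split; first exact: measurableC.
  rewrite probability_setC// setIC -setDE measureD//; last first.
    by rewrite ltey_eq fin_num_measure.
  transitivity (P B - P A * P B)%E; first by rewrite -AB setIC.
  by rewrite muleBl ?mul1e ?fin_num_measure// fin_num_adde_defl// fin_num_measure.
- move=> F tF FB; have mF n : measurable (F n) by case: (FB n).
  split; first exact: bigcup_measurable.
  have tFB : trivIset setT (fun n => F n `&` B).
    apply/trivIsetP => i j _ _ ij; rewrite setIACA setIid.
    by move/trivIsetP : tF => /(_ i j Logic.I Logic.I ij) ->; rewrite set0I.
  rewrite setI_bigcupl measure_bigcup//; last by move=> n _; exact: measurableI.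
  rewrite measure_bigcup//.
  rewrite (eq_eseriesr (fun n _ => (FB n).2)).
  have PBE : P B = (fine (P B))%:E by rewrite fineK// fin_num_measure.
  rewrite [RHS]muleC PBE -nneseriesZl//.
  by apply: (@eq_eseriesr _ _ _ (fun n => n \in [set: nat])) => n _; exact: muleC.
Qed.

(** The events independent of B form a Dynkin system ([dynkin_indep]), so the pi-lambda theorem
    applies. *)
Lemma indep_sigma G B : setI_closed G -> G `<=` measurable -> measurable B ->
  (forall A, G A -> P (A `&` B) = (P A * P B)%E) ->
  forall A, <<s G >> A -> P (A `&` B) = (P A * P B)%E.
Proof.
move=> IG mG mB GB A; rewrite -setI_closed_g_dynkin_g_sigma_algebra//.
by move=> /(_ _ (conj (dynkin_indep mB) (fun A GA => conj (mG _ GA) (GB _ GA))))[].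
Qed.


(** When the families are stable under intersection and contain the whole space, this is a pi-system
    whose generated sigma-algebra contains [fam_sigma F J] ([fam_sigma_cap]), which makes
    [indep_sigma] applicable. *)
Definition fam_cap (I : finType) (F : I -> set (set Omega)) (J : {set I}) :
    set (set Omega) :=
  [set A | exists2 B : I -> set Omega, (forall i, i \in J -> F i (B i)) &
     A = \bigcap_(i in [set` J]) B i].

Definition fam_sigma (I : finType) (F : I -> set (set Omega)) (J : {set I}) :
    set (set Omega) :=
  <<s \bigcup_(i in [set` J]) F i >>.

Lemma fam_capI (I : finType) (F : I -> set (set Omega)) (J : {set I}) :
  (forall i, setI_closed (F i)) -> setI_closed (fam_cap F J).
Proof.
move=> FI _ _ [A FA ->] [B FB ->]; exists (fun i => A i `&` B i).
  by move=> i iJ; apply: FI; [exact: FA|exact: FB].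
by rewrite bigcapI.
Qed.

Lemma fam_sigma_cap (I : finType) (F : I -> set (set Omega)) (J : {set I}) :
  (forall i, F i setT) -> fam_sigma F J `<=` <<s fam_cap F J >>.
Proof.
move=> FT; apply: smallest_sub; first exact: smallest_sigma_algebra.
move=> A [i iJ FA]; apply: sub_sigma_algebra.
exists (fun k => if k == i then A else setT).
  by move=> k _; case: eqP => [->|_].
apply/seteqP; split => [w Aw k _|w]; first by case: eqP.
by move=> /(_ i iJ); rewrite eqxx.
Qed.

(** Grouping over disjoint index sets: [indep_sigma] is applied twice, first on the side of [J] with
    B fixed, then on the side of [K], which leaves only finite intersections. *)
Lemma indep_fam_sigma (I : finType) (F : I -> set (set Omega))
    (J K : {set I}) :
  (forall i, F i setT) -> (forall i, setI_closed (F i)) ->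
  (forall i, F i `<=` measurable) ->
  mutual_independence P F -> (forall i, i \in J -> i \notin K) ->
  forall A B, fam_sigma F J A -> fam_sigma F K B ->
    P (A `&` B) = (P A * P B)%E.
Proof.
move=> FT FI Fm indF JK A B /(fam_sigma_cap FT) sA /(fam_sigma_cap FT) sB.
have capm (L : {set I}) : fam_cap F L `<=` measurable.
  move=> _ [C FC ->]; apply: fin_bigcap_measurable => //.
  by move=> i iL; apply/Fm/FC.
have sigm (L : {set I}) : <<s fam_cap F L >> `<=` measurable.
  apply: smallest_sub => //; exact: sigma_algebra_measurable.
have mB := sigm _ _ sB.
apply: (indep_sigma (fam_capI FI) (capm J) mB _ sA) => {sA}A GA.
rewrite setIC muleC.
apply: (indep_sigma (fam_capI FI) (capm K) (capm _ _ GA) _ sB) => {sB mB}B GB.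
rewrite setIC muleC.
case: GA => A' FA ->; case: GB => B' FB ->.
(* As [J] and [K] are disjoint, the two choices of events glue into one choice on the union, to
   which mutual independence applies. *)
pose C i := if i \in J then A' i else B' i.
have eJ : \bigcap_(i in [set` J]) A' i = \bigcap_(i in [set` J]) C i.
  by apply: eq_bigcapr => i /= iJ; rewrite /C iJ.
have nJ i : i \in K -> (i \in J) = false.
  by move=> iK; apply: contraTF iK => /JK.
have eK : \bigcap_(i in [set` K]) B' i = \bigcap_(i in [set` K]) C i.
  by apply: eq_bigcapr => i /= iK; rewrite /C nJ.
have FC i : i \in J :|: K -> F i (C i).
  rewrite inE /C; case: ifPn => [iJ _|_ /= iK]; [exact: FA|exact: FB].
have -> : \bigcap_(i in [set` J]) A' i `&` \bigcap_(i in [set` K]) B' i =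
    \bigcap_(i in [set` J :|: K]) C i.
  rewrite eJ eK -bigcap_setU; congr bigcap.
  by apply/seteqP; split => i /=; rewrite inE => /orP.
rewrite eJ eK (indF _ _ FC) !indF; last 2 first.
- by move=> i iK; apply: FC; rewrite inE iK orbT.
- by move=> i iJ; apply: FC; rewrite inE iJ.
rewrite -bigU//=; last first.
  by apply/pred0P => i /=; apply/negbTE/negP => /andP[/JK/negP].
by apply: eq_bigl => i; rewrite !inE.
Qed.


Lemma setI_closed_bigcap (I : finType) G (J : {set I}) (A : I -> set Omega) :
  setI_closed G -> G setT -> (forall i, i \in J -> G (A i)) ->
  G (\bigcap_(i in [set` J]) A i).
Proof.
move=> GI GT GA.
have -> : [set` J] = [set` enum J] by apply/seteqP; split => i /=; rewrite mem_enum.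
rewrite bigcap_seq big_seq; elim/big_ind : _ => // i.
by rewrite mem_enum; exact: GA.
Qed.

(** Events with the same first index i are intersected into one event of [G i]. Independence of the
    [G i] splits the product over i, and independence within each i splits every factor. The pairs
    will be (Wiener process, time cell). *)
Lemma mutual_independence_pair (I K : finType) (G : I -> set (set Omega))
    (F : I * K -> set (set Omega)) :
  (forall i, G i setT) -> (forall i, setI_closed (G i)) ->
  (forall i k, F (i, k) `<=` G i) ->
  mutual_independence P G ->
  (forall i, mutual_independence P (fun k => F (i, k))) ->
  mutual_independence P F.
Proof.
move=> GT GI FG indG indF J A FA.
pose L i := [set k | (i, k) \in J]%SET.
pose B i := \bigcap_(k in [set` L i]) A (i, k).
have -> : \bigcap_(p in [set` J]) A p = \bigcap_(i in [set` [set: I]%SET]) B i.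
  apply/seteqP; split => w h.
    by move=> i _ k /=; rewrite inE => /h.
  by move=> [i k] /= ikJ; apply: (h i) => //=; rewrite inE.
rewrite indG; last first.
  move=> i _; apply: setI_closed_bigcap => // k.
  by rewrite inE => ikJ; exact/(@FG _ k)/FA.
under eq_bigr => i _.
  rewrite /B (indF i); last by move=> k; rewrite inE => /FA.
  over.
rewrite pair_big_dep; apply: eq_big => [[i k]|[i k] _] //=.
by rewrite !inE.
Qed.

End independence.

(** * Independent pairs of real random variables *)

Section indep_pair.
Context (R : realType) (d : measure_display) (Omega : measurableType d)
  (P : probability Omega R).

Definition indep2 (x y : Omega -> R) : Prop :=
  forall A B : set R, measurable A -> measurable B ->
    P (x @^-1` A `&` y @^-1` B) = (P (x @^-1` A) * P (y @^-1` B))%E.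

Lemma indep2_comp (f g : R -> R) (x y : Omega -> R) :
  measurable_fun setT f -> measurable_fun setT g ->
  indep2 x y -> indep2 (f \o x) (g \o y).
Proof.
move=> mf mg xy A B mA mB; apply: (xy (f @^-1` A) (g @^-1` B)).
- by rewrite -[X in measurable X]setTI; exact: mf.
- by rewrite -[X in measurable X]setTI; exact: mg.
Qed.

Section law.
Context (x y : Omega -> R) (mx : measurable_fun setT x)
  (my : measurable_fun setT y) (xy : indep2 x y).

Let X : {mfun Omega >-> R} := HB.pack x (isMeasurableFun.Build _ _ _ _ _ mx).
Let Y : {mfun Omega >-> R} := HB.pack y (isMeasurableFun.Build _ _ _ _ _ my).
Let mxy : measurable_fun setT (fun w => (x w, y w)).
Proof. exact: measurable_fun_pair. Qed.
Let XY : {mfun Omega >-> (R * R)%type} :=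
  HB.pack (fun w => (x w, y w)) (isMeasurableFun.Build _ _ _ _ _ mxy).

(** By independence the two measures agree on rectangles, which determine the product measure. *)
Lemma indep2_law (C : set (R * R)) : measurable C ->
  P ((fun w => (x w, y w)) @^-1` C) = (distribution P X \x distribution P Y)%E C.
Proof.
move=> mC; apply/esym.
exact: (@product_measure_unique _ _ _ _ R (distribution P X) (distribution P Y)
  (distribution P XY)).
Qed.

(** Tonelli and Fubini on the product law of [indep2_law]. *)
Lemma indep2_integrableM : P.-integrable setT (EFin \o x) ->
  P.-integrable setT (EFin \o y) ->
  P.-integrable setT (EFin \o (fun w => x w * y w)) /\
  \int[P]_w (x w * y w) = (\int[P]_w x w) * (\int[P]_w y w).
Proof.
move=> ix iy.
have ef : (EFin \o (fun u : R * R => (u.1 * u.2)%R)) =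
    (fun u => u.1%:E * u.2%:E)%E by apply/funext => u.
have mM : measurable_fun setT
    (EFin \o (fun u : R * R => (u.1 * u.2)%R)).
  apply/measurable_EFinP; apply: measurable_funM;
    [exact: measurable_fst|exact: measurable_snd].
have idX : (distribution P X).-integrable setT EFin.
  by apply: integrable_pushforward => //; exact: measurable_EFinP.
have idY : (distribution P Y).-integrable setT EFin.
  by apply: integrable_pushforward => //; exact: measurable_EFinP.
have absfin (Z : {mfun Omega >-> R}) : P.-integrable setT (EFin \o Z) ->
    (\int[distribution P Z]_s `|s%:E| \is a fin_num)%E.
  move=> iZ; rewrite ge0_fin_numE; last exact: integral_ge0.
  have : (distribution P Z).-integrable setT EFin.
    by apply: integrable_pushforward => //; exact: measurable_EFinP.
  by move=> /integrableP[].
have iM : (distribution P X \x distribution P Y)%E.-integrable setT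
    (EFin \o (fun u : R * R => (u.1 * u.2)%R)).
  apply/integrable12ltyP => //.
  have mabs : measurable_fun setT (fun s : R => `|s%:E|%E).
    by apply: measurableT_comp => //; exact: measurable_EFinP.
  under eq_integral => s _.
    under eq_integral do rewrite /= normrM EFinM.
    rewrite ge0_integralZl//.
    over.
  rewrite ge0_integralZr//; last exact: integral_ge0.
  by rewrite -ge0_fin_numE ?mule_ge0 ?integral_ge0// fin_numM// absfin.
have eqm (A : set (R * R)) : measurable A -> A `<=` setT ->
    distribution P XY A = (distribution P X \x distribution P Y)%E A.
  by move=> mA _; exact: indep2_law.
have iP : P.-integrable setT (EFin \o (fun w => x w * y w)).
  apply/integrableP; split.
    by apply/measurable_EFinP; exact: measurable_funM.
  move: iM => /integrableP[_]; rewrite -(eq_measure_integral _ eqm).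
  by rewrite ge0_integral_pushforward//; exact: measurableT_comp.
split=> //; rewrite /Rintegral -fineM; last 2 first.
- exact: integrable_fin_num.
- exact: integrable_fin_num.
congr fine.
transitivity (\int[distribution P XY]_u
  ((EFin \o (fun u : R * R => (u.1 * u.2)%R)) u))%E.
  by rewrite [RHS]integral_pushforward.
rewrite (eq_measure_integral _ eqm) -integral12_prod_meas1//.
pose c := fine (\int[P]_w (y w)%:E)%E.
have cE : (\int[distribution P Y]_s s%:E = c%:E)%E.
  rewrite (integral_distribution (X := Y))//=.
  by rewrite fineK//; exact: integrable_fin_num.
rewrite (eq_integral (fun s : R => c%:E * s%:E)%E); last first.
  by move=> s _; rewrite /fubini_F /= -cE muleC -integralZl//; exact: idY.
rewrite integralZl//.
rewrite muleC; congr (_ * _)%E.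
  by rewrite (integral_distribution (X := X)).
by rewrite fineK//; exact: integrable_fin_num.
Qed.

(** The joint law of an independent pair depends only on its marginals, so it can be computed from
    variables with the same marginals on another probability space. *)
Lemma indep2_sum_law (d' : measure_display) (Omega' : measurableType d')
    (P' : probability Omega' R) (x' y' : {mfun Omega' >-> R}) :
  (forall A : set R, measurable A -> P (x @^-1` A) = P' (x' @^-1` A)) ->
  (forall A : set R, measurable A -> P (y @^-1` A) = P' (y' @^-1` A)) ->
  forall C, measurable C -> P ((fun w => (x w, y w)) @^-1` C) =
    (distribution P' x' \x distribution P' y')%E C.
Proof.
move=> xx' yy' C mC; apply/esym.
apply: (@product_measure_unique _ _ _ _ R (distribution P' x')
  (distribution P' y') (distribution P XY)) => // A B mA mB.
rewrite [RHS](_ : _ = P (x @^-1` A) * P (y @^-1` B))%E; first exact: xy.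
by rewrite xx'// yy'.
Qed.

End law.

End indep_pair.

(** * Sums of independent centred normal variables *)

Section normal_rv.
Context (R : realType) (d : measure_display) (Omega : measurableType d)
  (P : probability Omega R).
Implicit Types x y : Omega -> R.

Definition same_law x y := forall A : set R, measurable A ->
  P (x @^-1` A) = P (y @^-1` A).

Lemma indep2_sum_same_law x y x' y' :
  measurable_fun setT x -> measurable_fun setT y ->
  measurable_fun setT x' -> measurable_fun setT y' ->
  indep2 P x y -> indep2 P x' y' -> same_law x x' -> same_law y y' ->
  same_law (fun w => x w + y w) (fun w => x' w + y' w).
Proof.
move=> mx my mx' my' xy xy' xx' yy' A mA.
pose X : {mfun Omega >-> R} := HB.pack x' (isMeasurableFun.Build _ _ _ _ _ mx').
pose Y : {mfun Omega >-> R} := HB.pack y' (isMeasurableFun.Build _ _ _ _ _ my').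
have mC : measurable ((fun u : R * R => u.1 + u.2) @^-1` A).
  rewrite -[X in measurable X]setTI.
  by apply: (measurable_funD measurable_fst measurable_snd).
have l := @indep2_sum_law _ _ _ P x y mx my xy _ _ P X Y xx' yy' _ mC.
have r := @indep2_sum_law _ _ _ P x' y' mx' my' xy' _ _ P X Y
  (fun _ _ => erefl) (fun _ _ => erefl) _ mC.
by move: (etrans l (esym r)).
Qed.

Definition normal_rv (v : R) x : Prop :=
  measurable_fun setT x /\
  forall A : set R, measurable A -> P (x @^-1` A) = normal_law 0 v A.

Lemma normal_rv_same_law v x y : normal_rv v x -> normal_rv v y -> same_law x y.
Proof. by move=> [_ nx] [_ ny] A mA; rewrite nx// ny. Qed.

Lemma normal_rv_cst0 : normal_rv 0 (fun _ => 0).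
Proof.
split; first exact: measurable_cst.
move=> A mA; rewrite /normal_law eqxx diracE preimage_cst.
by case: ifPn => A0; rewrite ?probability_setT ?measure0.
Qed.

Section wiener_normal.
Context (r : nat) (W : R -> Omega -> 'cV[R]_r) (WP : wiener P W) (i : 'I_r).

Lemma wiener_increment_rv (s t : R) : 0 <= s -> s <= t ->
  normal_rv (t - s) (fun w => W t w i 0 - W s w i 0).
Proof.
move=> s0; rewrite le_eqVlt => /predU1P[<-|st].
  rewrite subrr (_ : (fun _ => _) = fun _ => 0); first exact: normal_rv_cst0.
  by apply/funext => w; rewrite subrr.
have [rv nW] := wiener_normal WP s0 st.
split.
  have := rv i; congr measurable_fun.
  by apply/funext => w; rewrite !mxE.
move=> A mA; have := nW (delta_mx i 0) A mA.
rewrite trmx_delta mulmx0 [in RHS]mxE.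
have -> : (delta_mx 0 i *m (t - s)%:M *m delta_mx i 0 : 'M[R]_1) 0 0 = t - s.
  by rewrite mul_mx_scalar -scalemxAl mul_delta_mx !mxE !eqxx mulr1.
move=> <-; congr (P _); apply/seteqP; split => w /=; rewrite -rowE !mxE//.
Qed.

Lemma wiener_increment_indep (s t : R) : 0 <= s -> s <= t ->
  indep2 P (fun w => W s w i 0 - W 0 w i 0) (fun w => W t w i 0 - W s w i 0).
Proof.
move=> s0 st A B mA mB.
(* The definition of [wiener] takes an infinite nondecreasing sequence of times; only 0, s and t
   matter here, and the sequence stays at t. *)
pose u (n : nat) := if n is n'.+1 then (if n' is 0%N then s else t) else 0 : R.
have u0 : 0 <= u 0%N by [].
have um n : u n <= u n.+1 by case: n => [|[|n]] /=.
have := wiener_independent WP (m := 2) u0 um.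
pose C (k : 'I_2) := (fun w => W (u k.+1) w i 0 - W (u k) w i 0) @^-1`
  (if val k == 0%N then A else B).
move=> /(_ [set: 'I_2]%SET C).
have CE : \bigcap_(k in [set` [set: 'I_2]%SET]) C k = C ord0 `&` C ord_max.
  apply/seteqP; split => w /=.
    by move=> h; split; apply: h; rewrite /= inE.
  move=> [h0 h1] k _; have [->//|->//] : k = ord0 \/ k = ord_max.
  by case: k => -[|[|//]] lk; [left|right]; exact: val_inj.
rewrite CE; under eq_bigl do rewrite inE.
rewrite !big_ord_recl big_ord0 mule1.
rewrite (_ : lift _ _ = ord_max); last exact: val_inj.
apply => k _; apply: sub_sigma_algebra.
exists tt, i, (if val k == 0%N then A else B); split => //.
  by case: ifP.
by apply/seteqP; split => w; rewrite /C /= !mxE.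
Qed.

(** No convolution is computed. The increments of W over [0, v] and [v, v + w] are independent with
    the laws of x and y, so their sum has the law of x + y; but that sum is the increment over
    [0, v + w], which is normal of variance v + w. *)
Lemma normal_rvD x y (v w : R) : 0 <= v -> 0 <= w ->
  indep2 P x y -> normal_rv v x -> normal_rv w y ->
  normal_rv (v + w) (fun t => x t + y t).
Proof.
move=> v0 w0 xy nx ny; have [mx _] := nx; have [my _] := ny.
split; first exact: measurable_funD.
move=> A mA.
have vw : v <= v + w by rewrite lerDl.
have n1 := wiener_increment_rv (lexx 0) v0; rewrite subr0 in n1.
have n2 := wiener_increment_rv v0 vw.
rewrite [v + w - v]addrAC subrr add0r in n2.
have [m1 _] := n1; have [m2 _] := n2.
rewrite (indep2_sum_same_law mx my m1 m2 xy (wiener_increment_indep v0 vw)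
  (normal_rv_same_law nx n1) (normal_rv_same_law ny n2))//.
have := wiener_increment_rv (lexx 0) (le_trans v0 vw); rewrite subr0 => -[_ <-//].
rewrite (_ : (fun t => _ + _) = fun t => W (v + w) t i 0 - W 0 t i 0)//.
by apply/funext => t; ring.
Qed.

End wiener_normal.

End normal_rv.

(** * Random variables measurable with respect to a sub-sigma-algebra *)

Section measurable_wrt.
Context (R : realType) (d : measure_display) (Omega : measurableType d).
Implicit Types (x y : Omega -> R) (H : set (set Omega)).

Definition measurable_wrt (G : set (set Omega)) x : Prop :=
  forall B : set R, measurable B -> G (x @^-1` B).

Lemma measurable_wrtP H x : measurable_wrt <<s H>> x <->
  measurable_fun setT (x : g_sigma_algebraType H -> R).
Proof.
split=> [mx _ B mB|mx B mB]; first by rewrite setTI; exact: mx.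
by rewrite -[X in smallest _ _ X]setTI; exact: mx.
Qed.

Lemma measurable_wrt_sub (G G' : set (set Omega)) x : G `<=` G' ->
  measurable_wrt G x -> measurable_wrt G' x.
Proof. by move=> GG' mx B mB; exact/GG'/mx. Qed.

Lemma measurable_wrt_cst H (c : R) : measurable_wrt <<s H>> (fun _ => c).
Proof. by apply/measurable_wrtP; exact: measurable_cst. Qed.

Lemma measurable_wrtD H x y : measurable_wrt <<s H>> x ->
  measurable_wrt <<s H>> y -> measurable_wrt <<s H>> (fun w => x w + y w).
Proof.
move=> /measurable_wrtP mx /measurable_wrtP my; apply/measurable_wrtP.
exact: measurable_funD.
Qed.

Lemma measurable_wrtM H x y : measurable_wrt <<s H>> x ->
  measurable_wrt <<s H>> y -> measurable_wrt <<s H>> (fun w => x w * y w).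
Proof.
move=> /measurable_wrtP mx /measurable_wrtP my; apply/measurable_wrtP.
exact: measurable_funM.
Qed.

Lemma measurable_wrtB H x y : measurable_wrt <<s H>> x ->
  measurable_wrt <<s H>> y -> measurable_wrt <<s H>> (fun w => x w - y w).
Proof.
move=> /measurable_wrtP mx /measurable_wrtP my; apply/measurable_wrtP.
exact: measurable_funB.
Qed.

Lemma measurable_wrt_sum H (I : Type) (s : seq I) (p : pred I)
    (x : I -> Omega -> R) :
  (forall i, p i -> measurable_wrt <<s H>> (x i)) ->
  measurable_wrt <<s H>> (fun w => \sum_(i <- s | p i) x i w).
Proof.
move=> mx; elim: s => [|i s ih].
  by under eq_fun do rewrite big_nil; exact: measurable_wrt_cst.
under eq_fun do rewrite big_cons.
case: (boolP (p i)) => // pi; apply: measurable_wrtD => //; exact: mx.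
Qed.

End measurable_wrt.

Section families.
Context (R : realType) (d : measure_display) (Omega : measurableType d)
  (P : probability Omega R).
Context (I : finType) (F : I -> set (set Omega)).
Hypotheses (FT : forall i, F i setT) (FI : forall i, setI_closed (F i))
  (Fm : forall i, F i `<=` measurable) (indF : mutual_independence P F).

Lemma fam_sigma_sub (J : {set I}) i : i \in J -> F i `<=` fam_sigma F J.
Proof. by move=> iJ A FA; apply: sub_sigma_algebra; exists i. Qed.

Lemma indep2_fam_sigma (J K : {set I}) (x y : Omega -> R) :
  (forall i, i \in J -> i \notin K) ->
  measurable_wrt (fam_sigma F J) x -> measurable_wrt (fam_sigma F K) y ->
  indep2 P x y.
Proof.
move=> JK mx my A B mA mB.
by apply: (indep_fam_sigma FT FI Fm indF JK); [exact: mx|exact: my].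
Qed.

(** One index is removed at a time; the remaining sum is measurable with respect to the other
    families, hence independent of the removed term. The Wiener process is the reference process of
    [normal_rvD]. *)
Lemma normal_rv_sum (r : nat) (W : R -> Omega -> 'cV[R]_r) (k : 'I_r)
    (x : I -> Omega -> R) (v : I -> R) (J : {set I}) : wiener P W ->
  (forall i, 0 <= v i) ->
  (forall i, measurable_wrt (F i) (x i)) -> (forall i, normal_rv P (v i) (x i)) ->
  normal_rv P (\sum_(i in J) v i) (fun w => \sum_(i in J) x i w).
Proof.
move=> WP v0 Fx nx.
have [n] := ubnP #|J|; elim: n J => // n ih J Jn.
have [->|[i iJ]] := set_0Vmem J.
  rewrite big_set0; under eq_fun do rewrite big_set0; exact: normal_rv_cst0.
rewrite (big_setD1 i)//=.
rewrite (_ : (fun w => _) = fun w => x i w + \sum_(j in (J :\ i)%SET) x j w).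
  2: by apply/funext => w; rewrite (big_setD1 i).
apply: (normal_rvD WP k) => //.
- by apply: sumr_ge0 => *; exact: v0.
- apply: (indep2_fam_sigma (J := [set i]%SET) (K := (J :\ i)%SET)).
  + by move=> j; rewrite !inE => /eqP ->; rewrite eqxx.
  + apply: measurable_wrt_sub (Fx i); apply: fam_sigma_sub.
    by rewrite inE.
  + apply: measurable_wrt_sum => j jJ.
    by apply: measurable_wrt_sub (Fx j); exact: fam_sigma_sub.
- by apply: ih; rewrite (cardsD1 i) iJ in Jn.
Qed.

End families.

(** * Moments of the normal law *)

Section normal_integral.
Context (R : realType).
Local Notation mu := (@lebesgue_measure R).

(** The Radon-Nikodym derivative of the normal law coincides almost everywhere with its density,
    since both have the same integral over every measurable set. *)
Lemma ge0_integral_normal_prob (m s : R) (f : R -> \bar R) :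
  measurable_fun setT f -> (forall x, 0 <= f x)%E ->
  (\int[normal_prob m s]_x f x = \int[mu]_x (f x * (normal_pdf m s x)%:E))%E.
Proof.
move=> mf f0; have dom := @normal_prob_dominates R m s.
rewrite -(Radon_Nikodym_SigmaFinite.change_of_variables dom)//.
have mp : measurable_fun setT (fun x => (normal_pdf m s x)%:E).
  by apply/measurable_EFinP; exact: measurable_normal_pdf.
have mrn := measurable_int _ (Radon_Nikodym_SigmaFinite.f_integrable dom).
apply: ge0_ae_eq_integral => //.
- exact: emeasurable_funM.
- exact: emeasurable_funM.
- by move=> x _; rewrite mule_ge0//; exact: Radon_Nikodym_SigmaFinite.f_ge0.
- by move=> x _; rewrite mule_ge0// lee_fin normal_pdf_ge0.
have : ae_eq mu setT (Radon_Nikodym_SigmaFinite.f (normal_prob m s) mu)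
    (fun x => (normal_pdf m s x)%:E).
  apply: integral_ae_eq => //.
    exact: Radon_Nikodym_SigmaFinite.f_integrable.
  by move=> E _ mE; rewrite -Radon_Nikodym_SigmaFinite.f_integral.
by apply: filterS => x /[apply] ->.
Qed.

(** After division by [normal_pdf 0 1 x], the right-hand side is exp a with a = x^2 (1 - s^(-2)) /
    2, and the left-hand side is its tangent 1 + a. *)
Lemma normal_pdf_tangent (s x : R) : 0 < s ->
  normal_pdf 0 1 x * (1 - x ^+ 2 * (s ^- 2 - 1) / 2) <= s * normal_pdf 0 s x.
Proof.
move=> s0; rewrite !normal_pdfE ?gt_eqF//.
have -> : normal_peak s = s^-1 * normal_peak 1 :> R.
  rewrite /normal_peak -invfM; congr (_^-1).
  rewrite expr1n mul1r -[_ *+ 2]mulrnAr sqrtrM ?sqr_ge0//.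
  by rewrite sqrtr_sqr gtr0_norm.
rewrite -(mulrA s^-1) (mulrA s s^-1) mulfV ?gt_eqF// mul1r.
rewrite -(mulrA (normal_peak 1)).
apply: ler_wpM2l; first exact: normal_peak_ge0.
rewrite /normal_fun subr0 expr1n.
pose a := - (x ^+ 2 * (s ^- 2 - 1) / 2).
have -> : - x ^+ 2 / (s ^+ 2 *+ 2) = - x ^+ 2 / (1 *+ 2) + a.
  by rewrite /a; field; rewrite gt_eqF.
by rewrite expRD ler_wpM2l ?expR_ge0// -/a; exact: expR_ge1Dx.
Qed.

End normal_integral.

Section same_law.
Context (R : realType) (d : measure_display) (Omega : measurableType d)
  (P : probability Omega R).
Implicit Types x y : Omega -> R.

Lemma same_law_ge0_integral x y (f : R -> \bar R) :
  measurable_fun setT x -> measurable_fun setT y -> same_law P x y ->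
  measurable_fun setT f -> (forall r, 0 <= f r)%E ->
  (\int[P]_w f (x w) = \int[P]_w f (y w))%E.
Proof.
move=> mx my xy mf f0.
transitivity (\int[pushforward P x]_r f r)%E.
  by rewrite ge0_integral_pushforward.
transitivity (\int[pushforward P y]_r f r)%E.
  by apply: eq_measure_integral => A mA _; exact: xy.
by rewrite ge0_integral_pushforward.
Qed.

Lemma same_law_integrable x y (f : R -> R) :
  measurable_fun setT x -> measurable_fun setT y -> same_law P x y ->
  measurable_fun setT f ->
  P.-integrable setT (EFin \o (f \o x)) -> P.-integrable setT (EFin \o (f \o y)).
Proof.
move=> mx my xy mf /integrableP[_ fx]; apply/integrableP; split.
  by apply/measurable_EFinP; exact: measurableT_comp.
rewrite -(same_law_ge0_integral (f := fun r => `|(f r)%:E|%E) mx my)//.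
by apply: measurableT_comp => //; exact/measurable_EFinP.
Qed.

Lemma same_law_Rintegral x y (f : R -> R) :
  measurable_fun setT x -> measurable_fun setT y -> same_law P x y ->
  measurable_fun setT f -> P.-integrable setT (EFin \o (f \o x)) ->
  \int[P]_w f (x w) = \int[P]_w f (y w).
Proof.
move=> mx my xy mf fx.
have fy := same_law_integrable mx my xy mf fx.
have mEf : measurable_fun setT (EFin \o f) by exact/measurable_EFinP.
congr fine.
transitivity (\int[pushforward P x]_r (EFin \o f) r)%E.
  by rewrite integral_pushforward.
transitivity (\int[pushforward P y]_r (EFin \o f) r)%E.
  by apply: eq_measure_integral => A mA _; exact: xy.
by rewrite integral_pushforward.
Qed.

End same_law.

Section normal_rv_integral.
Context (R : realType) (d : measure_display) (Omega : measurableType d)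
  (P : probability Omega R).
Local Notation mu := (@lebesgue_measure R).

Lemma normal_rv_ge0_integral (s : R) (x : Omega -> R) (f : R -> \bar R) :
  0 < s -> normal_rv P (s ^+ 2) x ->
  measurable_fun setT f -> (forall r, 0 <= f r)%E ->
  (\int[P]_w f (x w) = \int[mu]_r (f r * (normal_pdf 0 s r)%:E))%E.
Proof.
move=> s0 [mx nx] mf f0; rewrite -ge0_integral_normal_prob//.
have mx' : measurable_fun setT (x : Omega -> measurableTypeR R) by exact: mx.
pose X : {mfun Omega >-> measurableTypeR R} :=
  HB.pack (x : Omega -> measurableTypeR R) (isMeasurableFun.Build _ _ _ _ _ mx').
rewrite -(ge0_integral_distribution X)//.
apply: eq_measure_integral => A mA _; rewrite [LHS]nx//.
by rewrite /normal_law sqrf_eq0 gt_eqF// sqrtr_sqr gtr0_norm.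
Qed.

End normal_rv_integral.

Lemma eq0_sign_change (R : realType) (f : R -> R) : {for 1, continuous f} ->
  (forall s, 1 < s -> 0 <= f s) -> (forall s, 0 < s -> s < 1 -> f s <= 0) ->
  f 1 = 0.
Proof.
move=> cf fp fn; apply/eqP; rewrite eq_le; apply/andP; split; rewrite leNgt;
  apply/negP => f1.
- have : \forall s \near (1 : R), 0 < f s by exact: cvgr_gt cf _ f1.
  move=> /nbhs_ballP[h /= h0 /(_ (1 - Num.min (h / 2) (1 / 2)))].
  have m0 : 0 < Num.min (h / 2) (1 / 2) :> R by rewrite lt_min !divr_gt0.
  have m1 : Num.min (h / 2) (1 / 2) <= 1 / 2 by rewrite ge_min lexx orbT.
  have m2 : Num.min (h / 2) (1 / 2) <= h / 2 by rewrite ge_min lexx.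
  rewrite /ball /= opprB addrC subrK gtr0_norm// => /(_ ltac:(lra)).
  by rewrite ltNge fn//; lra.
- have : \forall s \near (1 : R), f s < 0 by exact: cvgr_lt cf _ f1.
  move=> /nbhs_ballP[h /= h0 /(_ (1 + h / 2))].
  rewrite /ball /= opprD addrA subrr add0r normrN gtr0_norm ?divr_gt0//.
  by rewrite ltr_pdivrMr// ltr_pMr// ltr1n => /(_ isT); rewrite ltNge fp// ltrDl divr_gt0.
Qed.

Section normal_moments.
Context (R : realType) (d : measure_display) (Omega : measurableType d)
  (P : probability Omega R).
Local Notation mu := (@lebesgue_measure R).

Context (r : nat) (W : R -> Omega -> 'cV[R]_r) (WP : wiener P W) (k : 'I_r).

Let x1 w := W 1 w k 0 - W 0 w k 0.

Lemma normal_rv_std : normal_rv P 1 x1.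
Proof.
by have := wiener_increment_rv WP k (lexx 0) ler01; rewrite subr0.
Qed.

Let mx1 : measurable_fun setT x1. Proof. by have [] := normal_rv_std. Qed.

Lemma normal_rv_scale (s : R) : normal_rv P (s ^+ 2) (fun w => s * x1 w).
Proof.
split; first exact: measurable_funM.
move=> A mA; have [_ nW] := wiener_normal WP (lexx 0) ltr01.
have := nW (s *: delta_mx k 0) A mA.
rewrite mulmx0 [in RHS]mxE subr0 linearZ /= trmx_delta mulmx1.
have -> : (s *: delta_mx 0 k *m (s *: delta_mx k 0) : 'M[R]_1) 0 0 = s ^+ 2.
  rewrite mxE (bigD1 k)//= big1 ?addr0 => [|i ik].
    by rewrite !mxE !eqxx mulr1 expr2.
  by rewrite !mxE (negbTE ik) mulr0 mul0r.
move=> <-; congr (P _); apply/seteqP; split => w /=;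
  by rewrite -scalemxAl -rowE !mxE.
Qed.

Let m j := (\int[P]_w (x1 w ^+ (2 * j))%:E)%E.

Let e (s : R) j := (\int[mu]_t (t ^+ (2 * j) * normal_pdf 0 s t)%:E)%E.

Let x2j_ge0 j (t : R) : 0 <= t ^+ (2 * j).
Proof. by rewrite exprM exprn_ge0 ?sqr_ge0. Qed.

Let m_ge0 j : (0 <= m j)%E.
Proof. by apply: integral_ge0 => w _; rewrite lee_fin. Qed.

Let mpow j : measurable_fun setT (fun t : R => t ^+ j).
Proof. exact: measurable_funX. Qed.

Let eE (s : R) j : 0 < s -> e s j = ((s ^+ (2 * j))%:E * m j)%E.
Proof.
move=> s0; rewrite /m -ge0_integralZl_EFin//; last 2 first.
- by move=> w _; rewrite lee_fin.
- by apply/measurable_EFinP; exact: measurable_funX.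
transitivity (\int[P]_w ((s * x1 w) ^+ (2 * j))%:E)%E; last first.
  by apply: eq_integral => w _; rewrite exprMn EFinM.
rewrite (normal_rv_ge0_integral (f := fun t => (t ^+ (2 * j))%:E) s0
  (normal_rv_scale s))//.
  by apply/measurable_EFinP; exact: mpow.
by move=> t; rewrite lee_fin.
Qed.

Let mpdf (s : R) j (c : R) :
  measurable_fun setT (fun t : R => (c * (t ^+ (2 * j) * normal_pdf 0 s t))%:E).
Proof.
apply/measurable_EFinP; apply: measurable_funM => //; apply: measurable_funM => //.
exact: measurable_normal_pdf.
Qed.

Let fpos (s t c : R) j : 0 <= c -> 0 <= c * (t ^+ (2 * j) * normal_pdf 0 s t).
Proof. by move=> c0; rewrite !mulr_ge0// normal_pdf_ge0. Qed.

Let eZ (s c : R) j : 0 <= c ->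
  (\int[mu]_t (c * (t ^+ (2 * j) * normal_pdf 0 s t))%:E = c%:E * e s j)%E.
Proof.
move=> c0; rewrite -ge0_integralZl_EFin//.
- by move=> t _; have := @fpos s t 1 j ler01; rewrite mul1r lee_fin.
- by have := mpdf s j 1; under eq_fun do rewrite mul1r.
Qed.

(** Integral of [normal_pdf_tangent] against t^(2j), where scaling turns the right-hand side into
    s^(2j+1) m_j. The cases s > 1 and s < 1 are separated so that every term is nonnegative: at this
    point m_(j+1) may still be infinite. *)
Let ineq_gt1 (s : R) j : 1 < s ->
  (m j + ((1 - s ^- 2) / 2)%:E * m j.+1 <= (s ^+ (2 * j).+1)%:E * m j)%E.
Proof.
move=> s1; have s0 : 0 < s by exact: lt_trans s1.
have c0 : 0 <= (1 - s ^- 2) / 2.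
  by rewrite divr_ge0// subr_ge0 invf_le1 ?exprn_gt0// exprn_ege1// ltW.
have e1 i : e 1 i = m i by rewrite eE// expr1n mul1e.
have -> : ((s ^+ (2 * j).+1)%:E * m j = s%:E * e s j)%E.
  by rewrite eE// muleA -EFinM -exprS.
rewrite -!e1 -[e 1 j]mul1e -!eZ ?(ltW s0)//.
rewrite -ge0_integralD//; last 4 first.
- by move=> t _; rewrite lee_fin fpos.
- exact: mpdf.
- by move=> t _; rewrite lee_fin fpos.
- exact: mpdf.
apply: ge0_le_integral => //.
- by move=> t _; rewrite -EFinD lee_fin addr_ge0// fpos.
- by apply: emeasurable_funD; exact: mpdf.
- exact: mpdf.
move=> t _; rewrite -EFinD lee_fin.
have := ler_wpM2l (x2j_ge0 j t) (normal_pdf_tangent t s0).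
rewrite mulnS exprD; lra.
Qed.

Let ineq_lt1 (s : R) j : 0 < s -> s < 1 ->
  (m j <= (s ^+ (2 * j).+1)%:E * m j + ((s ^- 2 - 1) / 2)%:E * m j.+1)%E.
Proof.
move=> s0 s1.
have c0 : 0 <= (s ^- 2 - 1) / 2.
  by rewrite divr_ge0// subr_ge0 invf_ge1 ?exprn_gt0// exprn_ile1// ltW.
have e1 i : e 1 i = m i by rewrite eE// expr1n mul1e.
have -> : ((s ^+ (2 * j).+1)%:E * m j = s%:E * e s j)%E.
  by rewrite eE// muleA -EFinM -exprS.
rewrite -!e1 -[X in (X <= _)%E]mul1e -!eZ ?(ltW s0)//.
rewrite -ge0_integralD//; last 4 first.
- by move=> t _; rewrite lee_fin fpos// ltW.
- exact: mpdf.
- by move=> t _; rewrite lee_fin fpos.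
- exact: mpdf.
apply: ge0_le_integral => //.
- by move=> t _; rewrite lee_fin fpos.
- exact: mpdf.
- by apply: emeasurable_funD; exact: mpdf.
move=> t _; rewrite -EFinD lee_fin.
have := ler_wpM2l (x2j_ge0 j t) (normal_pdf_tangent t s0).
rewrite mulnS exprD; lra.
Qed.


(** With a = m_j and b = m_(j+1), q(s) (s - 1) is 2 s^2 times the difference of the two sides of the
    inequalities above. Hence q is nonnegative above 1 and nonpositive below 1, and q(1) = 0 reads b
    = (2j+1) a. *)
Let q (a b : R) j (s : R) :=
  a * 2 * s ^+ 2 * \sum_(i < (2 * j).+1) s ^+ i - b * (s + 1).

Let qM a b j s : q a b j s * (s - 1) =
  2 * s ^+ 2 * ((s ^+ (2 * j).+1 - 1) * a) - b * (s ^+ 2 - 1).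
Proof. rewrite subrX1 /q; ring. Qed.

Let continuous_q a b j : continuous (q a b j).
Proof.
have -> : q a b j = horner ((a * 2)%:P * 'X^2 * \sum_(i < (2 * j).+1) 'X^i
    - b%:P * ('X + 1%:P)).
  apply/funext => s; rewrite /q !hornerE/= horner_sum.
  by congr (_ * _ - _); apply: eq_bigr => i _; rewrite hornerXn.
exact: continuous_horner.
Qed.

Lemma normal_std_moment j :
  m j = (\prod_(i < j) (2 * i + 1)%:R : R)%:E.
Proof.
elim: j => [|j ih].
  rewrite big_ord0 /m; under eq_integral do rewrite expr0.
  rewrite integral_cst//.
  by rewrite mul1e; exact: probability_setT.
rewrite big_ord_recr /=; set a := \prod_(i < j) _ in ih *.
(* At s = 2 the coefficient of m_(j+1) is positive and the right-hand side is finite, so m_(j+1) is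
   finite. *)
have [b bE] : exists b, m j.+1 = b%:E.
  have : (m j.+1 < +oo)%E.
    rewrite ltey; apply/negP => /eqP my.
    have l12 : 1 < 2 :> R by rewrite ltr1n.
    have := @ineq_gt1 2 j l12; rewrite my ih.
    rewrite gt0_muley; last by rewrite lte_fin; lra.
    by rewrite addey// -EFinM leye_eq.
  rewrite -ge0_fin_numE// => /fineK <-.
  by exists (fine (m j.+1)).
rewrite bE; congr EFin.
have := @eq0_sign_change R (q a b j) (@continuous_q a b j 1).
have g1 s : 1 < s -> 0 <= q a b j s.
  move=> s1; have := @ineq_gt1 s j s1; rewrite bE ih -!EFinM -EFinD lee_fin => h.
  have s0 : 0 < s by exact: lt_trans s1.
  rewrite -(pmulr_lge0 _ (_ : 0 < s - 1)) ?subr_gt0// qM.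
  have := ler_wpM2l (_ : 0 <= 2 * s ^+ 2) h.
  rewrite mulr_ge0 ?sqr_ge0// => /(_ isT).
  have -> : 2 * s ^+ 2 * (a + (1 - s ^- 2) / 2 * b) =
      2 * s ^+ 2 * a + (s ^+ 2 - 1) * b by field; rewrite gt_eqF.
  lra.
have l1 s : 0 < s -> s < 1 -> q a b j s <= 0.
  move=> s0 s1; have := @ineq_lt1 s j s0 s1; rewrite bE ih -!EFinM -EFinD lee_fin => h.
  rewrite -(nmulr_lge0 _ (_ : s - 1 < 0)) ?subr_lt0// qM.
  have := ler_wpM2l (_ : 0 <= 2 * s ^+ 2) h.
  rewrite mulr_ge0 ?sqr_ge0// => /(_ isT).
  have -> : 2 * s ^+ 2 * (s ^+ (2 * j).+1 * a + (s ^- 2 - 1) / 2 * b) =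
      2 * s ^+ 2 * s ^+ (2 * j).+1 * a + (1 - s ^+ 2) * b.
    by field; rewrite gt_eqF.
  lra.
move=> /(_ g1 l1); rewrite /q expr1n.
under eq_bigr do rewrite expr1n.
rewrite sumr_const card_ord -[(2 * j).+1]addn1; lra.
Qed.

End normal_moments.

Section normal_rv_moments.
Context (R : realType) (d : measure_display) (Omega : measurableType d)
  (P : probability Omega R).
Implicit Types x y : Omega -> R.

Lemma integrable_cst (c : R) : P.-integrable setT (EFin \o (fun _ : Omega => c)).
Proof. exact: finite_measure_integrable_cst. Qed.

Lemma Rintegral_cstT (c : R) : \int[P]_(w in setT) c = c.
Proof.
rewrite Rintegral_cst// -[RHS]mulr1; congr (_ * _).
exact: (congr1 fine (probability_setT P)).
Qed.

Lemma integrable_bound x y : measurable_fun setT x ->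
  P.-integrable setT (EFin \o y) -> (forall w, `|x w| <= y w) ->
  P.-integrable setT (EFin \o x).
Proof.
move=> mx iy xy; apply: le_integrable iy => //; first exact/measurable_EFinP.
by move=> w _; rewrite /= lee_fin (le_trans (xy w))// ler_norm.
Qed.

Lemma integrable_addr x y : P.-integrable setT (EFin \o x) ->
  P.-integrable setT (EFin \o y) -> P.-integrable setT (EFin \o (fun w => x w + y w)).
Proof. by move=> ix iy; exact: (integrableD measurableT ix iy). Qed.

Lemma integrable_subr x y : P.-integrable setT (EFin \o x) ->
  P.-integrable setT (EFin \o y) -> P.-integrable setT (EFin \o (fun w => x w - y w)).
Proof. by move=> ix iy; exact: (integrableB measurableT ix iy). Qed.

Lemma integrable_scaler (c : R) x : P.-integrable setT (EFin \o x) ->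
  P.-integrable setT (EFin \o (fun w => c * x w)).
Proof. by move=> ix; exact: (integrableZl measurableT c ix). Qed.

Lemma integrable_sumr (I : Type) (s : seq I) (p : pred I) (x : I -> Omega -> R) :
  (forall i, p i -> P.-integrable setT (EFin \o x i)) ->
  P.-integrable setT (EFin \o (fun w => \sum_(i <- s | p i) x i w)).
Proof.
move=> ix; have := @integrable_sum _ _ _ P setT measurableT _ s p
  (fun i w => (x i w)%:E) ix.
by apply: eq_integrable => // w _; rewrite sumEFin.
Qed.

Lemma Rintegral_sum (I : Type) (s : seq I) (p : pred I) (x : I -> Omega -> R) :
  (forall i, p i -> P.-integrable setT (EFin \o x i)) ->
  \int[P]_(w in setT) (\sum_(i <- s | p i) x i w) =
  \sum_(i <- s | p i) \int[P]_(w in setT) x i w.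
Proof.
move=> ix; elim: s => [|i s ih].
  by rewrite big_nil; under eq_Rintegral do rewrite big_nil; exact: Rintegral_cstT.
rewrite big_cons; under eq_Rintegral do rewrite big_cons.
case: (boolP (p i)) => // pi; rewrite RintegralD ?ih//; first exact: ix.
exact: integrable_sumr.
Qed.

Context (r : nat) (W : R -> Omega -> 'cV[R]_r) (WP : wiener P W) (k : 'I_r).

Let x1 w := W 1 w k 0 - W 0 w k 0.

Let mx1 : measurable_fun setT x1. Proof. by have [] := normal_rv_std WP k. Qed.

Let mpow n : measurable_fun setT (fun t : R => t ^+ n).
Proof. exact: measurable_funX. Qed.

Let integrable_x1 n : P.-integrable setT (EFin \o (fun w => x1 w ^+ n)).
Proof.
have i2 : P.-integrable setT (EFin \o (fun w => x1 w ^+ (2 * n))).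
  apply/integrableP; split.
    by apply/measurable_EFinP; exact: measurable_funX.
  under eq_integral => w _.
    rewrite /= ger0_norm; last by rewrite exprM exprn_ge0 ?sqr_ge0.
    over.
  by rewrite (normal_std_moment WP k n) ltry.
apply: (integrable_bound _ (integrable_addr (integrable_cst 1) i2)).
  exact: measurable_funX.
move=> w; rewrite mulnC exprM -[_ ^+ 2]real_normK ?num_real//.
by have := normr_ge0 (x1 w ^+ n); nra.
Qed.

Section rv.
Context (v : R) (v0 : 0 <= v) (x : Omega -> R) (nx : normal_rv P v x).

Let nsx : normal_rv P v (fun w => Num.sqrt v * x1 w).
Proof. by have := normal_rv_scale WP k (Num.sqrt v); rewrite sqr_sqrtr. Qed.

Let mx : measurable_fun setT x. Proof. by case: nx. Qed.

Let msx : measurable_fun setT (fun w => Num.sqrt v * x1 w).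
Proof. by case: nsx. Qed.

Lemma integrable_normal_pow n : P.-integrable setT (EFin \o (fun w => x w ^+ n)).
Proof.
apply: (same_law_integrable (x := fun w => Num.sqrt v * x1 w)
  (f := fun t => t ^+ n)) => //.
- exact: normal_rv_same_law nsx nx.
rewrite (_ : _ \o _ = (fun w => Num.sqrt v ^+ n * x1 w ^+ n)).
  exact: integrable_scaler.
by apply/funext => w /=; rewrite exprMn.
Qed.

Lemma normal_moment_even j : \int[P]_(w in setT) (x w ^+ (2 * j)) =
  v ^+ j * \prod_(i < j) (2 * i + 1)%:R.
Proof.
rewrite (same_law_Rintegral (f := fun t => t ^+ (2 * j)) mx msx)//.
- under eq_Rintegral do rewrite exprMn.
  rewrite RintegralZl// exprM sqr_sqrtr//; congr (_ * _).
  by rewrite /Rintegral (normal_std_moment WP k j).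
- exact: normal_rv_same_law nx nsx.
- exact: integrable_normal_pow.
Qed.

(** The centred normal law is invariant under change of sign. *)
Lemma normal_moment_odd n : odd n -> \int[P]_(w in setT) (x w ^+ n) = 0.
Proof.
move=> on.
have nxN : normal_rv P v (fun w => - Num.sqrt v * x1 w).
  by have := normal_rv_scale WP k (- Num.sqrt v); rewrite sqrrN sqr_sqrtr.
have [mxN _] := nxN.
have e1 := same_law_Rintegral (f := fun t => t ^+ n) mx msx
  (normal_rv_same_law nx nsx) (mpow n) (integrable_normal_pow n).
have e2 := same_law_Rintegral (f := fun t => t ^+ n) mx mxN
  (normal_rv_same_law nx nxN) (mpow n) (integrable_normal_pow n).
have e3 : \int[P]_w ((- Num.sqrt v * x1 w) ^+ n) =
    - \int[P]_w ((Num.sqrt v * x1 w) ^+ n).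
  under eq_Rintegral do rewrite exprMn exprNn -signr_odd on expr1 mulN1r.
  under [in RHS]eq_Rintegral do rewrite exprMn.
  by rewrite !RintegralZl// mulNr.
by move: e1; rewrite e2 e3 => e1; move: e2; rewrite e3; lra.
Qed.

End rv.
End normal_rv_moments.

(** * Taylor bounds for cosine and sine *)

Section taylor.
Context (R : realType).
Implicit Types x : R.

(** Drives a chain of bounds: [sin_lex], [cos_gex], [sin_gex] and [cos_lex] each follow by
    integrating the preceding one from 0. *)
Lemma nondecreasing_from0 (f df : R -> R) x :
  (forall t : R, is_derive t 1 f (df t)) -> (forall t, 0 <= t -> 0 <= df t) ->
  0 <= x -> f 0 <= f x.
Proof.
move=> fdf df0; rewrite le_eqVlt => /predU1P[<-//|x0].
have [|t + fE] := @MVT R f df 0 x x0 (fun t _ => fdf t).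
  by apply: derivable_within_continuous => t _; have [] := fdf t.
rewrite in_itv /= => /andP[t0 _].
by rewrite -subr_ge0 fE subr0 mulr_ge0 ?df0 ?ltW.
Qed.

Lemma sin_lex x : 0 <= x -> sin x <= x.
Proof.
move=> x0; have := @nondecreasing_from0 (fun t => t - sin t) (fun t => 1 - cos t) x.
rewrite sin0 subr0 subr_ge0; apply => // t _. 
Qed.

Lemma cos_gex x : 0 <= x -> 0 <= cos x - 1 + x ^+ 2 / 2.
Proof.
move=> x0; have := @nondecreasing_from0 (fun t => cos t - 1 + t ^+ 2 / 2)
  (fun t => t - sin t) x.
rewrite cos0 subrr add0r expr0n mul0r; apply => // t.
  by apply: is_derive_eq; rewrite /GRing.scale/=; field.
by move=> t0; rewrite subr_ge0 sin_lex.
Qed.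

Lemma sin_gex x : 0 <= x -> 0 <= sin x - x + x ^+ 3 / 6.
Proof.
move=> x0; have := @nondecreasing_from0 (fun t => sin t - t + t ^+ 3 / 6)
  (fun t => cos t - 1 + t ^+ 2 / 2) x.
rewrite sin0 subrr add0r expr0n mul0r; apply => // t.
  by apply: is_derive_eq; rewrite /GRing.scale/=; field.
exact: cos_gex.
Qed.

Lemma cos_lex x : 0 <= x -> cos x - 1 + x ^+ 2 / 2 <= x ^+ 4 / 24.
Proof.
move=> x0; have := @nondecreasing_from0
  (fun t => t ^+ 4 / 24 - (cos t - 1 + t ^+ 2 / 2))
  (fun t => sin t - t + t ^+ 3 / 6) x.
rewrite cos0 subrr add0r !expr0n !mul0r subrr subr_ge0; apply => // t.
  by apply: is_derive_eq; rewrite /GRing.scale/=; field.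
exact: sin_gex.
Qed.

Lemma cos_taylor x : `|cos x - 1 + x ^+ 2 / 2| <= x ^+ 4 / 24.
Proof.
wlog x0 : x / 0 <= x => [h|].
  have [/h//|/ltW] := leP 0 x.
  by rewrite -oppr_ge0 => /h; rewrite cosN sqrrN (_ : (- x) ^+ 4 = x ^+ 4)//; ring.
by rewrite ger0_norm ?cos_gex ?cos_lex.
Qed.

Lemma sin_taylor x : `|sin x - x| <= `|x| ^+ 3 / 6.
Proof.
wlog x0 : x / 0 <= x => [h|].
  have [/h//|/ltW] := leP 0 x.
  by rewrite -oppr_ge0 => /h; rewrite sinN opprK normrN addrC distrC.
rewrite (ger0_norm x0) distrC ger0_norm ?subr_ge0 ?sin_lex//.
by have := sin_gex x0; lra.
Qed.

End taylor.

(** * Characteristic functions and the central limit theorem *)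

Section characteristic_function.
Context (R : realType) (d : measure_display) (Omega : measurableType d)
  (P : probability Omega R).
Implicit Types x y : Omega -> R.

Lemma measurable_cos_rv x : measurable_fun setT x ->
  measurable_fun setT (fun w => cos (x w)).
Proof.
move=> mx; apply: measurableT_comp mx.
by apply: continuous_measurable_fun; exact: continuous_cos.
Qed.

Lemma measurable_sin_rv x : measurable_fun setT x ->
  measurable_fun setT (fun w => sin (x w)).
Proof.
move=> mx; apply: measurableT_comp mx.
by apply: continuous_measurable_fun; exact: continuous_sin.
Qed.

Lemma normr_cos_le1 (t : R) : `|cos t| <= 1.
Proof. by rewrite ler_norml cos_geN1 cos_le1. Qed.

Lemma normr_sin_le1 (t : R) : `|sin t| <= 1.
Proof. by rewrite ler_norml sin_geN1 sin_le1. Qed.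

Lemma integrable_cos x : measurable_fun setT x ->
  P.-integrable setT (EFin \o (fun w => cos (x w))).
Proof.
move=> mx; apply: (integrable_bound _ (integrable_cst P 1)).
  exact: measurable_cos_rv.
by move=> w; exact: normr_cos_le1.
Qed.

Lemma integrable_sin x : measurable_fun setT x ->
  P.-integrable setT (EFin \o (fun w => sin (x w))).
Proof.
move=> mx; apply: (integrable_bound _ (integrable_cst P 1)).
  exact: measurable_sin_rv.
by move=> w; exact: normr_sin_le1.
Qed.

Lemma normr_Rintegral_le x (c : R) : P.-integrable setT (EFin \o x) ->
  (forall w, `|x w| <= c) -> `|\int[P]_w x w| <= c.
Proof.
move=> ix xc; apply: (le_trans (le_normr_Rintegral _ ix)) => //.
rewrite -[leRHS](Rintegral_cstT P); apply: le_Rintegral => //.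
- exact: integrable_norm.
- exact: integrable_cst.
Qed.

(** A cosine with a free phase [th] plays the role of the complex exponential. In the addition
    formula for the last summand, its cosine integral is replaced by g and its sine integral by 0;
    each replacement costs at most e, because the factors they multiply are bounded by 1. *)
Lemma cf_sum (n : nat) (X : nat -> Omega -> R) (g e : R) :
  (forall i, (i < n)%N -> measurable_fun setT (X i)) ->
  (forall i, (i < n)%N -> indep2 P (fun w => \sum_(j < i) X j w) (X i)) ->
  0 <= g <= 1 ->
  (forall i, (i < n)%N -> `|\int[P]_w cos (X i w) - g| <= e) ->
  (forall i, (i < n)%N -> `|\int[P]_w sin (X i w)| <= e) ->
  forall th, `|\int[P]_w cos (th + \sum_(i < n) X i w) - g ^+ n * cos th|
    <= n%:R * (e + e).
Proof.
move=> mX iX /andP[g0 g1] cX sX; elim: n mX iX cX sX => [_ _ _ _|n ih mX iX cX sX] th.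
  under eq_Rintegral do rewrite big_ord0 addr0.
  by rewrite Rintegral_cstT expr0 mul1r subrr normr0 mul0r.
have mS : measurable_fun setT (fun w => \sum_(i < n) X i w).
  by apply: measurable_sum => i; apply: mX; exact: (ltnW (ltn_ord i)).
have mT : measurable_fun setT (fun w => th + \sum_(i < n) X i w).
  exact: measurable_funD.
have mXn := mX n (ltnSn n).
have mth : measurable_fun setT (fun t : R => th + t) by exact: measurable_funD.
have mcos : measurable_fun setT (@cos R).
  by apply: continuous_measurable_fun; exact: continuous_cos.
have msin : measurable_fun setT (@sin R).
  by apply: continuous_measurable_fun; exact: continuous_sin.
have icc := indep2_comp (f := fun t => cos (th + t)) (g := cos)
  (measurableT_comp mcos mth) mcos (iX n (ltnSn n)).
have iss := indep2_comp (f := fun t => sin (th + t)) (g := sin)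
  (measurableT_comp msin mth) msin (iX n (ltnSn n)).
have [ic ec] := indep2_integrableM (measurable_cos_rv mT) (measurable_cos_rv mXn)
  icc (integrable_cos mT) (integrable_cos mXn).
have [is_ es] := indep2_integrableM (measurable_sin_rv mT) (measurable_sin_rv mXn)
  iss (integrable_sin mT) (integrable_sin mXn).
have -> : \int[P]_w cos (th + \sum_(i < n.+1) X i w) =
    \int[P]_w cos (th + \sum_(i < n) X i w) * \int[P]_w cos (X n w) -
    \int[P]_w sin (th + \sum_(i < n) X i w) * \int[P]_w sin (X n w).
  rewrite -ec -es -RintegralB//; apply: eq_Rintegral => w _.
  by rewrite big_ord_recr /= addrA cosD.
have {}ih := ih (fun i ii => mX i (ltnW ii)) (fun i ii => iX i (ltnW ii))
  (fun i ii => cX i (ltnW ii)) (fun i ii => sX i (ltnW ii)) th.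
move: ih; set a := \int[P]_w _; set b := \int[P]_w cos (X n w).
set c := \int[P]_w sin _; set s := \int[P]_w sin (X n w) => ih.
have a1 : `|a| <= 1.
  apply: normr_Rintegral_le => [|w]; last exact: normr_cos_le1.
  exact: integrable_cos.
have c1 : `|c| <= 1.
  apply: normr_Rintegral_le => [|w]; last exact: normr_sin_le1.
  exact: integrable_sin.
have -> : a * b - c * s - g ^+ n.+1 * cos th =
    g * (a - g ^+ n * cos th) + (a * (b - g) - c * s) by rewrite exprS; ring.
apply: le_trans (ler_normD _ _) _; rewrite -natr1 mulrDl mul1r lerD//.
  rewrite normrM ger0_norm//; apply: le_trans ih.
  by rewrite ler_piMl.
apply: le_trans (ler_normB _ _) _; rewrite !normrM.
apply: lerD; [rewrite -[leRHS]mul1r|rewrite -[leRHS]mul1r]; apply: ler_pM => //.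
  exact: cX.
exact: sX.
Qed.

Lemma expRN_taylor (y : R) : 0 <= y -> `|expR (- y) - 1 + y| <= y ^+ 2.
Proof.
move=> y0; rewrite ler_norml; apply/andP; split.
  have := expR_ge1Dx (- y); have := sqr_ge0 y; lra.
have h : expR (- y) * (1 + y) <= 1.
  apply: (@le_trans _ _ (expR (- y) * expR y)).
    by rewrite ler_wpM2l ?expR_ge0// expR_ge1Dx.
  by rewrite -expRD addNr expR0.
have := expR_ge0 (- y); nra.
Qed.

(** Second-order expansion. The cubic error of the sine is controlled by second and fourth moments
    through |x|^3 <= (del x^2 + x^4 / del) / 2, where [del] is free. *)
Lemma cf_small x (s c del : R) : measurable_fun setT x ->
  P.-integrable setT (EFin \o x) ->
  P.-integrable setT (EFin \o (fun w => x w ^+ 2)) ->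
  P.-integrable setT (EFin \o (fun w => x w ^+ 4)) ->
  \int[P]_w x w = 0 -> \int[P]_w (x w ^+ 2) = s -> \int[P]_w (x w ^+ 4) <= c ->
  0 < del ->
  `|\int[P]_w cos (x w) - expR (- (s / 2))| <= c / 24 + (s / 2) ^+ 2 /\
  `|\int[P]_w sin (x w)| <= (s * del + c / del) / 12.
Proof.
move=> mx i1 i2 i4 e1 e2 e4 del0.
have s0 : 0 <= s by rewrite -e2; apply: Rintegral_ge0 => w _; exact: sqr_ge0.
split.
  have -> : \int[P]_w cos (x w) - expR (- (s / 2)) =
      \int[P]_w (cos (x w) - 1 + 2^-1 * x w ^+ 2) -
      (expR (- (s / 2)) - 1 + s / 2).
    rewrite RintegralD//; last 2 first.
    - by apply: integrable_subr; [exact: integrable_cos|exact: integrable_cst].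
    - exact: integrable_scaler.
    rewrite RintegralB//; [|exact: integrable_cos|exact: integrable_cst].
    by rewrite RintegralZl// Rintegral_cstT e2; ring.
  apply: le_trans (ler_normB _ _) _; apply: lerD; last first.
    by apply: expRN_taylor; rewrite divr_ge0.
  have ii : P.-integrable setT (EFin \o (fun w => cos (x w) - 1 + 2^-1 * x w ^+ 2)).
    apply: integrable_addr; last exact: integrable_scaler.
    by apply: integrable_subr; [exact: integrable_cos|exact: integrable_cst].
  apply: (le_trans (le_normr_Rintegral _ ii)) => //.
  apply: (@le_trans _ _ (\int[P]_w (24^-1 * x w ^+ 4))).
    apply: le_Rintegral => //; [exact: integrable_norm|exact: integrable_scaler|].
    by move=> w _; rewrite /= [2^-1 * _]mulrC [24^-1 * _]mulrC cos_taylor.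
  rewrite RintegralZl// mulrC; lra.
have is_ := integrable_sin mx.
have -> : \int[P]_w sin (x w) = \int[P]_w (sin (x w) - x w).
  by rewrite RintegralB// e1 subr0.
have ib := integrable_subr is_ i1.
apply: (le_trans (le_normr_Rintegral _ ib)) => //.
have ic : P.-integrable setT
    (EFin \o (fun w => del / 12 * x w ^+ 2 + (12 * del)^-1 * x w ^+ 4)).
  by apply: integrable_addr; exact: integrable_scaler.
apply: (@le_trans _ _
    (\int[P]_w (del / 12 * x w ^+ 2 + (12 * del)^-1 * x w ^+ 4))).
  apply: le_Rintegral => //; first exact: integrable_norm.
  move=> w _; apply: (le_trans (sin_taylor _)).
  have <- : `|x w| ^+ 2 = x w ^+ 2 by rewrite real_normK ?num_real.
  have <- : `|x w| ^+ 4 = x w ^+ 4.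
    by rewrite (exprM _ 2 2) real_normK ?num_real// -exprM.
  set z := `|x w|; rewrite -subr_ge0.
  have -> : del / 12 * z ^+ 2 + (12 * del)^-1 * z ^+ 4 - z ^+ 3 / 6 =
      (12 * del)^-1 * (z * (del - z)) ^+ 2 by field; rewrite gt_eqF.
  by rewrite mulr_ge0 ?sqr_ge0// invr_ge0 mulr_ge0 ?ltW.
rewrite RintegralD//; [|exact: integrable_scaler|exact: integrable_scaler].
rewrite !RintegralZl// e2.
have -> : (s * del + c / del) / 12 = del / 12 * s + (12 * del)^-1 * c.
  by field; rewrite gt_eqF.
rewrite lerD2l ler_wpM2l//.
by rewrite invr_ge0 mulr_ge0 ?ltW.
Qed.

(** The summands have variance v/n and fourth moment of order n^(-2), so with [del] = n^(-1/2) both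
    errors of [cf_small] are O(n^(-3/2)). [cf_sum] adds n of them, with g = exp(- v / (2n)), whose
    n-th power is the limit; the total error is O(n^(-1/2)). *)
Lemma cf_clt (X : nat -> nat -> Omega -> R) (v C : R) :
  (forall n i, (i < n)%N -> measurable_fun setT (X n i)) ->
  (forall n i, (i < n)%N -> indep2 P (fun w => \sum_(j < i) X n j w) (X n i)) ->
  (forall n i, (i < n)%N -> P.-integrable setT (EFin \o X n i)) ->
  (forall n i, (i < n)%N -> P.-integrable setT (EFin \o (fun w => X n i w ^+ 2))) ->
  (forall n i, (i < n)%N -> P.-integrable setT (EFin \o (fun w => X n i w ^+ 4))) ->
  (forall n i, (i < n)%N -> \int[P]_w X n i w = 0) ->
  (forall n i, (i < n)%N -> \int[P]_w (X n i w ^+ 2) = v / n%:R) ->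
  (forall n i, (i < n)%N -> \int[P]_w (X n i w ^+ 4) <= C / n%:R ^+ 2) ->
  forall th, \int[P]_w cos (th + \sum_(i < n) X n i w) @[n --> \oo] -->
    expR (- (v / 2)) * cos th.
Proof.
move=> mX iX i1 i2 i4 e1 e2 e4 th.
have v0 : 0 <= v.
  rewrite -[v]divr1 -(e2 1%N 0%N)//; apply: Rintegral_ge0 => w _; exact: sqr_ge0.
have C0 : 0 <= C.
  have := e4 1%N 0%N isT; rewrite expr1n divr1; apply: le_trans.
  by apply: Rintegral_ge0 => w _; rewrite (exprM _ 2 2) sqr_ge0.
pose K := 2 * (C / 24 + v ^+ 2 / 4 + (v + C) / 12).
have bound n : (0 < n)%N -> `|\int[P]_w cos (th + \sum_(i < n) X n i w) -
    expR (- (v / 2)) * cos th| <= K * (Num.sqrt n%:R)^-1.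
  move=> n0; have nR0 : 0 < n%:R :> R by rewrite ltr0n.
  pose q : R := Num.sqrt n%:R.
  have q0 : 0 < q by rewrite sqrtr_gt0.
  have nE : n%:R = q ^+ 2 by rewrite sqr_sqrtr ?ler0n.
  have q1 : 1 <= q.
    by rewrite -[1]sqrtr1 ler_sqrt ?ler1n.
  pose e := (C / 24 + v ^+ 2 / 4 + (v + C) / 12) / q ^+ 3.
  have small i (ni : (i < n)%N) := cf_small (mX n i ni) (i1 n i ni) (i2 n i ni)
    (i4 n i ni) (e1 n i ni) (e2 n i ni) (e4 n i ni) (del := q^-1).
  have iq0 : 0 < q^-1 by rewrite invr_gt0.
  have iq1 : q^-1 <= 1 by rewrite invf_le1.
  have gE : expR (- (v / 2)) = expR (- (v / n%:R / 2)) ^+ n.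
    rewrite -expRM_natl; congr expR.
    by rewrite -mulr_natl; field; rewrite gt_eqF.
  rewrite gE; apply: le_trans.
    apply: (cf_sum (g := expR (- (v / n%:R / 2))) (e := e)).
    - by move=> i; exact: mX.
    - by move=> i; exact: iX.
    - rewrite expR_ge0 -[leRHS]expR0 ler_expR oppr_le0.
      by rewrite !divr_ge0// ltW.
    - move=> i ni; have [+ _] := small i ni iq0; move/le_trans; apply.
      rewrite /e nE.
      have -> : C / q ^+ 2 ^+ 2 / 24 + (v / q ^+ 2 / 2) ^+ 2 =
          (C / 24 + v ^+ 2 / 4) / q ^+ 3 * q^-1 by field; rewrite gt_eqF.
      have h : 0 <= (C / 24 + v ^+ 2 / 4) / q ^+ 3.
        by rewrite divr_ge0 ?exprn_ge0 ?(ltW q0)// addr_ge0// divr_ge0 ?sqr_ge0.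
      have h' : 0 <= (v + C) / 12 / q ^+ 3.
        by rewrite !divr_ge0 ?exprn_ge0 ?(ltW q0)// addr_ge0.
      by rewrite (mulrDl _ _ (q ^+ 3)^-1); nra.
    - move=> i ni; have [_ +] := small i ni iq0; move/le_trans; apply.
      rewrite /e nE.
      have -> : (v / q ^+ 2 * q^-1 + C / q ^+ 2 ^+ 2 / q^-1) / 12 =
        (v + C) / 12 / q ^+ 3 by field; rewrite gt_eqF.
      rewrite ler_wpM2r ?invr_ge0 ?exprn_ge0 ?(ltW q0)// lerDr.
      by rewrite addr_ge0// divr_ge0 ?sqr_ge0.
  by rewrite -/q nE /e /K le_eqVlt; apply/orP; left; apply/eqP; field; rewrite gt_eqF.
apply/cvgrPdist_le => h h0; near=> n.
have n0 : (0 < n)%N by near: n; exact: nbhs_infty_gt.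
rewrite distrC; apply: (le_trans (bound n n0)).
have K0 : 0 <= K by rewrite /K mulr_ge0// !addr_ge0// !divr_ge0 ?sqr_ge0// addr_ge0.
rewrite ler_pdivrMr ?sqrtr_gt0 ?ltr0n// -ler_pdivrMl//.
apply: (@le_trans _ _ (Num.sqrt ((h^-1 * K) ^+ 2))).
  by rewrite sqrtr_sqr ler_norm.
rewrite ler_sqrt ?ler0n//.
near: n; exact: nbhs_infty_ger.
Unshelve. all: by end_near. Qed.

End characteristic_function.

Section normal_cf.
Context (R : realType) (d : measure_display) (Omega : measurableType d)
  (P : probability Omega R).
Context (r : nat) (W : R -> Omega -> 'cV[R]_r) (WP : wiener P W) (k : 'I_r).

(** For every n > 0, x has the law of a sum of n Wiener increments of variance v/n. The sequence in
    [cf_clt] is then eventually constant, equal to the left-hand side, which must be its limit. *)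
Lemma normal_cf (v : R) (x : Omega -> R) : 0 <= v -> normal_rv P v x ->
  forall th, \int[P]_w cos (th + x w) = expR (- (v / 2)) * cos th.
Proof.
move=> v0 nx th; have [mx _] := nx.
pose t n i : R := i%:R * (v / n%:R).
have t0 n i : 0 <= t n i by rewrite mulr_ge0// divr_ge0.
have tS n i : t n i <= t n i.+1.
  by rewrite ler_wpM2r ?divr_ge0// ler_nat.
pose X n i w := W (t n i.+1) w k 0 - W (t n i) w k 0.
have tB n i : t n i.+1 - t n i = v / n%:R.
  by rewrite /t -natr1; ring.
have nX n i : normal_rv P (v / n%:R) (X n i).
  by rewrite -(tB n i); exact: wiener_increment_rv.
have v'0 n : 0 <= v / n%:R by rewrite divr_ge0.
have sX n i w : \sum_(j < i) X n j w = W (t n i) w k 0 - W 0 w k 0.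
  rewrite -(big_mkord xpredT (fun j => X n j w)) telescope_sumr//.
  by rewrite /t mul0r.
(* The fourth moment of N(0, v/n) is 3 (v/n)^2. *)
have := @cf_clt _ _ _ P X v (3 * v ^+ 2).
have h1 n i : (i < n)%N -> measurable_fun setT (X n i) by case: (nX n i).
have h2 n i : (i < n)%N -> indep2 P (fun w => \sum_(j < i) X n j w) (X n i).
  by move=> _; under eq_fun do rewrite sX; exact: wiener_increment_indep.
have i1 n i : (i < n)%N -> P.-integrable setT (EFin \o X n i).
  by move=> _; exact: (integrable_normal_pow WP k (v'0 n) (nX n i) 1).
have i2 n i : (i < n)%N -> P.-integrable setT (EFin \o (fun w => X n i w ^+ 2)).
  by move=> _; exact: (integrable_normal_pow WP k (v'0 n) (nX n i) 2).
have i4 n i : (i < n)%N -> P.-integrable setT (EFin \o (fun w => X n i w ^+ 4)).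
  by move=> _; exact: (integrable_normal_pow WP k (v'0 n) (nX n i) 4).
have e1 n i : (i < n)%N -> \int[P]_w X n i w = 0.
  by move=> _; exact: (normal_moment_odd WP k (v'0 n) (nX n i) (n := 1)).
have e2 n i : (i < n)%N -> \int[P]_w (X n i w ^+ 2) = v / n%:R.
  move=> _; rewrite (normal_moment_even WP k (v'0 n) (nX n i) 1).
  by rewrite big_ord_recl big_ord0 expr1 !mulr1.
have e4 n i : (i < n)%N -> \int[P]_w (X n i w ^+ 4) <= 3 * v ^+ 2 / n%:R ^+ 2.
  move=> _; rewrite (normal_moment_even WP k (v'0 n) (nX n i) 2).
  rewrite !big_ord_recl big_ord0 expr_div_n /= mulrC mulr1 mul1r.
  by rewrite mulrA.
move=> /(_ h1 h2 i1 i2 i4 e1 e2 e4 th).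
have nW := wiener_increment_rv WP k (lexx 0) v0; rewrite subr0 in nW.
have [mW _] := nW.
have ncos : measurable_fun setT (fun s : R => cos (th + s)).
  by apply: measurable_cos_rv; exact: measurable_funD.
have eq n : (0 < n)%N -> \int[P]_w cos (th + \sum_(i < n) X n i w) =
    \int[P]_w cos (th + x w).
  move=> n0; under eq_Rintegral do rewrite sX.
  rewrite /t mulrCA mulfV ?pnatr_eq0 ?gtn_eqF// mulr1.
  apply: (same_law_Rintegral (f := fun s => cos (th + s)) mW mx) => //.
    exact: normal_rv_same_law nW nx.
  by apply: integrable_cos; exact: measurable_funD.
move=> h.
have h' : \int[P]_w cos (th + \sum_(i < n) X n i w) @[n --> \oo] -->
    \int[P]_w cos (th + x w).
  apply: cvg_near_cst; near=> n; apply: eq.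
  by near: n; exact: nbhs_infty_gt.
exact: (cvg_unique _ h' h).
Unshelve. all: by end_near. Qed.

End normal_cf.

(** * Approximation of continuous functions by trigonometric polynomials *)

Section trigonometric_approximation.
Context (R : realType).

(** The triples are (amplitude, frequency, phase). Phases make sines available and close the class
    under products. *)
Definition trigpoly (q : nat) (g : 'cV[R]_q -> R) : Prop :=
  exists s : seq (R * 'cV[R]_q * R), forall x,
    g x = \sum_(u <- s) u.1.1 * cos ((u.1.2^T *m x) 0 0 + u.2).

Section closure.
Context (q : nat).
Implicit Types g h : 'cV[R]_q -> R.

Lemma trigpoly_cst (c : R) : trigpoly (fun _ : 'cV[R]_q => c).
Proof.
exists [:: (c, 0, 0)] => x; rewrite big_seq1 /= trmx0 mul0mx mxE addr0 cos0.
by rewrite mulr1.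
Qed.

Lemma trigpolyD g h : trigpoly g -> trigpoly h -> trigpoly (fun x => g x + h x).
Proof. by move=> [s gE] [t hE]; exists (s ++ t) => x; rewrite big_cat gE hE. Qed.

Lemma trigpoly_sum (I : Type) (s : seq I) (p : pred I) (g : I -> 'cV[R]_q -> R) :
  (forall i, trigpoly (g i)) -> trigpoly (fun x => \sum_(i <- s | p i) g i x).
Proof.
move=> tg; elim: s => [|i s ih].
  by under eq_fun do rewrite big_nil; exact: trigpoly_cst.
under eq_fun do rewrite big_cons.
by case: (p i) => //; apply: trigpolyD.
Qed.

(** Product-to-sum formula for two cosines. *)
Lemma trigpolyM g h : trigpoly g -> trigpoly h -> trigpoly (fun x => g x * h x).
Proof.
move=> [s gE] [t hE].
have -> : (fun x => g x * h x) = fun x => \sum_(u <- s) \sum_(v <- t)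
    (u.1.1 * cos ((u.1.2^T *m x) 0 0 + u.2)) *
    (v.1.1 * cos ((v.1.2^T *m x) 0 0 + v.2)).
  by apply/funext => x; rewrite gE hE big_distrlr.
apply: trigpoly_sum => u; apply: trigpoly_sum => v.
pose c := u.1.1 * v.1.1 / 2.
exists [:: (c, u.1.2 + v.1.2, u.2 + v.2); (c, u.1.2 - v.1.2, u.2 - v.2)] => x.
rewrite big_cons big_seq1 /= linearD linearB /= mulmxDl mulmxBl !mxE.
set A := \sum_j _; set B := \sum_j _.
have -> : A + B + (u.2 + v.2) = (A + u.2) + (B + v.2) by ring.
have -> : A - B + (u.2 - v.2) = (A + u.2) - (B + v.2) by ring.
by rewrite (cosD (A + u.2)) (cosB (A + u.2)) /c; field.
Qed.

Lemma trigpoly_prod (I : Type) (s : seq I) (p : pred I) (g : I -> 'cV[R]_q -> R) :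
  (forall i, trigpoly (g i)) -> trigpoly (fun x => \prod_(i <- s | p i) g i x).
Proof.
move=> tg; elim: s => [|i s ih].
  by under eq_fun do rewrite big_nil; exact: trigpoly_cst.
under eq_fun do rewrite big_cons.
by case: (p i) => //; apply: trigpolyM.
Qed.

Lemma trigpoly_sin (i : 'I_q) (c : R) : trigpoly (fun x => sin (c * x i 0)).
Proof.
exists [:: (1, c *: delta_mx i 0, - (pi / 2))] => x.
rewrite big_seq1 /= mul1r cosBpihalf linearZ /= trmx_delta -scalemxAl -rowE.
by rewrite !mxE.
Qed.

End closure.

Section bernoulli_weights.
Context (I : finType) (y : I -> R).

(** For y with values in [0, 1], the probability that independent Bernoulli variables of parameters
    [y i] take the values [b i]. *)
Definition bernoulli_weight (b : {ffun I -> bool}) : R :=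
  \prod_i (if b i then y i else 1 - y i).

Lemma sum_bernoulli_weight : \sum_b bernoulli_weight b = 1.
Proof.
rewrite -(bigA_distr_bigA (fun i (c : bool) => if c then y i else 1 - y i)).
by apply: big1 => i _; rewrite big_bool /=; ring.
Qed.

(** The summand is a product over the indices, so the sum over b is a product of two-term sums; off
    the diagonal the factor at i is a centred mean, hence 0. *)
Lemma bernoulli_weight_cov (i j : I) :
  \sum_b bernoulli_weight b * ((b i)%:R - y i) * ((b j)%:R - y j) =
  if i == j then y i * (1 - y i) else 0.
Proof.
pose F k (c : bool) := (if c then y k else 1 - y k) *
  (if k == i then c%:R - y i else 1) * (if k == j then c%:R - y j else 1).
transitivity (\sum_(b : {ffun I -> bool}) \prod_k F k (b k)).
  apply: eq_bigr => b _; rewrite /F !big_split /= -!big_mkcond /=.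
  by rewrite !big_pred1_eq.
rewrite -(bigA_distr_bigA F) (bigD1 i)//= big_bool /F eqxx.
case: eqVneq => [<-|ij]; last first.
  rewrite !mulr1 [X in X * _](_ : _ = 0) ?mul0r//= ?(negbTE ij) mulr1n mulr0n; ring.
rewrite big1 ?mulr1 => [|k ki] /=; first by rewrite mulr1n mulr0n; ring.
by rewrite big_bool (negbTE ki) /=; ring.
Qed.

End bernoulli_weights.

Lemma bernoulli_weight_ge0 (I : finType) (y : I -> R) b :
  (forall i, 0 <= y i <= 1) -> 0 <= bernoulli_weight y b.
Proof.
move=> y01; apply: prodr_ge0 => i _; have /andP[? ?] := y01 i.
by case: ifP; rewrite ?subr_ge0.
Qed.

End trigonometric_approximation.

Section approximation.
Context (R : realType).

(** Heine's theorem with x in the box and z unrestricted. Compactness of the box is obtained for row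
    vectors, hence the transposes. *)
Lemma unif_continuous_box (q : nat) (f : 'cV[R]_q -> R) (c e : R) :
  continuous f -> 0 < e -> exists2 del, 0 < del &
    forall x z : 'cV[R]_q, (forall i, `|x i 0| <= c) ->
      (forall i, `|x i 0 - z i 0| < del) -> `|f x - f z| < e.
Proof.
move=> cf e0.
have cK := @rV_compact R q (fun _ => `[- c, c]%classic)
  (fun _ => @segment_compact R (- c) c).
move/compact_near_coveringP : cK => cK.
pose Q (del : R) (x : 'rV[R]_q) := forall z : 'cV[R]_q,
  (forall i, `|x 0 i - z i 0| < del) -> `|f x^T - f z| < e.
have := cK R (0^'+) Q _ _.
have H (x : 'rV[R]_q) : (\forall x' \near x & del \near 0^'+, Q del x').
  have e20 : 0 < e / 2 by rewrite divr_gt0.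
  have := cf x^T; move=> /cvgrPdist_lt /(_ _ e20) /nbhs_ballP[h /= h0 hf].
  have hb (z : 'cV[R]_q) : (forall i, `|x 0 i - z i 0| < h) -> `|f x^T - f z| < e / 2.
    by move=> xz; apply: hf; split=> // i j; rewrite /ball /= mxE ord1; exact: xz.
  exists (ball x (h / 2), [set del | del < h / 2]) => /=.
    split; first by apply: nbhsx_ballx; rewrite divr_gt0.
    by apply: nbhs_right_lt; rewrite divr_gt0.
  move=> [x' del] /= [[_ xx'] dh] z x'z.
  rewrite (splitr e) -(subrKA (f x^T)).
  apply: (le_lt_trans (ler_normD _ _)); rewrite ltrD//.
    rewrite distrC hb// => i; rewrite mxE.
    by apply: lt_trans (xx' 0 i) _; rewrite ltr_pdivrMr// ltr_pMr// ltr1n.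
  apply: hb => i; rewrite (splitr h) -(subrKA (x' 0 i)).
  apply: (le_lt_trans (ler_normD _ _)); rewrite ltrD//; first exact: xx'.
  by apply: (lt_trans (x'z i)).
move=> /(_ _ (fun x _ => H x)) hQ.
have [del [/= del0 QK]] := filter_ex (filterI (nbhs_right_gt (0 : R)) hQ).
exists del => // x z xc xz.
have := QK x^T; rewrite /= /Q trmxK; apply.
  by move=> i; rewrite in_itv /= -ler_norml mxE.
by move=> i; rewrite mxE.
Qed.

Lemma cos_ge_half (t : R) : `|t| <= 1 -> 1 / 2 <= cos t.
Proof.
move=> t1; have h := cos_gex (normr_ge0 t).
have -> : cos t = cos `|t| by case: ger0P => // _; rewrite cosN.
have := normr_ge0 t; nra.
Qed.

Lemma sin_inv_lipschitz (th phi : R) : `|th| <= 1 -> `|phi| <= 1 ->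
  `|th - phi| <= 2 * `|sin th - sin phi|.
Proof.
move=> t1 p1; wlog tp : th phi t1 p1 / phi <= th.
  move=> h; have [/h|/ltW/h] := leP phi th; first exact.
  by rewrite distrC (distrC (sin th)); apply.
have [c] := @MVT_segment R (@sin R) (@cos R) phi th tp (fun x _ => is_derive_sin x)
  (continuous_subspaceT (@continuous_sin R)).
rewrite in_itv /= => /andP[pc ct] ->.
have : 1 / 2 <= cos c.
  apply: cos_ge_half; rewrite ler_norml.
  by move: t1 p1; rewrite !ler_norml => /andP[_ /(le_trans ct) ->] /andP[/le_trans -> ].
move=> c2; have tp0 : 0 <= th - phi by rewrite subr_ge0.
rewrite normrM (ger0_norm tp0) ger0_norm; last by apply: le_trans c2; lra.
nra.
Qed.

Lemma ler_sin1 (th : R) : `|th| <= 1 -> `|sin th| <= sin 1.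
Proof.
have le1 (t : R) : 0 <= t -> t <= 1 -> sin t <= sin 1.
  move=> t0 t1.
  have [c] := @MVT_segment R (@sin R) (@cos R) t 1 t1 (fun x _ => is_derive_sin x)
    (continuous_subspaceT (@continuous_sin R)).
  rewrite in_itv /= => /andP[tc c1] e; rewrite -subr_ge0 e.
  rewrite mulr_ge0 ?subr_ge0//; apply: (@le_trans _ _ (1 / 2)); first lra.
  by apply: cos_ge_half; rewrite ger0_norm ?(le_trans t0).
have pos (t : R) : 0 <= t -> t <= 1 -> 0 <= sin t.
  move=> t0 t1; have := sin_gex t0; have := mulr_ge0 t0 (sqr_ge0 t).
  have : t ^+ 2 <= 1 by rewrite exprn_ile1.
  have : t ^+ 3 <= t by rewrite -[leRHS]mulr1 exprS ler_wpM2l// exprn_ile1.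
  lra.
move=> t1; have -> : `|sin th| = sin `|th|.
  have [t0|t0] := leP 0 th.
    by rewrite !ger0_norm// pos//; move: t1; rewrite ger0_norm.
  rewrite (ltr0_norm t0) -normrN -sinN ger0_norm//.
  by apply: pos; [lra|move: t1; rewrite ltr0_norm].
by apply: le1.
Qed.

(** phi is the arcsine of t clamped to [- sin 1, sin 1]. Clamping does not move t away from sin th,
    and the sine has derivative at least 1/2 on [-1, 1]. *)
Lemma sin_node (t : R) : exists phi, `|phi| <= 1 /\
  forall th, `|th| <= 1 -> `|th - phi| <= 2 * `|sin th - t|.
Proof.
have s1 : 0 <= sin 1 :> R by apply: le_trans (ler_sin1 (_ : `|0| <= 1)); rewrite ?normr0.
pose t' := Num.max (- sin 1) (Num.min t (sin 1)).
have t'b : - sin 1 <= t' <= sin 1.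
  by rewrite le_max lexx /= ge_max ge_min lexx orbT andbT; lra.
have [|||phi] := @IVT R (@sin R) (-1) 1 t'.
- lra.
- exact: continuous_subspaceT (@continuous_sin R).
- by rewrite sinN min_l ?max_r//; lra.
rewrite in_itv /= -ler_norml => p1 sp; exists phi; split=> // th t1.
apply: le_trans (sin_inv_lipschitz t1 p1) _; rewrite ler_wpM2l// sp.
have := ler_sin1 t1; rewrite ler_norml => /andP[sl sr].
rewrite /t'; have [h1|h1] := leP t (sin 1).
  have [h2//|h2] := leP (- sin 1) t.
  by rewrite !ger0_norm; lra.
rewrite max_r; last lra.
by rewrite !ler0_norm; lra.
Qed.

End approximation.

Section trig_approx.
Context (R : realType).

(** The variance of the mean of N independent Bernoulli variables is y (1 - y) / N, and y (1 - y) <=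
    1/4. *)
Lemma bernoulli_mean_variance (q N : nat) (y : 'I_q -> R) (i : 'I_q) :
  (0 < N)%N -> (forall j, 0 <= y j <= 1) ->
  \sum_(b : {ffun 'I_q * 'I_N -> bool}) bernoulli_weight (fun t => y t.1) b *
    ((\sum_(l < N) (b (i, l))%:R) / N%:R - y i) ^+ 2 <= (4 * N%:R)^-1.
Proof.
move=> N0 y01; have NR : 0 < N%:R :> R by rewrite ltr0n.
set wt := bernoulli_weight _.
have E b : wt b * ((\sum_(l < N) (b (i, l))%:R) / N%:R - y i) ^+ 2 =
    N%:R ^- 2 * \sum_(l < N) \sum_(m < N)
      wt b * ((b (i, l))%:R - y i) * ((b (i, m))%:R - y i).
  have -> : (\sum_(l < N) (b (i, l))%:R) / N%:R - y i =
      N%:R^-1 * \sum_(l < N) ((b (i, l))%:R - y i).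
    rewrite sumrB sumr_const card_ord -mulr_natr.
    by field; rewrite gt_eqF.
  rewrite exprMn exprVn mulrCA; congr (_ * _).
  rewrite expr2 big_distrlr /= mulr_sumr; apply: eq_bigr => l _.
  by rewrite mulr_sumr; apply: eq_bigr => m _; rewrite mulrA.
under eq_bigr do rewrite E.
rewrite -mulr_sumr exchange_big /=.
under eq_bigr => l _.
  rewrite exchange_big /=.
  under eq_bigr => m _.
    rewrite (bernoulli_weight_cov (fun t => y t.1) (i, l) (i, m)) /=.
    over.
  rewrite (bigD1 l)//= eqxx big1 ?addr0 => [|m ml]; last first.
    by rewrite xpair_eqE eqxx /= eq_sym (negbTE ml).
  over.
rewrite sumr_const card_ord -[(_ * _) *+ N]mulr_natl.
have -> : N%:R ^- 2 * (N%:R * (y i * (1 - y i))) = N%:R^-1 * (y i * (1 - y i)).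
  by field; rewrite gt_eqF.
rewrite invfM mulrC ler_wpM2r ?invr_ge0 ?ler0n//.
have := sqr_ge0 (y i - 1 / 2); lra.
Qed.

(** Bernstein's proof in several variables, with parameters y_i(x) = (1 + sin(x_i / c)) / 2. The
    approximant averages f over random points z(b) determined by N Bernoulli trials per coordinate.
    The weights are trigonometric polynomials in x; they are nonnegative with sum 1, so the bound M
    holds everywhere; and z(b) concentrates near x when x is in the box. *)
Lemma trig_approx (q : nat) (f : 'cV[R]_q -> R) (M c e : R) :
  continuous f -> (forall x, `|f x| <= M) -> 0 < c -> 0 < e ->
  exists g : 'cV[R]_q -> R, [/\ trigpoly g, forall x, `|g x| <= M &
    forall x : 'cV[R]_q, (forall i, `|x i 0| <= c) -> `|f x - g x| <= e].
Proof.
move=> cf fM c0 e0.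
have M0 : 0 <= M by apply: le_trans (normr_ge0 _) (fM 0).
have e20 : 0 < e / 2 by rewrite divr_gt0.
have [del del0 fdel] := unif_continuous_box c cf e20.
(* Some |x_i - z_i| >= del forces |k_i - y_i| >= del / (4c), and D (k_i - y_i)^2 then reaches 2M,
   the largest possible gap between two values of f. *)
pose D := 32 * M * c ^+ 2 / del ^+ 2.
have D0 : 0 <= D.
  by rewrite /D divr_ge0 ?sqr_ge0// !mulr_ge0 ?(ltW c0).
(* Large enough for D times the total variance, at most q / (4N), to be below e / 2. *)
pose N := (Num.bound (D * q%:R / (2 * e))).+1.
have NR : 0 < N%:R :> R by rewrite ltr0n.
have Nbig : D * q%:R / (4 * N%:R) <= e / 2.
  have : D * q%:R / (2 * e) < N%:R.
    apply: (@lt_le_trans _ _ (Num.bound (D * q%:R / (2 * e)))%:R).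
      apply: archi_boundP.
      by rewrite (divr_ge0 (mulr_ge0 D0 (ler0n _ _)))// mulr_ge0 ?(ltW e0).
    by rewrite ler_nat.
  rewrite ltr_pdivrMr ?mulr_gt0// ler_pdivrMr ?mulr_gt0//; lra.
have [node nodeP] : exists node : R -> R, forall t, `|node t| <= 1 /\
    forall th, `|th| <= 1 -> `|th - node t| <= 2 * `|sin th - t|.
  by exists (fun t => projT1 (cid (sin_node t))) => t; case: cid.
pose y (x : 'cV[R]_q) (i : 'I_q) : R := 2^-1 * (1 + sin (c^-1 * x i 0)).
pose kk (b : {ffun 'I_q * 'I_N -> bool}) i : R := (\sum_(l < N) (b (i, l))%:R) / N%:R.
(* The frequency [kk b i] estimates y_i(x); [node] inverts the sine, which recovers x_i
   approximately. *)
pose z b : 'cV[R]_q := \col_i (c * node (2 * kk b i - 1)).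
pose wt x := bernoulli_weight (fun t : 'I_q * 'I_N => y x t.1).
pose g x := \sum_(b : {ffun 'I_q * 'I_N -> bool}) wt x b * f (z b).
have y01 x i : 0 <= y x i <= 1.
  rewrite /y; have := sin_geN1 (c^-1 * x i 0); have := sin_le1 (c^-1 * x i 0).
  by move=> h1 h2; apply/andP; split; lra.
have wt0 x b : 0 <= wt x b by apply: bernoulli_weight_ge0 => -[].
have wt1 x : \sum_b wt x b = 1 by exact: sum_bernoulli_weight.
exists g; split.
- apply: trigpoly_sum => b; apply: trigpolyM; last exact: trigpoly_cst.
  apply: trigpoly_prod => t.
  have ty : trigpoly (fun x => y x t.1).
    apply: trigpolyM; first exact: trigpoly_cst.
    by apply: trigpolyD; [exact: trigpoly_cst|exact: trigpoly_sin].
  case: (b t) => //.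
  have -> : (fun x => 1 - y x t.1) = fun x => 1 + (-1) * y x t.1.
    by apply/funext => x; rewrite mulN1r.
  apply: trigpolyD; first exact: trigpoly_cst.
  by apply: trigpolyM => //; exact: trigpoly_cst.
- move=> x; apply: le_trans (ler_norm_sum _ _ _) _.
  rewrite -[leRHS]mul1r -(wt1 x) mulr_suml; apply: ler_sum => b _.
  by rewrite normrM ger0_norm ?wt0// ler_wpM2l.
move=> x xc.
have -> : f x - g x = \sum_b wt x b * (f x - f (z b)).
  under [RHS]eq_bigr do rewrite mulrBr.
  by rewrite sumrB -mulr_suml wt1 mul1r.
apply: le_trans (ler_norm_sum _ _ _) _.
have bound b : `|f x - f (z b)| <= e / 2 + D * \sum_i (kk b i - y x i) ^+ 2.
  have S0 : 0 <= \sum_i (kk b i - y x i) ^+ 2 by apply: sumr_ge0 => i _; exact: sqr_ge0.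
  have [near|/existsNP[i /negP]] :=
    pselect (forall i, `|x i 0 - z b i 0| < del).
    apply: (le_trans (ltW (fdel x (z b) xc near))).
    by rewrite lerDl (mulr_ge0 D0 S0).
  rewrite -leNgt => far.
  have th1 : `|c^-1 * x i 0| <= 1.
    by rewrite normrM gtr0_norm ?invr_gt0// mulrC ler_pdivrMr// mul1r.
  have [_ /(_ _ th1) h] := nodeP (2 * kk b i - 1).
  have hd : del <= 4 * c * `|kk b i - y x i|.
    apply: (le_trans far).
    have -> : x i 0 - z b i 0 = c * (c^-1 * x i 0 - node (2 * kk b i - 1)).
      by rewrite mxE; field; rewrite gt_eqF.
    rewrite normrM gtr0_norm// (mulrC 4 c) -mulrA ler_wpM2l ?(ltW c0)//.
    apply: (le_trans h).
    have -> : sin (c^-1 * x i 0) - (2 * kk b i - 1) = (- 2) * (kk b i - y x i).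
      by rewrite /y; field.
    by rewrite normrM normrN normr_nat mulrA -natrM.
  have hd2 : del ^+ 2 <= 16 * c ^+ 2 * (kk b i - y x i) ^+ 2.
    have -> : 16 * c ^+ 2 * (kk b i - y x i) ^+ 2 =
        (4 * c * `|kk b i - y x i|) ^+ 2.
      by rewrite !exprMn real_normK ?num_real//; ring.
    by rewrite ler_pXn2r ?nnegrE// ?(ltW del0)// (le_trans (ltW del0)).
  apply: (@le_trans _ _ (2 * M)).
    by apply: le_trans (ler_normB _ _) _; have := fM x; have := fM (z b); lra.
  have : (kk b i - y x i) ^+ 2 <= \sum_i (kk b i - y x i) ^+ 2.
    by rewrite (bigD1 i)//= lerDl sumr_ge0// => j _; exact: sqr_ge0.
  move=> /(ler_wpM2l D0) hS.
  have hD : 2 * M <= D * (kk b i - y x i) ^+ 2.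
    have -> : D * (kk b i - y x i) ^+ 2 =
        (2 * M) * ((16 * c ^+ 2 * (kk b i - y x i) ^+ 2) / del ^+ 2).
      by rewrite /D; field; rewrite gt_eqF.
    rewrite ler_peMr ?mulr_ge0// ler_pdivlMr ?exprn_gt0//.
    by rewrite mul1r.
  lra.
apply: (@le_trans _ _ (\sum_b (wt x b * (e / 2) +
    D * \sum_i wt x b * (kk b i - y x i) ^+ 2))).
  apply: ler_sum => b _; rewrite normrM ger0_norm ?wt0//.
  apply: le_trans (ler_wpM2l (wt0 x b) (bound b)) _.
  by rewrite mulrDr lerD2l -mulr_sumr mulrCA.
rewrite big_split /= -mulr_suml wt1 mul1r -mulr_sumr exchange_big /=.
rewrite [leRHS](splitr e) lerD2l; apply: le_trans Nbig.
rewrite -mulrA ler_wpM2l//.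
apply: (@le_trans _ _ (\sum_(i < q) (4 * N%:R)^-1)).
  apply: ler_sum => i _; apply: (bernoulli_mean_variance (y := y x)) => //.
by rewrite sumr_const card_ord -[leLHS]mulr_natl.
Qed.

End trig_approx.

(** * Random vectors, tightness and convergence in distribution *)

Section random_vectors.
Context (R : realType) (d : measure_display) (Omega : measurableType d)
  (P : probability Omega R).

Lemma random_vector_dot (q : nat) (Z : Omega -> 'cV[R]_q) (a : 'cV[R]_q) :
  random_vector Z -> measurable_fun setT (fun w => (a^T *m Z w) 0 0).
Proof.
move=> mZ; under eq_fun do rewrite mxE.
by apply: measurable_sum => i; apply: measurable_funM; [exact: measurable_cst|exact: mZ].
Qed.

Lemma trigpoly_measurable (q : nat) (Z : Omega -> 'cV[R]_q)
    (g : 'cV[R]_q -> R) :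
  random_vector Z -> trigpoly g -> measurable_fun setT (fun w => g (Z w)).
Proof.
move=> mZ [s gE]; under eq_fun do rewrite gE.
apply: measurable_sum => u; apply: measurable_funM => //.
apply: measurable_cos_rv; apply: measurable_funD => //; exact: random_vector_dot.
Qed.

(** Measurability of Z is given by coordinates only. It passes to trigonometric polynomials of Z and
    then to their pointwise limit, with boxes of radius n + 1 and errors 1 / (n + 1). *)
Lemma bounded_continuous_measurable (q : nat) (Z : Omega -> 'cV[R]_q)
    (f : 'cV[R]_q -> R) (M : R) :
  random_vector Z -> continuous f -> (forall x, `|f x| <= M) ->
  measurable_fun setT (fun w => f (Z w)).
Proof.
move=> mZ cf fM.
have cN (n : nat) : 0 < n.+1%:R :> R by rewrite ltr0n.
have eN (n : nat) : 0 < n.+1%:R^-1 :> R by rewrite invr_gt0.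
pose g n := projT1 (cid (trig_approx cf fM (cN n) (eN n))).
have gP n : [/\ trigpoly (g n), forall x, `|g n x| <= M &
    forall x : 'cV[R]_q, (forall i, `|x i 0| <= n.+1%:R) -> `|f x - g n x| <= n.+1%:R^-1].
  by rewrite /g; case: cid.
apply: (@measurable_fun_cvg _ _ _ _ (fun n w => g n (Z w))).
  by move=> n; apply: trigpoly_measurable => //; case: (gP n).
move=> w _; apply/cvgrPdist_le => e e0; near=> n.
have [_ _ h] := gP n; apply: (le_trans (h _ _)).
  move=> i; apply: (@le_trans _ _ (\sum_i `|Z w i 0|)).
    by rewrite (bigD1 i)//= lerDl sumr_ge0.
  apply: (@le_trans _ _ n%:R); last by rewrite ler_nat.
  by near: n; exact: nbhs_infty_ger.
rewrite -[leRHS]invrK lef_pV2 ?posrE ?invr_gt0//.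
apply: (@le_trans _ _ n%:R); last by rewrite ler_nat.
by near: n; exact: nbhs_infty_ger.
Unshelve. all: by end_near. Qed.

Lemma measurable_normr_gt (x : Omega -> R) (c : R) : measurable_fun setT x ->
  measurable [set w | c < `|x w|].
Proof.
move=> mx; have mn : measurable_fun setT (fun w => `|x w|).
  by apply: measurableT_comp mx.
have -> : [set w | c < `|x w|] = setT `&` (fun w => `|x w|) @^-1` `]c, +oo[.
  by apply/seteqP; split => w /=; rewrite in_itv /= andbT; [split|case].
exact: mn.
Qed.

Lemma Rintegral_indicator (A : set Omega) : measurable A ->
  \int[P]_w \1_A w = fine (P A).
Proof. by move=> mA; rewrite /Rintegral integral_indic// setIT. Qed.

Lemma integrable_indicator (A : set Omega) : measurable A ->
  P.-integrable setT (EFin \o \1_A).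
Proof. by move=> mA; exact: integrable_indic. Qed.

Lemma markov_sqr (x : Omega -> R) (c : R) : 0 < c -> measurable_fun setT x ->
  P.-integrable setT (EFin \o (fun w => x w ^+ 2)) ->
  (P [set w | (c < `|x w|)%R] <= (c ^- 2 * \int[P]_w (x w ^+ 2))%R%:E)%E.
Proof.
move=> c0 mx ix; have mA := measurable_normr_gt c mx.
rewrite -[X in (X <= _)%E]fineK ?fin_num_measure// lee_fin -Rintegral_indicator//.
rewrite -RintegralZl//; apply: le_Rintegral => //.
- exact: integrable_indicator.
- exact: integrable_scaler.
move=> w _; rewrite indicE; case: (boolP (w \in _)) => [|_]; last first.
  by rewrite mulr_ge0 ?invr_ge0 ?sqr_ge0.
rewrite inE /= => cx; rewrite mulrC ler_pdivlMr ?exprn_gt0// mul1r.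
by rewrite -[x w ^+ 2]real_normK ?num_real// ler_pXn2r ?nnegrE ?(ltW c0) ?(ltW cx).
Qed.

End random_vectors.

Lemma cvg_sumr (R : realType) (I : Type) (s : seq I) (u : I -> nat -> R) (l : I -> R) :
  (forall i, u i n @[n --> \oo] --> l i) ->
  \sum_(i <- s) u i n @[n --> \oo] --> \sum_(i <- s) l i.
Proof.
move=> ul; elim: s => [|i s ih].
  by rewrite big_nil; under eq_cvg do rewrite big_nil; exact: cvg_cst.
rewrite big_cons; under eq_cvg do rewrite big_cons; exact: cvgD.
Qed.

Section weak_convergence.
Context (R : realType) (d : measure_display) (Omega : measurableType d)
  (P : probability Omega R).
Context (d' : measure_display) (Omega' : measurableType d')
  (P' : probability Omega' R).

(** Tightness by coordinates and for large n only. A union bound over the q coordinates brings it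
    back to boxes. *)
Definition tight (d0 : measure_display) (O : measurableType d0)
    (Q : probability O R) (q : nat) (Z : nat -> O -> 'cV[R]_q) : Prop :=
  forall e : R, 0 < e -> exists2 c : R, 0 < c &
    \forall n \near \oo, forall i,
      (Q [set w | (c < `|Z n w i 0|)%R] <= e%:E)%E.

(** Outside the box f and g differ by at most 2M, and by a union bound Z leaves the box with
    probability at most q e'. *)
Lemma Rintegral_approx (d0 : measure_display) (O : measurableType d0)
    (Q : probability O R) (q : nat) (Z : O -> 'cV[R]_q)
    (f g : 'cV[R]_q -> R) (M c e e' : R) :
  random_vector Z -> measurable_fun setT (f \o Z) -> measurable_fun setT (g \o Z) ->
  0 <= M -> 0 <= e ->
  (forall x, `|f x| <= M) -> (forall x, `|g x| <= M) ->
  (forall x : 'cV[R]_q, (forall i, `|x i 0| <= c) -> `|f x - g x| <= e) ->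
  (forall i, (Q [set w | (c < `|Z w i 0|)%R] <= e'%:E)%E) ->
  `|\int[Q]_w f (Z w) - \int[Q]_w g (Z w)| <= e + 2 * M * q%:R * e'.
Proof.
move=> mZ mf mg M0 e0 fM gM fg tZ.
have if_ : Q.-integrable setT (EFin \o (f \o Z)).
  by apply: (integrable_bound mf (integrable_cst Q M)) => w; exact: fM.
have ig : Q.-integrable setT (EFin \o (g \o Z)).
  by apply: (integrable_bound mg (integrable_cst Q M)) => w; exact: gM.
have ifg := integrable_subr if_ ig.
rewrite -RintegralB//; apply: (le_trans (le_normr_Rintegral _ ifg)) => //.
pose A i := [set w | c < `|Z w i 0|].
have mA i : measurable (A i) by exact: measurable_normr_gt.
have iA : Q.-integrable setT (EFin \o (fun w => \sum_i \1_(A i) w)).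
  by apply: integrable_sumr => i _; exact: integrable_indicator.
apply: (@le_trans _ _ (\int[Q]_w (e + 2 * M * \sum_i \1_(A i) w))).
  apply: le_Rintegral => //.
  - exact: integrable_norm.
  - by apply: integrable_addr; [exact: integrable_cst|exact: integrable_scaler].
  move=> w _ /=; have [h|/existsNP[i hi]] := pselect (forall i, `|Z w i 0| <= c).
    apply: (le_trans (fg _ h)); rewrite lerDl mulr_ge0 ?mulr_ge0//.
    by apply: sumr_ge0 => i _; rewrite indicE.
  have Ai : 1 <= \sum_i \1_(A i) w :> R.
    rewrite (bigD1 i)//= indicE mem_set; last first.
      by rewrite /A /= ltNge; apply/negP.
    by rewrite lerDl sumr_ge0// => j _; rewrite indicE.
  apply: (@le_trans _ _ (2 * M)).
    apply: le_trans (ler_normB _ _) _; have := fM (Z w); have := gM (Z w); lra.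
  have : 2 * M * 1 <= 2 * M * \sum_i \1_(A i) w by rewrite ler_wpM2l// mulr_ge0.
  lra.
rewrite RintegralD//; last 2 first.
- exact: integrable_cst.
- exact: integrable_scaler.
rewrite Rintegral_cstT lerD2l RintegralZl// Rintegral_sum; last first.
  by move=> i _; exact: integrable_indicator.
rewrite -[leRHS](mulrA (2 * M)) ler_wpM2l ?mulr_ge0//.
apply: (@le_trans _ _ (\sum_(i < q) e')).
  apply: ler_sum => i _; rewrite Rintegral_indicator// -lee_fin fineK ?fin_num_measure//.
  exact: tZ.
by rewrite sumr_const card_ord -[leLHS]mulr_natl.
Qed.

Lemma expectation_Rintegral (d0 : measure_display) (O : measurableType d0)
    (Q : probability O R) (x : O -> R) : Q.-integrable setT (EFin \o x) ->
  'E_Q[x]%E = (\int[Q]_w x w)%:E.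
Proof.
by move=> ix; rewrite unlock /Rintegral fineK//; exact: integrable_fin_num.
Qed.

(** f is replaced by a trigonometric polynomial g, at cost 2e/5 under each of the two laws; the
    integrals of g converge, being finite combinations of the assumed limits, which costs the last
    e/5. *)
Lemma cvg_distribution_cf (q : nat) (Z : nat -> Omega -> 'cV[R]_q)
    (Y : Omega' -> 'cV[R]_q) :
  (forall n, random_vector (Z n)) -> random_vector Y ->
  (forall (a : 'cV[R]_q) (th : R),
     \int[P]_w cos (th + (a^T *m Z n w) 0 0) @[n --> \oo] -->
     \int[P']_w cos (th + (a^T *m Y w) 0 0)) ->
  tight P Z -> tight P' (fun _ => Y) -> cvg_distribution P P' Z Y.
Proof.
move=> mZ mY cfZ tZ tY f cf [M fM].
have M0 : 0 <= M by apply: le_trans (normr_ge0 _) (fM 0).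
have mfZ n := bounded_continuous_measurable (mZ n) cf fM.
have mfY := bounded_continuous_measurable mY cf fM.
have ifZ n : P.-integrable setT (EFin \o (fun w => f (Z n w))).
  by apply: (integrable_bound (mfZ n) (integrable_cst P M)) => w; exact: fM.
have ifY : P'.-integrable setT (EFin \o (fun w => f (Y w))).
  by apply: (integrable_bound mfY (integrable_cst P' M)) => w; exact: fM.
under eq_cvg do rewrite expectation_Rintegral//.
rewrite expectation_Rintegral//; apply: cvg_EFin; first exact: nearW.
apply/cvgrPdist_le => e e0.
(* Makes the tail term 2 M q e' at most e/5; the added 1 keeps the denominator positive. *)
pose e' := e / 5 / (2 * M * q%:R + 1).
have K0 : 0 < 2 * M * q%:R + 1 by rewrite ltr_wpDl// !mulr_ge0.
have e'0 : 0 < e' by rewrite !divr_gt0.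
have e'b : 2 * M * q%:R * e' <= e / 5.
  have -> : e / 5 = (2 * M * q%:R + 1) * e'.
    by rewrite /e'; field; rewrite gt_eqF.
  by rewrite -subr_ge0 -mulrBl addrAC subrr add0r mul1r ltW.
have [c1 c10 tZ1] := tZ e' e'0; have [c2 c20 tY1] := tY e' e'0.
have e50 : 0 < e / 5 by rewrite divr_gt0.
have mono (d0 : measure_display) (O : measurableType d0) (Q : probability O R)
    (x : O -> R) (a b : R) : measurable_fun setT x -> a <= b ->
    (Q [set w | (a < `|x w|)%R] <= e'%:E)%E -> (Q [set w | (b < `|x w|)%R] <= e'%:E)%E.
  move=> mx ab; apply: le_trans; apply: le_measure; rewrite ?inE.
  - exact: measurable_normr_gt.
  - exact: measurable_normr_gt.
  - by move=> w /=; exact: le_lt_trans.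
pose c := Num.max c1 c2.
have c0 : 0 < c by rewrite lt_max c10.
have [g [tg gM fg]] := trig_approx cf fM c0 e50.
have mgZ n := trigpoly_measurable (mZ n) tg.
have mgY := trigpoly_measurable mY tg.
have gcvg : \int[P]_w g (Z n w) @[n --> \oo] --> \int[P']_w g (Y w).
  have [s gE] := tg.
  have E (d0 : measure_display) (O : measurableType d0) (Q : probability O R)
      (X : O -> 'cV[R]_q) : random_vector X -> \int[Q]_w g (X w) =
      \sum_(u <- s) u.1.1 * \int[Q]_w cos (u.2 + (u.1.2^T *m X w) 0 0).
    move=> mX; under eq_Rintegral do rewrite gE.
    have ic (u : R * 'cV[R]_q * R) : Q.-integrable setT
        (EFin \o (fun w => cos ((u.1.2^T *m X w) 0 0 + u.2))).
      apply: integrable_cos; apply: measurable_funD => //.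
      exact: random_vector_dot.
    rewrite Rintegral_sum => [|u _]; last exact: integrable_scaler.
    apply: eq_bigr => u _; rewrite RintegralZl//; congr (_ * _).
    by under eq_Rintegral do rewrite addrC.
  rewrite (E _ _ P' Y mY); under eq_cvg do rewrite (E _ _ P _ (mZ _)).
  by apply: cvg_sumr => u; apply: cvgMl_tmp; exact: cfZ.
have YY : `|\int[P']_w f (Y w) - \int[P']_w g (Y w)| <= e / 5 + e / 5.
  apply: le_trans (Rintegral_approx mY mfY mgY M0 (ltW e50) fM gM fg (e' := e') _) _.
  - have [m _ /(_ m (leqnn m)) h] := tY1.
    by move=> i; apply: mono (h i); [exact: mY|rewrite le_max lexx orbT].
  - by rewrite lerD2l.
move/cvgrPdist_le : gcvg => /(_ _ e50) gcvg.
near=> n.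
have ZZ : `|\int[P]_w f (Z n w) - \int[P]_w g (Z n w)| <= e / 5 + e / 5.
  apply: le_trans (Rintegral_approx (mZ n) (mfZ n) (mgZ n) M0 (ltW e50) fM gM fg
    (e' := e') _) _.
  - have h : forall i, (P [set w | (c1 < `|Z n w i 0|)%R] <= e'%:E)%E.
      by near: n.
    by move=> i; apply: mono (h i); [exact: mZ|rewrite le_max lexx].
  - by rewrite lerD2l.
have gg : `|\int[P']_w g (Y w) - \int[P]_w g (Z n w)| <= e / 5 by near: n.
move: YY ZZ gg; rewrite !ler_norml => /andP[? ?] /andP[? ?] /andP[? ?].
by apply/andP; split; rewrite /=; lra.
Unshelve. all: by end_near. Qed.

End weak_convergence.

(** * Vectorization, Kronecker product and duplication matrix *)

Lemma enum_rank_pair (m n : nat) (i : 'I_m) (j : 'I_n) :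
  enum_rank (i, j) = (i * n + j)%N :> nat.
Proof.
pose v (u : 'I_m * 'I_n) : nat := (u.1 * n + u.2)%N.
have vinj : injective v.
  move=> [a b] [a' b'] /eqP; rewrite /v /= => /eqP e.
  have n0 : (0 < n)%N by apply: leq_ltn_trans (ltn_ord b).
  have /val_inj -> : val a = val a'.
    have := congr1 (divn^~ n) e.
    by rewrite !divnMDl// !divn_small// !addn0.
  have /val_inj -> // : val b = val b'.
    have := congr1 (modn^~ n) e.
    by rewrite !modnMDl !modn_small.
have -> : enum_rank (i, j) = index (v (i, j)) (map v (enum {: 'I_m * 'I_n})) :> nat.
  rewrite index_map// -[in RHS](enum_rankK (i, j)) /enum_val.
  by rewrite index_uniq ?enum_uniq// -cardE.
have lt : (v (i, j) < m * n)%N.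
  rewrite /v /=; apply: (@leq_trans (i.+1 * n)); last by rewrite leq_mul2r ltn_ord orbT.
  by rewrite mulSn addnC ltn_add2r.
suff -> : map v (enum {: 'I_m * 'I_n}) = iota 0 (m * n).
  rewrite -[X in index X _]add0n -(nth_iota 0 0 lt) index_uniq ?iota_uniq//.
  by rewrite size_iota.
rewrite enumT unlock /prod_enum.
have e2 (k : nat) : map (fun j : 'I_n => (k * n + j)%N) (enum 'I_n) = iota (k * n) n.
  by rewrite -[X in iota X]addn0 iotaDl -val_enum_ord -map_comp.
have -> : map v [seq (x1, x2) | x1 <- enum 'I_m, x2 <- enum 'I_n] =
    flatten [seq iota (k * n) n | k <- map val (enum 'I_m)].
  rewrite map_allpairs /allpairs_dep /= -map_comp; congr flatten.
  by apply: eq_map => k /=; rewrite -e2 -?map_comp.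
rewrite val_enum_ord {i j v vinj lt}; elim: m => [//|m ih].
rewrite -[in LHS]addn1 iotaD map_cat flatten_cat ih /= cats0 add0n.
by rewrite mulSn addnC iotaD.
Qed.

(** Vectorization orders pairs by enumeration rank and the Kronecker product by the formula i n + j.
    [enum_rank_pair] shows that these orders agree, so the two can be multiplied entrywise. *)
Lemma mxvec_index_tens (m n : nat) (i : 'I_m) (j : 'I_n) :
  mxvec_index i j = mxtens_index (i, j).
Proof. by apply: val_inj; rewrite /= enum_rank_pair. Qed.

Lemma sum4_exchange (R : realType) (I J K L : finType) (F : I -> J -> K -> L -> R) :
  \sum_k \sum_l \sum_i \sum_j F i j k l = \sum_i \sum_j \sum_k \sum_l F i j k l.
Proof.
transitivity (\sum_k \sum_i \sum_l \sum_j F i j k l).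
  by apply: eq_bigr => k _; exact: exchange_big.
transitivity (\sum_i \sum_k \sum_l \sum_j F i j k l); first exact: exchange_big.
apply: eq_bigr => i _; transitivity (\sum_k \sum_j \sum_l F i j k l).
  by apply: eq_bigr => k _; exact: exchange_big.
exact: exchange_big.
Qed.

Section duplication.
Context (R : realType) (p : nat).
Local Notation q := ((p * p.+1)./2).
Local Notation D := (duplication_mx R p).
Local Notation Dp := (mpinvmx (duplication_mx R p)).

Lemma vecE (A : 'M[R]_p) (i j : 'I_p) : vec A (mxvec_index j i) 0 = A i j.
Proof. by rewrite mxE mxvecE mxE. Qed.

Lemma duplication_mxE (i j : 'I_p) k : D (mxvec_index j i) k =
  (((i, j) == tnth (vech_tuple p) k) || ((j, i) == tnth (vech_tuple p) k))%:R.
Proof. by rewrite !mxE mxvecE !mxE. Qed.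

(** The matrix E, which selects the lower triangular entries of a vectorized matrix, is a left
    inverse of D; multiplying D D^+ D = D by it on the left gives the claim. *)
Lemma mpinvmx_duplicationK : Dp *m D = 1%:M.
Proof.
pose E : 'M[R]_(q, p * p) := \matrix_(k, u)
  (u == mxvec_index (tnth (vech_tuple p) k).2 (tnth (vech_tuple p) k).1)%:R.
have ED : E *m D = 1%:M.
  apply/matrixP => l k; rewrite mxE (bigD1 (mxvec_index
    (tnth (vech_tuple p) l).2 (tnth (vech_tuple p) l).1))//= big1 => [|u ul].
    rewrite addr0 mxE eqxx mul1r duplication_mxE mxE.
    have inj := elimT (tuple_uniqP (vech_tuple p)) (vech_pos_uniq p).
    have ml : tnth (vech_tuple p) l \in vech_tuple p by exact: mem_tnth.
    have mk : tnth (vech_tuple p) k \in vech_tuple p by exact: mem_tnth.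
    rewrite -surjective_pairing; have [e|ne] := eqVneq l k.
      by rewrite e eqxx.
    rewrite (inj_eq inj) (negbTE ne) /=; case: eqP => // e.
    case/negP: ne; apply/eqP/inj; move: ml mk; rewrite -e.
    case: (tnth _ l) => a b /=; rewrite !mem_vech_pos => ba ab.
    by have -> : a = b by apply/val_inj/eqP; rewrite eqn_leq ab ba.
  by rewrite mxE (negbTE ul) mul0r.
have [DDpD _ _ _] := mpinvmxP D.
by rewrite -[Dp *m D]mul1mx -ED -mulmxA (mulmxA D) DDpD.
Qed.

Lemma vech_mpinvmx (A : 'M[R]_p) : A^T = A -> vech A = Dp *m vec A.
Proof.
by move=> sA; rewrite duplication_mxP// mulmxA mpinvmx_duplicationK mul1mx.
Qed.

Section linear_form.
Variable a : 'cV[R]_q.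

(** The matrix of the linear form a^T vech on symmetric matrices ([vech_formE]): the vector (D^+)^T
    a reshaped into a square. *)
Definition vech_form : 'M[R]_p :=
  \matrix_(i, j) (Dp^T *m a) (mxvec_index j i) 0.

(** (D^+)^T = D (D^+ (D^+)^T), so (D^+)^T a is a combination of columns of D, which are vectorized
    symmetric matrices. *)
Lemma vech_form_sym i j : vech_form i j = vech_form j i.
Proof.
have DpT : Dp^T = D *m (Dp *m Dp^T).
  have [_ DpDDp sDDp _] := mpinvmxP D.
  by rewrite -{1}DpDDp -mulmxA trmx_mul sDDp mulmxA.
rewrite [LHS]mxE [RHS]mxE DpT -mulmxA; move: (Dp *m Dp^T *m a) => c.
rewrite ![(D *m _) _ _]mxE; apply: eq_bigr => k _.
by rewrite !duplication_mxE orbC.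
Qed.

Lemma sum_mxvec_index (m n : nat) (F : 'I_(m * n) -> R) :
  \sum_u F u = \sum_i \sum_j F (mxvec_index i j).
Proof.
rewrite pair_big /= (reindex _ (curry_mxvec_bij m n)) /=.
by apply: eq_bigr => -[i j].
Qed.

Lemma vech_formE (A : 'M[R]_p) : A^T = A ->
  (a^T *m vech A) 0 0 = \sum_i \sum_j vech_form i j * A i j.
Proof.
move=> sA; rewrite vech_mpinvmx// mulmxA.
have -> : a^T *m Dp = (Dp^T *m a)^T by rewrite trmx_mul trmxK.
rewrite mxE sum_mxvec_index exchange_big; apply: eq_bigr => i _.
by apply: eq_bigr => j _; rewrite vecE !mxE.
Qed.

(** Rewrites the variance of a^T N(0, V), with V the limit covariance, in the form in which the
    variance of a Gaussian quadratic form appears ([qform_var]). *)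
Lemma vech_form_cov (S : 'M[R]_p) :
  (a^T *m (2 *: (Dp *m (S *t S) *m Dp^T)) *m a) 0 0 =
  2 * \sum_i \sum_j \sum_k \sum_l
    vech_form i j * vech_form k l * (S i k * S j l).
Proof.
rewrite -scalemxAr -scalemxAl mxE; congr (_ * _).
have -> : a^T *m (Dp *m (S *t S) *m Dp^T) *m a =
    (Dp^T *m a)^T *m (S *t S) *m (Dp^T *m a).
  by rewrite trmx_mul trmxK !mulmxA.
rewrite mxE sum_mxvec_index exchange_big /=.
under eq_bigr => k _.
  under eq_bigr => l _.
    rewrite mxE sum_mxvec_index mulr_suml.
    under eq_bigr do rewrite mulr_suml.
    over.
  over.
rewrite /=.
transitivity (\sum_k \sum_l \sum_i \sum_j
    vech_form i j * vech_form k l * (S i k * S j l)).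
  apply: eq_bigr => k _; apply: eq_bigr => l _; rewrite exchange_big /=.
  apply: eq_bigr => i _; apply: eq_bigr => j _.
  rewrite !mxvec_index_tens tensmxE -!mxvec_index_tens.
  rewrite [X in X * _ * _]mxE /vech_form !mxE; ring.
exact: sum4_exchange.
Qed.

End linear_form.
End duplication.

(** * Gaussian product moments and quadratic forms *)

Lemma odd_prod_natr (R : realType) (n m : nat) :
  (\prod_(i < n) (2 * i + 1) = m)%N -> \prod_(i < n) (2 * i + 1)%:R = m%:R :> R.
Proof. by move=> <-; rewrite natr_prod. Qed.

Lemma delta_mx_dot (R : realType) (p : nat) (k : 'I_p) (v : 'cV[R]_p) :
  ((delta_mx k 0 : 'cV[R]_p)^T *m v) 0 0 = v k 0.
Proof. by rewrite trmx_delta -rowE mxE. Qed.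

Section gaussian_moments.
Context (R : realType) (d : measure_display) (Omega : measurableType d)
  (P : probability Omega R).
Context (r : nat) (W : R -> Omega -> 'cV[R]_r) (WP : wiener P W) (k0 : 'I_r).
Context (p : nat) (z : Omega -> 'cV[R]_p) (S : 'M[R]_p).
Hypothesis symS : S^T = S.
Hypothesis S_ge0 : forall a : 'cV[R]_p, 0 <= (a^T *m S *m a) 0 0.
Hypothesis nz : forall a : 'cV[R]_p,
  normal_rv P ((a^T *m S *m a) 0 0) (fun w => (a^T *m z w) 0 0).

Let S_sym i j : S i j = S j i.
Proof. by rewrite -[in LHS]symS mxE. Qed.

Let lc (c1 c2 c3 c4 : R) (i j k l : 'I_p) : 'cV[R]_p :=
  c1 *: delta_mx i 0 + c2 *: delta_mx j 0 + c3 *: delta_mx k 0 + c4 *: delta_mx l 0.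

Let lc_dot c1 c2 c3 c4 i j k l (v : 'cV[R]_p) :
  ((lc c1 c2 c3 c4 i j k l)^T *m v) 0 0 =
  c1 * v i 0 + c2 * v j 0 + c3 * v k 0 + c4 * v l 0.
Proof.
rewrite /lc !linearD /= !linearZ /= !trmx_delta !mulmxDl -!scalemxAl -!rowE.
by rewrite !mxE.
Qed.

Let lc_quad c1 c2 c3 c4 i j k l :
  ((lc c1 c2 c3 c4 i j k l)^T *m S *m lc c1 c2 c3 c4 i j k l) 0 0 =
  c1 ^+ 2 * S i i + c2 ^+ 2 * S j j + c3 ^+ 2 * S k k + c4 ^+ 2 * S l l +
  2 * (c1 * c2 * S i j + c1 * c3 * S i k + c1 * c4 * S i l +
       c2 * c3 * S j k + c2 * c4 * S j l + c3 * c4 * S k l).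
Proof.
have e (m : 'I_p) : (S *m lc c1 c2 c3 c4 i j k l) m 0 =
    c1 * S m i + c2 * S m j + c3 * S m k + c4 * S m l.
  by rewrite /lc !mulmxDr -!scalemxAr -!colE !mxE.
rewrite -mulmxA lc_dot !e (S_sym j i) (S_sym k i) (S_sym l i) (S_sym k j).
by rewrite (S_sym l j) (S_sym l k); ring.
Qed.

Lemma gaussian_coord_measurable i : measurable_fun setT (fun w => z w i 0).
Proof.
have [+ _] := nz (delta_mx i 0); congr measurable_fun.
by apply/funext => w; rewrite delta_mx_dot.
Qed.

Lemma gaussian_integrable_pow (a : 'cV[R]_p) n :
  P.-integrable setT (EFin \o (fun w => (a^T *m z w) 0 0 ^+ n)).
Proof. exact: (integrable_normal_pow WP k0 (S_ge0 a) (nz a)). Qed.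

Lemma gaussian_moment2 (i j : 'I_p) :
  P.-integrable setT (EFin \o (fun w => z w i 0 * z w j 0)) /\
  \int[P]_w (z w i 0 * z w j 0) = S i j.
Proof.
pose a c := lc 1 c 0 0 i j i i.
have eE : (fun w => z w i 0 * z w j 0) = fun w =>
    4^-1 * ((a 1)^T *m z w) 0 0 ^+ 2 + (- 4^-1) * ((a (-1))^T *m z w) 0 0 ^+ 2.
  by apply/funext => w; rewrite !lc_dot; field.
have i1 := integrable_scaler 4^-1 (gaussian_integrable_pow (a 1) 2).
have i2 := integrable_scaler (- 4^-1) (gaussian_integrable_pow (a (-1)) 2).
rewrite eE; split; first exact: integrable_addr.
rewrite RintegralD// !RintegralZl//; try exact: gaussian_integrable_pow.
rewrite !(normal_moment_even WP k0 (S_ge0 _) (nz _) 1) (@odd_prod_natr R 1 1) ?big_ord1//.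
by rewrite !lc_quad; field.
Qed.

(** Polarization: the product of four coordinates is the sum, over the eight choices of signs, of c2
    c3 c4 / 192 times the fourth power of z_i + c2 z_j + c3 z_k + c4 z_l. Each of these combinations
    is normal, with fourth moment three times its squared variance. *)
Lemma isserlis (i j k l : 'I_p) :
  P.-integrable setT
    (EFin \o (fun w => z w i 0 * z w j 0 * (z w k 0 * z w l 0))) /\
  \int[P]_w (z w i 0 * z w j 0 * (z w k 0 * z w l 0)) =
    S i j * S k l + S i k * S j l + S i l * S j k.
Proof.
pose a (c2 c3 c4 : R) := lc 1 c2 c3 c4 i j k l.
pose t c2 c3 c4 w := (c2 * c3 * c4 / 192) * ((a c2 c3 c4)^T *m z w) 0 0 ^+ 4.
have it c2 c3 c4 : P.-integrable setT (EFin \o t c2 c3 c4).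
  by apply: integrable_scaler; exact: gaussian_integrable_pow.
have et c2 c3 c4 : \int[P]_w t c2 c3 c4 w = (c2 * c3 * c4 / 192) *
   (((a c2 c3 c4)^T *m S *m a c2 c3 c4) 0 0 ^+ 2 * 3).
  rewrite RintegralZl//; last exact: gaussian_integrable_pow.
  rewrite (normal_moment_even WP k0 (S_ge0 _) (nz _) 2) (@odd_prod_natr R 2 3)//.
  by rewrite !big_ord_recl big_ord0.
pose ta c2 c3 w := t c2 c3 1 w + t c2 c3 (-1) w.
pose tb c2 w := ta c2 1 w + ta c2 (-1) w.
have ia c2 c3 : P.-integrable setT (EFin \o ta c2 c3) by exact: integrable_addr.
have ib c2 : P.-integrable setT (EFin \o tb c2) by exact: integrable_addr.
have ea c2 c3 : \int[P]_w ta c2 c3 w = \int[P]_w t c2 c3 1 w + \int[P]_w t c2 c3 (-1) w.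
  exact: (RintegralD measurableT (it _ _ _) (it _ _ _)).
have eb c2 : \int[P]_w tb c2 w = \int[P]_w ta c2 1 w + \int[P]_w ta c2 (-1) w.
  exact: (RintegralD measurableT (ia _ _) (ia _ _)).
have eE : (fun w => z w i 0 * z w j 0 * (z w k 0 * z w l 0)) =
    fun w => tb 1 w + tb (-1) w.
  by apply/funext => w; rewrite /tb /ta /t !lc_dot; field.
rewrite eE; split; first exact: integrable_addr.
rewrite (RintegralD measurableT (ib 1) (ib (-1))) !eb !ea !et !lc_quad.
by field.
Qed.

Lemma gaussian_moment8 (i : 'I_p) :
  P.-integrable setT (EFin \o (fun w => z w i 0 ^+ 8)) /\
  \int[P]_w (z w i 0 ^+ 8) = 105 * S i i ^+ 4.
Proof.
have eE8 : (fun w => z w i 0 ^+ 8) =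
    fun w => ((delta_mx i 0 : 'cV[R]_p)^T *m z w) 0 0 ^+ 8.
  by apply/funext => w; rewrite delta_mx_dot.
rewrite eE8; split; first exact: gaussian_integrable_pow.
rewrite (normal_moment_even WP k0 (S_ge0 _) (nz _) 4) (@odd_prod_natr R 4 105).
  by rewrite trmx_delta -rowE -colE !mxE mulrC.
by rewrite !big_ord_recl big_ord0.
Qed.

End gaussian_moments.

Section power_means.
Context (R : realType) (p : nat).

Lemma sqr_sum_le (y : 'I_p -> R) :
  (\sum_i y i) ^+ 2 <= p%:R * \sum_i y i ^+ 2.
Proof.
have [p0|p0] := posnP p.
  rewrite big1 => [|[i ip] _]; last by exfalso; move: (ip); rewrite p0.
  by rewrite expr0n mulr_ge0// sumr_ge0// => i _; exact: sqr_ge0.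
have pR : 0 < p%:R :> R by rewrite ltr0n.
pose m := (\sum_i y i) / p%:R.
have : 0 <= \sum_i (y i - m) ^+ 2 by apply: sumr_ge0 => i _; exact: sqr_ge0.
have -> : \sum_i (y i - m) ^+ 2 = \sum_i y i ^+ 2 - (\sum_i y i) ^+ 2 / p%:R.
  under eq_bigr do rewrite sqrrB.
  rewrite big_split sumrB /= sumr_const card_ord -[m ^+ 2 *+ p]mulr_natl.
  rewrite sumrMnl -mulr_suml /m -[_ *+ 2]mulr_natl; field.
  by rewrite gt_eqF.
by rewrite subr_ge0 ler_pdivrMr// mulrC.
Qed.

End power_means.

Section quadratic_form.
Context (R : realType) (d : measure_display) (Omega : measurableType d)
  (P : probability Omega R).
Context (r : nat) (W : R -> Omega -> 'cV[R]_r) (WP : wiener P W) (k0 : 'I_r).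
Context (p : nat) (S : 'M[R]_p).
Hypothesis symS : S^T = S.
Hypothesis S_ge0 : forall a : 'cV[R]_p, 0 <= (a^T *m S *m a) 0 0.
Context (A : 'I_p -> 'I_p -> R) (symA : forall i j, A i j = A j i).

Definition qform (v : 'cV[R]_p) : R := \sum_i \sum_j A i j * (v i 0 * v j 0).

Definition qform_mean : R := \sum_i \sum_j A i j * S i j.

(** For symmetric A and S this is 2 tr(A S A S), in the index form of [vech_form_cov]. *)
Definition qform_var : R :=
  2 * \sum_i \sum_j \sum_k \sum_l A i j * A k l * (S i k * S j l).

(** An explicit constant from (x - y)^4 <= 8 (x^4 + y^4), |z^T A z| <= (sum |A_ij|) |z|^2 and |z|^8
    <= p^3 sum z_i^8; 105 = 1 * 3 * 5 * 7 is the eighth moment of N(0, 1). *)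
Definition qform_bound : R :=
  8 * ((\sum_i \sum_j `|A i j|) ^+ 4 * (p%:R ^+ 3 * \sum_i 105 * S i i ^+ 4) +
    qform_mean ^+ 4).

Context (z : Omega -> 'cV[R]_p).
Hypothesis nz : forall a : 'cV[R]_p,
  normal_rv P ((a^T *m S *m a) 0 0) (fun w => (a^T *m z w) 0 0).

Let m2 := gaussian_moment2 WP k0 symS S_ge0 nz.
Let m4 := isserlis WP k0 symS S_ge0 nz.
Let m8 := gaussian_moment8 WP k0 S_ge0 nz.

Let U w := qform (z w) - qform_mean.

Lemma qform_measurable : measurable_fun setT (fun w => qform (z w)).
Proof.
apply: measurable_sum => i; apply: measurable_sum => j.
apply: measurable_funM => //.
by apply: measurable_funM; exact: (gaussian_coord_measurable nz).
Qed.

Let integrable_qform : P.-integrable setT (EFin \o (fun w => qform (z w))).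
Proof.
apply: integrable_sumr => i _; apply: integrable_sumr => j _.
by apply: integrable_scaler; case: (m2 i j).
Qed.

Lemma qform_expectation : \int[P]_w qform (z w) = qform_mean.
Proof.
rewrite Rintegral_sum => [|i _]; last first.
  by apply: integrable_sumr => j _; apply: integrable_scaler; case: (m2 i j).
apply: eq_bigr => i _; rewrite Rintegral_sum => [|j _]; last first.
  by apply: integrable_scaler; case: (m2 i j).
apply: eq_bigr => j _; have [ij e] := m2 i j.
by rewrite RintegralZl// e.
Qed.

Let sqrE v : qform v ^+ 2 = \sum_i \sum_j \sum_k \sum_l
  (A i j * A k l) * (v i 0 * v j 0 * (v k 0 * v l 0)).
Proof.
rewrite expr2 {1}/qform mulr_suml; apply: eq_bigr => i _.
rewrite mulr_suml; apply: eq_bigr => j _; rewrite mulr_sumr.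
by apply: eq_bigr => k _; rewrite mulr_sumr; apply: eq_bigr => l _; ring.
Qed.

Let integrable_qform2 : P.-integrable setT (EFin \o (fun w => qform (z w) ^+ 2)).
Proof.
rewrite (_ : (fun w => _) = fun w => \sum_i \sum_j \sum_k \sum_l
    (A i j * A k l) * (z w i 0 * z w j 0 * (z w k 0 * z w l 0))).
  2: by apply/funext => w; exact: sqrE.
apply: integrable_sumr => i _; apply: integrable_sumr => j _.
apply: integrable_sumr => k _; apply: integrable_sumr => l _.
by apply: integrable_scaler; case: (m4 i j k l).
Qed.

Let qform2_expectation : \int[P]_w (qform (z w) ^+ 2) = qform_mean ^+ 2 + qform_var.
Proof.
have i4 i j k l : P.-integrable setT (EFin \o (fun w =>
    A i j * A k l * (z w i 0 * z w j 0 * (z w k 0 * z w l 0)))).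
  by apply: integrable_scaler; case: (m4 i j k l).
transitivity (\sum_i \sum_j \sum_k \sum_l A i j * A k l *
    (S i j * S k l + S i k * S j l + S i l * S j k)).
  under eq_Rintegral do rewrite sqrE.
  rewrite Rintegral_sum => [|i _]; last by do 3 (apply: integrable_sumr => ? _).
  apply: eq_bigr => i _.
  rewrite Rintegral_sum => [|j _]; last by do 2 (apply: integrable_sumr => ? _).
  apply: eq_bigr => j _.
  rewrite Rintegral_sum => [|k _]; last by apply: integrable_sumr => ? _.
  apply: eq_bigr => k _.
  rewrite Rintegral_sum => [|l _]; last by [].
  apply: eq_bigr => l _; have [il e] := m4 i j k l.
  by rewrite RintegralZl// e.
have -> : qform_mean ^+ 2 = \sum_i \sum_j \sum_k \sum_l
    A i j * A k l * (S i j * S k l).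
  rewrite expr2 {1}/qform_mean mulr_suml; apply: eq_bigr => i _.
  rewrite mulr_suml; apply: eq_bigr => j _; rewrite mulr_sumr.
  by apply: eq_bigr => k _; rewrite mulr_sumr; apply: eq_bigr => l _; ring.
(* Of the three Isserlis pairings, the first sums to the squared mean and the other two agree by
   symmetry of A, whence the factor 2 of [qform_var]. *)
have sw : \sum_i \sum_j \sum_k \sum_l A i j * A k l * (S i l * S j k) =
    \sum_i \sum_j \sum_k \sum_l A i j * A k l * (S i k * S j l).
  apply: eq_bigr => i _; apply: eq_bigr => j _; rewrite exchange_big /=.
  by apply: eq_bigr => k _; apply: eq_bigr => l _; rewrite (symA l k).
rewrite /qform_var mulrDl !mul1r -{2}sw -!big_split /=; apply: eq_bigr => i _.
rewrite -!big_split; apply: eq_bigr => j _.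
rewrite -!big_split; apply: eq_bigr => k _.
rewrite -!big_split; apply: eq_bigr => l _ /=; ring.
Qed.

Lemma qform_centered : P.-integrable setT (EFin \o U) /\ \int[P]_w U w = 0.
Proof.
have ic := integrable_cst P qform_mean.
split; first exact: integrable_subr.
by rewrite RintegralB// qform_expectation Rintegral_cstT subrr.
Qed.

Lemma qform_variance : P.-integrable setT (EFin \o (fun w => U w ^+ 2)) /\
  \int[P]_w (U w ^+ 2) = qform_var.
Proof.
have eE : (fun w => U w ^+ 2) = fun w =>
    qform (z w) ^+ 2 + ((- 2 * qform_mean) * qform (z w) + qform_mean ^+ 2).
  by apply/funext => w; rewrite /U; ring.
have i1 := integrable_scaler (- 2 * qform_mean) integrable_qform.
have i2 := integrable_cst P (qform_mean ^+ 2).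
have i3 := integrable_addr i1 i2.
rewrite eE; split; first exact: integrable_addr.
rewrite RintegralD// RintegralD// RintegralZl// Rintegral_cstT.
by rewrite qform2_expectation qform_expectation; ring.
Qed.

Let bound8 w := 8 * ((\sum_i \sum_j `|A i j|) ^+ 4 *
  (p%:R ^+ 3 * \sum_i z w i 0 ^+ 8) + qform_mean ^+ 4).

Let U4_le w : U w ^+ 4 <= bound8 w.
Proof.
pose B := \sum_i z w i 0 ^+ 2; pose al := \sum_i \sum_j `|A i j|.
have B0 : 0 <= B by apply: sumr_ge0 => i _; exact: sqr_ge0.
have al0 : 0 <= al by do 2 (apply: sumr_ge0 => ? _).
have zi i : z w i 0 ^+ 2 <= B.
  by rewrite /B (bigD1 i)//= lerDl sumr_ge0// => j _; exact: sqr_ge0.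
have qB : `|qform (z w)| <= al * B.
  apply: le_trans (ler_norm_sum _ _ _) _; rewrite mulr_suml.
  apply: ler_sum => i _; apply: le_trans (ler_norm_sum _ _ _) _.
  rewrite mulr_suml; apply: ler_sum => j _; rewrite normrM ler_wpM2l//.
  have := zi i; have := zi j; have := sqr_ge0 (z w i 0 - z w j 0).
  have := sqr_ge0 (z w i 0 + z w j 0).
  by rewrite ler_norml => *; apply/andP; split; nra.
(* Cauchy-Schwarz twice, from squares to fourth and then to eighth powers. *)
have B4 : B ^+ 4 <= p%:R ^+ 3 * \sum_i z w i 0 ^+ 8.
  have h1 : B ^+ 2 <= p%:R * \sum_i z w i 0 ^+ 4.
    have := sqr_sum_le (fun i => z w i 0 ^+ 2).
    by under [in X in _ <= X -> _]eq_bigr do rewrite -exprM.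
  have h2 : (\sum_i z w i 0 ^+ 4) ^+ 2 <= p%:R * \sum_i z w i 0 ^+ 8.
    have := sqr_sum_le (fun i => z w i 0 ^+ 4).
    by under [in X in _ <= X -> _]eq_bigr do rewrite -exprM.
  rewrite (exprM _ 2 2); apply: (@le_trans _ _ ((p%:R * \sum_i z w i 0 ^+ 4) ^+ 2)).
    rewrite ler_pXn2r ?nnegrE ?sqr_ge0// mulr_ge0// sumr_ge0// => i _.
    by rewrite (exprM _ 2 2) sqr_ge0.
  by rewrite exprMn (exprSr _ 2) -(mulrA (p%:R ^+ 2)) ler_wpM2l// exprn_ge0.
have U2 : U w ^+ 2 <= 2 * ((al * B) ^+ 2 + qform_mean ^+ 2).
  have h : qform (z w) ^+ 2 <= (al * B) ^+ 2.
    rewrite -[X in X <= _]real_normK ?num_real//.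
    by rewrite ler_pXn2r ?nnegrE// mulr_ge0.
  have := sqr_ge0 (qform (z w) + qform_mean); rewrite /U; nra.
rewrite (exprM _ 2 2).
apply: (@le_trans _ _ ((2 * ((al * B) ^+ 2 + qform_mean ^+ 2)) ^+ 2)).
  rewrite ler_pXn2r ?nnegrE ?sqr_ge0//.
  by rewrite mulr_ge0// addr_ge0 ?sqr_ge0.
apply: (@le_trans _ _ (8 * (al ^+ 4 * B ^+ 4 + qform_mean ^+ 4))).
  have := sqr_ge0 ((al * B) ^+ 2 - qform_mean ^+ 2).
  have := sqr_ge0 (al ^+ 2 * B ^+ 2); have := sqr_ge0 (qform_mean ^+ 2).
  lra.
rewrite /bound8 ler_wpM2l// lerD2r ler_wpM2l// exprn_ge0//.
Qed.

Lemma qform_fourth : P.-integrable setT (EFin \o (fun w => U w ^+ 4)) /\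
  \int[P]_w (U w ^+ 4) <= qform_bound.
Proof.
have i8 : P.-integrable setT (EFin \o (fun w => \sum_i z w i 0 ^+ 8)).
  by apply: integrable_sumr => i _; case: (m8 i).
have i8p := integrable_scaler (p%:R ^+ 3) i8.
have i8a := integrable_scaler ((\sum_i \sum_j `|A i j|) ^+ 4) i8p.
have i8c := integrable_addr i8a (integrable_cst P (qform_mean ^+ 4)).
have ib : P.-integrable setT (EFin \o bound8) by exact: integrable_scaler.
have iU : P.-integrable setT (EFin \o (fun w => U w ^+ 4)).
  apply: (integrable_bound _ ib) => [|w].
    apply: measurable_funX; apply: measurable_funB => //.
    exact: qform_measurable.
  by rewrite ger0_norm// (exprM _ 2 2) sqr_ge0.
split=> //; apply: (@le_trans _ _ (\int[P]_w bound8 w)).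
  by apply: le_Rintegral.
rewrite RintegralZl// (RintegralD measurableT i8a (integrable_cst P _)).
rewrite RintegralZl// RintegralZl// Rintegral_cstT Rintegral_sum; last first.
  by move=> i _; case: (m8 i).
rewrite le_eqVlt; apply/orP; left; apply/eqP; rewrite /qform_bound.
by congr (_ * (_ * (_ * _) + _)); apply: eq_bigr => i _; case: (m8 i).
Qed.

End quadratic_form.

(** * Uniform continuity, summation by parts and block sizes *)

Section path.
Context (R : realType).

Lemma unif_continuous_itv (g : R -> R) (a b e : R) :
  {within `[a, b], continuous g} -> 0 < e -> exists2 del, 0 < del &
    forall x z, x \in `[a, b] -> z \in `[a, b] -> `|x - z| < del -> `|g x - g z| < e.
Proof.
move=> /subspace_continuousP cg e0.
have cK := @segment_compact R a b; move/compact_near_coveringP : cK => cK.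
pose Q (del : R) (x : R) := x \in `[a, b] -> forall z, z \in `[a, b] ->
  `|x - z| < del -> `|g x - g z| < e.
have := cK R (0^'+) Q _ _.
have H x : `[a, b]%classic x -> (\forall x' \near x & del \near 0^'+, Q del x').
  move=> xab; have e20 : 0 < e / 2 by rewrite divr_gt0.
  have := cg x xab; move=> /cvgrPdist_lt /(_ _ e20) /nbhs_ballP[h /= h0 hf].
  exists (ball x (h / 2), [set del | del < h / 2]) => /=.
    split; first by apply: nbhsx_ballx; rewrite divr_gt0.
    by apply: nbhs_right_lt; rewrite divr_gt0.
  move=> [x' del] /= [xx' dh] x'ab z zab x'z.
  rewrite (splitr e) -(subrKA (g x)).
  apply: (le_lt_trans (ler_normD _ _)); rewrite ltrD//.
    rewrite distrC hf//; apply: lt_trans xx' _.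
    by rewrite ltr_pdivrMr// ltr_pMr// ltr1n.
  apply: hf => //; rewrite /ball /= (splitr h) -(subrKA x').
  apply: (le_lt_trans (ler_normD _ _)); rewrite ltrD//.
  exact: lt_trans x'z dh.
move=> /(_ _ H) hQ.
have [del [/= del0 QK]] := filter_ex (filterI (nbhs_right_gt (0 : R)) hQ).
by exists del => // x z xab; apply: QK.
Qed.

Lemma bounded_itv (g : R -> R) (a b : R) : {within `[a, b], continuous g} ->
  exists2 G, 0 <= G & forall x, x \in `[a, b] -> `|g x| <= G.
Proof.
move=> cg; have cK := continuous_compact cg (@segment_compact R a b).
have [M [Mr MP]] := compact_bounded cK.
exists (`|M| + 1); first by rewrite addr_ge0.
move=> x xab; apply: (MP (`|M| + 1)); first by rewrite ltr_pwDr// ler_norm.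
by exists x.
Qed.

Lemma Rintegral_average (g : R -> R) (a b c e : R) : a < b ->
  (@lebesgue_measure R).-integrable `]a, b] (EFin \o g) ->
  (forall x, x \in `]a, b] -> `|g x - c| <= e) ->
  `|\int[lebesgue_measure]_(x in `]a, b]) g x - (b - a) * c| <= (b - a) * e.
Proof.
move=> ab ig gc.
have mab : fine (lebesgue_measure (`]a, b] : set R)) = b - a.
  by rewrite lebesgue_measure_itv/= lte_fin ab.
have ic k : (@lebesgue_measure R).-integrable `]a, b] (EFin \o (fun _ => k)).
  have h : (@lebesgue_measure R).-integrable `[a, b] (EFin \o (fun _ => k)).
    apply: continuous_compact_integrable; first exact: segment_compact.
    by apply: continuous_subspaceT => x; exact: cst_continuous.
  apply: integrableS h => //; exact: subset_itv_oc_cc.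
rewrite [X in _ - X](_ : _ = \int[lebesgue_measure]_(x in `]a, b]) c); last first.
  by rewrite Rintegral_cst// mab mulrC.
rewrite -RintegralB//.
have igc : (@lebesgue_measure R).-integrable `]a, b] (EFin \o (fun x => g x - c)).
  exact: (integrableB _ ig (ic c)).
apply: le_trans (le_normr_Rintegral _ igc) _ => //.
rewrite [leRHS](_ : _ = \int[lebesgue_measure]_(x in `]a, b]) e); last first.
  by rewrite Rintegral_cst// mab mulrC.
by apply: le_Rintegral => //; exact: integrable_norm.
Qed.

Lemma abel_sum (a m : nat -> R) n :
  \sum_(i < n.+1) a i * (m i.+1 - m i) =
  a n * m n.+1 - a 0%N * m 0%N - \sum_(i < n) (a i.+1 - a i) * m i.+1.
Proof.
elim: n => [|n ih]; first by rewrite big_ord1 big_ord0; ring.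
by rewrite big_ord_recr /= ih big_ord_recr /=; ring.
Qed.

(** Summation by parts moves the difference onto the coefficients, which are constant on blocks of
    length L. Only the n %/ L block boundaries contribute, each at most 2 G B, besides the two end
    terms. *)
Lemma block_sum_le (d m : nat -> R) (L n : nat) (G B : R) : 0 <= G -> 0 <= B ->
  (forall i, (i <= n)%N -> `|d i| <= G) -> (forall i, (i <= n.+1)%N -> `|m i| <= B) ->
  `|\sum_(i < n.+1) d (i %/ L * L)%N * (m i.+1 - m i)| <=
    2 * G * B * (1 + (n %/ L)%:R).
Proof.
move=> G0 B0 dG mB.
pose a i := d (i %/ L * L)%N.
have aG i : (i <= n)%N -> `|a i| <= G.
  by move=> i_n; apply: dG; apply: leq_trans (leq_divM _ _) i_n.
rewrite -/(a _) (abel_sum a m n).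
have step : `|\sum_(i < n) (a i.+1 - a i) * m i.+1| <=
    2 * G * B * (n %/ L)%:R.
  (* The boundaries are counted by telescoping i %/ L, which increases exactly where the coefficient
     may change. *)
  have -> : (n %/ L)%:R = \sum_(i < n) ((i.+1 %/ L)%:R - (i %/ L)%:R) :> R.
    rewrite -(big_mkord xpredT (fun i => (i.+1 %/ L)%:R - (i %/ L)%:R)).
    by rewrite telescope_sumr// div0n subr0.
  apply: le_trans (ler_norm_sum _ _ _) _; rewrite mulr_sumr.
  apply: ler_sum => i _; rewrite normrM.
  have le : (i %/ L <= i.+1 %/ L)%N by exact: leq_div2r.
  have mi : `|m i.+1| <= B by apply: mB; exact: leqW.
  have [eq|neq] := eqVneq (i %/ L)%N (i.+1 %/ L)%N.
    by rewrite /a eq !subrr normr0 mulr0 mul0r.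
  have c1 : 1 <= (i.+1 %/ L)%:R - (i %/ L)%:R :> R.
    by rewrite -natrB// ler1n subn_gt0 ltn_neqAle neq.
  have aa : `|a i.+1 - a i| <= 2 * G.
    apply: le_trans (ler_normB _ _) _.
    by have := aG i.+1 (ltn_ord i); have := aG i (ltnW (ltn_ord i)); lra.
  apply: (@le_trans _ _ (2 * G * B)); first exact: ler_pM.
  by rewrite ler_peMr// !mulr_ge0.
apply: le_trans (ler_normB _ _) _; rewrite mulrDr mulr1 lerD//.
apply: le_trans (ler_normB _ _) _; rewrite !normrM.
have h1 : `|a n| * `|m n.+1| <= G * B by apply: ler_pM => //; [exact: aG|exact: mB].
have h2 : `|a 0%N| * `|m 0%N| <= G * B by apply: ler_pM => //; [exact: aG|exact: mB].
by rewrite -mulrA; lra.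
Qed.

(** About n^(3/4): short enough that a block occupies a vanishing fraction of [0, T], long enough
    that the O(n^(1/4)) blocks are negligible against sqrt(n). *)
Definition block_size (n : nat) : nat :=
  (Num.truncn (Num.sqrt (Num.sqrt (n%:R : R))) ^ 3)%N.

Let q (n : nat) : R := Num.sqrt (Num.sqrt n%:R).

Let qE n : n%:R = q n ^+ 4.
Proof. by rewrite (exprM _ 2 2) !sqr_sqrtr ?sqrtr_ge0 ?ler0n. Qed.

Lemma block_size_gt0 n : (0 < n)%N -> (0 < block_size n)%N.
Proof.
move=> n0; rewrite expn_gt0 truncn_ge_nat ?sqrtr_ge0//.
have -> : 1%:R = Num.sqrt (Num.sqrt 1) :> R by rewrite !sqrtr1.
by rewrite !ler_wsqrtr// ler1n.
Qed.

Let q_ge (A : R) : \forall n \near \oo, A <= q n.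
Proof.
near=> n; apply: (le_trans (ler_norm A)).
rewrite -(@ler_pXn2r _ 4) ?nnegrE ?sqrtr_ge0// -qE.
by near: n; exact: nbhs_infty_ger.
Unshelve. all: by end_near. Qed.

Lemma block_size_small (e : R) : 0 < e ->
  \forall n \near \oo, (block_size n).+1%:R / n%:R <= e.
Proof.
move=> e0; near=> n.
have q1 : 1 <= q n by near: n; exact: q_ge.
have qe : 2 / e <= q n by near: n; exact: q_ge.
have q0 : 0 < q n by exact: lt_le_trans q1.
rewrite (qE n) ler_pdivrMr ?exprn_gt0//.
have : (block_size n)%:R <= q n ^+ 3.
  rewrite /block_size natrX lerXn2r ?nnegrE ?ler0n ?(ltW q0)//.
  by rewrite truncn_le ltW.
rewrite ler_pdivrMr// in qe.
have q3 : 1 <= q n ^+ 3 by rewrite exprn_ege1.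
have : 2 * q n ^+ 3 <= q n * e * q n ^+ 3 by rewrite ler_wpM2r// exprn_ge0 ?ltW.
rewrite -natr1 (exprS _ 3); lra.
Unshelve. all: by end_near. Qed.

(** With q = n^(1/4) >= 1 and u its integer part, u >= q / 2, so n / u^3 <= 8 q; then 1 + 8 q <= 9 q
    <= e q^2 once q >= 9 / e. *)
Lemma block_number_small (e : R) : 0 < e ->
  \forall n \near \oo, (1 + (n %/ block_size n)%:R) / Num.sqrt n%:R <= e.
Proof.
move=> e0; near=> n.
have q1 : 1 <= q n by near: n; exact: q_ge.
have qe : 9 / e <= q n by near: n; exact: q_ge.
have q0 : 0 < q n by exact: lt_le_trans q1.
have sE : Num.sqrt n%:R = q n ^+ 2 by rewrite sqr_sqrtr// sqrtr_ge0.
rewrite sE ler_pdivrMr ?exprn_gt0//.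
pose u := Num.truncn (q n).
have /andP[uq qu] := truncn_itv (ltW q0).
have u1 : (1 <= u)%N by rewrite truncn_ge_nat ?(ltW q0).
have u1R : 1 <= u%:R :> R by rewrite ler1n.
have q2u : q n <= 2 * u%:R by move: qu; rewrite -natr1 -/u; lra.
have L0 : (0 < u ^ 3)%N by rewrite expn_gt0 u1.
have nL : (n %/ block_size n)%:R <= 8 * q n.
  apply: (@le_trans _ _ (n%:R / (u ^ 3)%:R)).
    by rewrite ler_pdivlMr ?ltr0n// -natrM ler_nat leq_divM.
  rewrite ler_pdivrMr ?ltr0n// (qE n) natrX exprS.
  rewrite (_ : 8 * q n * _ = q n * (2 * u%:R) ^+ 3); last by ring.
  by rewrite ler_wpM2l ?(ltW q0)// lerXn2r ?nnegrE ?(ltW q0)// mulr_ge0.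
rewrite ler_pdivrMr// in qe.
have : 9 * q n <= q n * e * q n by rewrite ler_wpM2r// ltW.
rewrite expr2; lra.
Unshelve. all: by end_near. Qed.

End path.

(** * Convergence to zero in probability *)

Section in_probability.
Context (R : realType) (d : measure_display) (Omega : measurableType d)
  (P : probability Omega R).
Implicit Types x y : nat -> Omega -> R.

Definition cvg0_prob x : Prop := forall e h : R, 0 < e -> 0 < h ->
  \forall n \near \oo, (P [set w | (e < `|x n w|)%R] <= h%:E)%E.

(** Dominated convergence for the indicators of the exceptional events. *)
Lemma cvg0_prob_ae x : (forall n, measurable_fun setT (x n)) ->
  {ae P, forall w, x n w @[n --> \oo] --> (0 : R)} -> cvg0_prob x.
Proof.
move=> mx xae e h e0 h0.
pose A n := [set w | e < `|x n w|].
have mA n : measurable (A n) by exact: measurable_normr_gt.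
have mf n : measurable_fun setT (fun w => (\1_(A n) w : R)%:E).
  by apply/measurable_EFinP; exact: measurable_indic.
have aecv : {ae P, forall w, setT w -> (\1_(A n) w : R)%:E @[n --> \oo] --> (0 : \bar R)%E}.
  apply: filterS xae => w xw _; apply: cvg_EFin; first exact: nearW.
  apply: cvg_near_cst; move/cvgr0Pnorm_lt : xw => /(_ _ e0); apply: filterS => n xn.
  by rewrite /= indicE memNset// /A /= => /(lt_trans xn); rewrite ltxx.
have ae1 : {ae P, forall w, forall n, setT w ->
    (`|(\1_(A n) w : R)%:E| <= (cst 1 w : \bar R))%E}.
  apply: aeW => w n _; rewrite /= lee_fin indicE.
  by case: (_ \in _); rewrite ?normr1 ?normr0.
have [_ _ cv] := dominated_convergence measurableT mf (measurable_cst _) aecv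
  (integrable_cst P 1) ae1.
move: cv; rewrite integral0 => /fine_cvg /cvgr0Pnorm_le /(_ _ h0).
apply: filterS => n; rewrite [X in `|X|](_ : _ = \int[P]_w \1_(A n) w)//.
rewrite Rintegral_indicator//.
rewrite ger0_norm ?fine_ge0// => nh.
by rewrite -(@fineK _ (P (A n))) ?fin_num_measure ?lee_fin.
Qed.

Lemma le_prob (A B : set Omega) : measurable A -> measurable B -> A `<=` B ->
  (P A <= P B)%E.
Proof. by move=> mA mB AB; apply: le_measure; rewrite ?inE. Qed.

Lemma prob_normr_le2 (x u v : Omega -> R) (a b c h h' : R) :
  measurable_fun setT x -> measurable_fun setT u -> measurable_fun setT v ->
  (forall w, `|u w| <= a -> `|v w| <= b -> `|x w| <= c) ->
  (P [set w | (a < `|u w|)%R] <= h%:E)%E -> (P [set w | (b < `|v w|)%R] <= h'%:E)%E ->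
  (P [set w | (c < `|x w|)%R] <= (h + h')%:E)%E.
Proof.
move=> mx mu mv uvx hu hv.
have mU := measurable_normr_gt a mu; have mV := measurable_normr_gt b mv.
apply: (@le_trans _ _ (P ([set w | (a < `|u w|)%R] `|` [set w | (b < `|v w|)%R]))).
  apply: le_prob; [exact: measurable_normr_gt|exact: measurableU|].
  move=> w /= cx; apply: contrapT => /not_orP[/negP + /negP].
  by rewrite -!leNgt => ua vb; move: cx; rewrite ltNge uvx.
by apply: (le_trans (measureU2 _ _ _)) => //; rewrite EFinD leeD.
Qed.

Lemma cvg0_probD x y : (forall n, measurable_fun setT (x n)) ->
  (forall n, measurable_fun setT (y n)) ->
  cvg0_prob x -> cvg0_prob y -> cvg0_prob (fun n w => x n w + y n w).
Proof.
move=> mx my cx cy e h e0 h0.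
have e20 : 0 < e / 2 by rewrite divr_gt0.
have h20 : 0 < h / 2 by rewrite divr_gt0.
have := cx _ _ e20 h20; have := cy _ _ e20 h20; apply: filterS2 => n yn xn.
rewrite (splitr h); apply: prob_normr_le2 xn yn => //; first exact: measurable_funD.
by move=> w xe ye; apply: (le_trans (ler_normD _ _)); rewrite (splitr e) lerD.
Qed.

(** First [lam] is taken small, so that Markov's inequality controls [lam] Q uniformly in n; for
    that fixed [lam] the term in o is small for large n. Used with Young's inequality in place of
    Cauchy-Schwarz. *)
Lemma cvg0_prob_young x (o : nat -> Omega -> R) (Q : nat -> Omega -> R) (K : R) :
  (forall n, measurable_fun setT (x n)) ->
  (forall n, measurable_fun setT (o n)) ->
  (forall n w, 0 <= Q n w) ->
  (forall n, P.-integrable setT (EFin \o Q n)) ->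
  (forall n, \int[P]_w Q n w <= K) ->
  (forall n w lam, 0 < lam -> `|x n w| <= lam^-1 * o n w + lam * Q n w) ->
  cvg0_prob o -> cvg0_prob x.
Proof.
move=> mx mo Q0 iQ QK xle co e h e0 h0.
have K0 : 0 <= K by apply: le_trans (QK 0%N); exact: Rintegral_ge0.
have e20 : 0 < e / 2 by rewrite divr_gt0.
have h20 : 0 < h / 2 by rewrite divr_gt0.
have K1 : 0 < K + 1 by rewrite ltr_wpDl.
(* Chosen so that Markov's bound for the event [lam] Q > e/2 is at most h/2, K + 1 serving as a
   positive bound of the expectation. *)
have [lam lam0 lamE] : exists2 lam, 0 < lam & lam / (e / 2) * (K + 1) = h / 2.
  exists ((e / 2) * (h / 2) / (K + 1)); first by rewrite divr_gt0// mulr_gt0.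
  by field; rewrite !gt_eqF.
have ho := co _ _ (mulr_gt0 lam0 e20) h20.
near=> n.
have On : (P [set w | (lam * (e / 2) < `|o n w|)%R] <= (h / 2)%:E)%E by near: n.
have mQ : measurable_fun setT (Q n) by have /integrableP[/measurable_EFinP] := iQ n.
have mO := measurable_normr_gt (lam * (e / 2)) (mo n).
have mB := measurable_normr_gt (lam^-1 * (e / 2)) mQ.
have Qn : (P [set w | (lam^-1 * (e / 2) < `|Q n w|)%R] <= (h / 2)%:E)%E.
  rewrite -[X in (X <= _)%E]fineK ?fin_num_measure// lee_fin -Rintegral_indicator//.
  apply: (@le_trans _ _ (\int[P]_w (lam / (e / 2) * Q n w))).
    apply: le_Rintegral => //.
    - exact: integrable_indicator.
    - exact: integrable_scaler.
    move=> w _; rewrite indicE; case: (boolP (w \in _)) => [|_]; last first.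
      by apply: (mulr_ge0 (divr_ge0 (ltW lam0) (ltW e20)) (Q0 n w)).
    rewrite inE /= (ger0_norm (Q0 n w)) => wQ.
    by rewrite mulrAC ler_pdivlMr// mul1r ltW// -ltr_pdivrMl.
  rewrite RintegralZl//.
  rewrite -lamE ler_wpM2l ?(divr_ge0 (ltW lam0) (ltW e20))//.
  by rewrite (le_trans (QK n))// lerDl.
rewrite (splitr h); apply: prob_normr_le2 On Qn => // w o1.
rewrite (ger0_norm (Q0 n w)) => q1; apply: (le_trans (xle n w lam lam0)).
rewrite [leRHS](splitr e) lerD//.
  by rewrite ler_pdivrMl// (le_trans (ler_norm _) o1).
by rewrite -ler_pdivlMl.
Unshelve. all: by end_near. Qed.

End in_probability.

(** * Deterministic sums along continuously differentiable paths *)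

Section smooth_paths.
Context (R : realType) (T : R) (T0 : 0 < T).

Definition grid (n i : nat) : R := i%:R * (T / n%:R).

Definition increment (n i : nat) (x : R -> R) : R := x (grid n i.+1) - x (grid n i).

Definition slope (n i : nat) (x : R -> R) : R := increment n i x * (n%:R / T).

(** A path of class C^1 on [0, T] with derivative g, in the integral form in which a differential
    equation provides it. *)
Definition smooth_path (g u : R -> R) : Prop :=
  {within `[0, T], continuous g} /\ exists c, forall t, t \in `[0, T] ->
    u t = c + \int[lebesgue_measure]_(s in `[0, t]) g s.

Lemma grid_itv n i : (i <= n)%N -> grid n i \in `[0, T].
Proof.
case: n => [|n] i_n; rewrite /grid in_itv /=.
  by move: i_n; rewrite leqn0 => /eqP ->; rewrite mul0r lexx ltW.
rewrite mulr_ge0 ?divr_ge0 ?(ltW T0)//= mulrCA ger_pMr// ler_pdivrMr ?ltr0n//.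
by rewrite mul1r ler_nat.
Qed.

Lemma gridS n i : grid n i.+1 - grid n i = T / n%:R.
Proof. by rewrite /grid -mulrBl -natrB// subSnn mul1r. Qed.

Lemma gridB n i j : (j <= i)%N -> grid n i - grid n j = (i - j)%:R * (T / n%:R).
Proof. by move=> ji; rewrite /grid -mulrBl -natrB. Qed.

Lemma ler_grid n i j : (i <= j)%N -> grid n i <= grid n j.
Proof. by move=> ij; rewrite ler_wpM2r ?divr_ge0 ?(ltW T0)// ler_nat. Qed.

Lemma slopeK n i x : (0 < n)%N -> increment n i x = T / n%:R * slope n i x.
Proof.
by move=> n0; rewrite /slope; field; rewrite gt_eqF//= pnatr_eq0 -lt0n.
Qed.

Lemma smooth_path_incr (g u : R -> R) (s t z e : R) : smooth_path g u ->
  s \in `[0, T] -> t \in `[0, T] -> s < t ->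
  (forall x, x \in `]s, t] -> `|g x - z| <= e) ->
  `|u t - u s - (t - s) * z| <= (t - s) * e.
Proof.
move=> [cg [c uE]] sT tT st gz; rewrite !uE// opprD addrACA subrr add0r.
have iT : (@lebesgue_measure R).-integrable `[0, T] (EFin \o g).
  by apply: continuous_compact_integrable => //; exact: segment_compact.
move: (sT) (tT); rewrite !in_itv /= => /andP[s0 sT'] /andP[t0 tT'].
have it : (@lebesgue_measure R).-integrable `[0, t] (EFin \o g).
  by apply: integrableS iT => //; apply: subset_itvl; rewrite bnd_simp.
rewrite (Rintegral_itvB it) ?bnd_simp ?(ltW st)//.
apply: Rintegral_average => //.
by apply: integrableS it => //; apply: subset_itvr; rewrite bnd_simp.
Qed.

(** The slope is the mean of g over the cell. *)
Lemma slope_near (g u : R -> R) (n i : nat) (z e : R) : smooth_path g u ->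
  (i < n)%N -> (forall x, x \in `](grid n i), (grid n i.+1)] -> `|g x - z| <= e) ->
  `|slope n i u - z| <= e.
Proof.
move=> gu i_n gz; have n0 : (0 < n)%N by exact: leq_ltn_trans i_n.
have h0 : 0 < T / n%:R by rewrite divr_gt0// ltr0n.
have lt : grid n i < grid n i.+1 by rewrite -subr_gt0 gridS.
have := smooth_path_incr gu (grid_itv (ltnW i_n)) (grid_itv i_n) lt gz.
rewrite gridS -/(increment n i u) slopeK// -mulrBr normrM (gtr0_norm h0).
by rewrite ler_pM2l.
Qed.

Lemma slope_bound (g u : R -> R) : smooth_path g u ->
  exists2 G, 0 <= G & forall n i, (i < n)%N -> `|slope n i u| <= G.
Proof.
move=> gu; have [cg _] := gu; have [G G0 gG] := bounded_itv cg.
exists G => // n i i_n; rewrite -[slope _ _ _]subr0; apply: (slope_near gu i_n) => x.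
rewrite in_itv /= => /andP[ix xi]; rewrite subr0; apply: gG.
have := grid_itv (ltnW i_n); have := grid_itv i_n.
rewrite !in_itv /= => /andP[_ iT] /andP[i0 _].
by rewrite (le_trans i0 (ltW ix)) (le_trans xi iT).
Qed.

Lemma inv_sqrt_small (K e : R) : 0 <= K -> 0 < e ->
  \forall n \near \oo, K * ((1 + (n %/ block_size R n)%:R) / Num.sqrt n%:R) <= e.
Proof.
move=> K0 e0; have K1 : 0 < K + 1 by rewrite ltr_wpDl.
have := block_number_small (divr_gt0 e0 K1); apply: filterS => n hn.
have -> : e = (K + 1) * (e / (K + 1)) by field; rewrite gt_eqF.
by rewrite ler_pM ?divr_ge0 ?sqrtr_ge0 ?addr_ge0// lerDl.
Qed.

(** The n products are each O(n^(-2)), so the normalized sum is O(n^(-1/2)). *)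
Lemma smooth_cross (g g' u v : R -> R) : smooth_path g u -> smooth_path g' v ->
  Num.sqrt n%:R * (T^-1 * \sum_(i < n) increment n i u * increment n i v)
    @[n --> \oo] --> (0 : R).
Proof.
move=> gu gv; have [G G0 uG] := slope_bound gu; have [G' G'0 vG] := slope_bound gv.
apply/cvgr0Pnorm_le => e e0.
have K0 : 0 <= T * (G * G') by rewrite !mulr_ge0// ltW.
near=> n.
have n0 : (0 < n)%N by near: n; exact: nbhs_infty_gt.
have nR : 0 < n%:R :> R by rewrite ltr0n.
have small : T * (G * G') * ((1 + (n %/ block_size R n)%:R) / Num.sqrt n%:R) <= e.
  by near: n; exact: inv_sqrt_small.
apply: le_trans small.
have s0 : 0 < Num.sqrt n%:R :> R by rewrite sqrtr_gt0.
rewrite !normrM (ger0_norm (sqrtr_ge0 _)) normfV (gtr0_norm T0).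
apply: (@le_trans _ _ (Num.sqrt n%:R * (T^-1 * \sum_(i < n) ((T / n%:R) ^+ 2 * (G * G'))))).
  rewrite ler_wpM2l ?sqrtr_ge0// ler_wpM2l ?invr_ge0 ?(ltW T0)//.
  apply: le_trans (ler_norm_sum _ _ _) _; apply: ler_sum => i _.
  rewrite !slopeK// mulrACA -expr2 normrM ger0_norm ?sqr_ge0//.
  by rewrite ler_wpM2l ?sqr_ge0// normrM ler_pM// ?uG ?vG.
rewrite sumr_const card_ord -[X in _ * (_ * X) <= _]mulr_natl.
rewrite [leLHS](_ : _ = T * (G * G') * (1 / Num.sqrt n%:R)); last first.
  have -> : n%:R = Num.sqrt n%:R ^+ 2 :> R by rewrite sqr_sqrtr// ler0n.
  by rewrite !sqrtr_sqr !(gtr0_norm s0); field; rewrite !gt_eqF.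
by rewrite ler_wpM2l// ler_pM2r ?invr_gt0// lerDl.
Unshelve. all: by end_near. Qed.

Definition block_start (n i : nat) : nat := (i %/ block_size R n * block_size R n)%N.

(** [block_sum_le] with bounded slopes and a bounded path m: the sum is of the order of the number
    of blocks, which is o(sqrt n). Only continuity of m enters, so m may be a Wiener path. *)
Lemma smooth_block (g u m : R -> R) : smooth_path g u ->
  {within `[0, T], continuous m} ->
  (Num.sqrt n%:R)^-1 * \sum_(i < n) slope n (block_start n i) u * increment n i m
    @[n --> \oo] --> (0 : R).
Proof.
move=> gu cm; have [G G0 uG] := slope_bound gu; have [B B0 mB] := bounded_itv cm.
apply/cvgr0Pnorm_le => e e0.
have K0 : 0 <= 2 * G * B by rewrite !mulr_ge0.
near=> n.
have n0 : (0 < n)%N by near: n; exact: nbhs_infty_gt.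
have small : 2 * G * B * ((1 + (n %/ block_size R n)%:R) / Num.sqrt n%:R) <= e.
  by near: n; exact: inv_sqrt_small.
apply: le_trans small; rewrite normrM normfV (ger0_norm (sqrtr_ge0 _)) mulrC mulrA.
rewrite ler_wpM2r ?invr_ge0 ?sqrtr_ge0//.
have [N ->] : exists N, n = N.+1 by exists n.-1; rewrite prednK.
apply: le_trans (block_sum_le (d := fun i => slope N.+1 i u)
  (m := fun i => m (grid N.+1 i)) (block_size R N.+1) G0 B0 _ _) _.
- by move=> i i_n; exact: uG.
- by move=> i i_n; apply: mB; exact: grid_itv.
- by rewrite ler_wpM2l// lerD2l ler_nat leq_div2r.
Unshelve. all: by end_near. Qed.

(** A cell and the first cell of its block lie within (L + 1) T / n of each other, where L is the
    block size. This tends to 0, so both slopes are close to g at the start of the block by uniform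
    continuity. *)
Lemma smooth_oscillation (g u : R -> R) : smooth_path g u ->
  n%:R^-1 * \sum_(i < n) (slope n i u - slope n (block_start n i) u) ^+ 2
    @[n --> \oo] --> (0 : R).
Proof.
move=> gu; apply/cvgr0Pnorm_le => e e0.
have [cg _] := gu.
(* Two slopes then differ by at most 2 e1, whose square is e. *)
pose e1 := Num.sqrt e / 2; have e10 : 0 < e1 by rewrite divr_gt0 ?sqrtr_gt0.
have [del del0 gdel] := unif_continuous_itv cg e10.
have delT : 0 < del / (2 * T) by rewrite divr_gt0// mulr_gt0.
near=> n.
have n0 : (0 < n)%N by near: n; exact: nbhs_infty_gt.
have nR : 0 < n%:R :> R by rewrite ltr0n.
have L0 := block_size_gt0 R n0.
have small : (block_size R n).+1%:R / n%:R <= del / (2 * T).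
  by near: n; exact: block_size_small.
have term i : (i < n)%N -> `|slope n i u - slope n (block_start n i) u| <= 2 * e1.
  move=> i_n; set j := block_start n i.
  have ji : (j <= i)%N by exact: leq_divM.
  have close k : (j <= k <= i)%N -> `|slope n k u - g (grid n j)| <= e1.
    move=> /andP[jk ki]; apply: (slope_near gu); first exact: leq_ltn_trans i_n.
    move=> x; rewrite in_itv /= => /andP[kx xk].
    have xi : x <= grid n i.+1 by apply: (le_trans xk); exact: ler_grid.
    have jx : grid n j < x by apply: le_lt_trans kx; exact: ler_grid.
    have := grid_itv (leq_trans ji (ltnW i_n)); have := grid_itv i_n.
    rewrite !in_itv /= => /andP[_ iT] /andP[j0 jT].
    apply/ltW/gdel; rewrite ?in_itv /= ?j0 ?jT//.
      by rewrite (le_trans j0 (ltW jx)) (le_trans xi iT).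
    rewrite ger0_norm ?subr_ge0 ?(ltW jx)//.
    apply: (@le_lt_trans _ _ (grid n i.+1 - grid n j)); first by rewrite lerD2r.
    rewrite gridB ?leqW//.
    apply: (@le_lt_trans _ _ ((block_size R n).+1%:R * (T / n%:R))).
      rewrite ler_wpM2r ?divr_ge0 ?(ltW T0)// ler_nat.
      rewrite subSn// ltnS /j /block_start {1}(divn_eq i (block_size R n)) addKn.
      by rewrite ltnW// ltn_mod.
    rewrite mulrCA; apply: (@le_lt_trans _ _ (T * (del / (2 * T)))).
      by rewrite ler_pM2l.
    rewrite [ltLHS](_ : _ = del / 2) ?ltr_pdivrMr ?ltr_pMr ?ltr1n//.
    by field; rewrite gt_eqF.
  rewrite -(subrKA (g (grid n j))); apply: (le_trans (ler_normD _ _)).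
  rewrite mulr2n mulrDl mul1r lerD//; first by rewrite close// ji leqnn.
  by rewrite distrC close// leqnn.
rewrite ger0_norm; last by rewrite mulr_ge0 ?invr_ge0 ?sumr_ge0// => i _; rewrite sqr_ge0.
rewrite ler_pdivrMl//; apply: (@le_trans _ _ (\sum_(i < n) e)).
  apply: ler_sum => i _; rewrite -real_normK ?num_real//.
  rewrite -[leRHS](sqr_sqrtr (ltW e0)) lerXn2r ?nnegrE ?sqrtr_ge0//.
  by apply: (le_trans (term _ (ltn_ord i))); rewrite /e1 mulrC divfK.
by rewrite sumr_const card_ord -[leLHS]mulr_natl.
Unshelve. all: by end_near. Qed.

End smooth_paths.

(** * Negligibility of the drift in the realized covariance *)

Section negligible_drift.
Context (R : realType) (d : measure_display) (Omega : measurableType d)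
  (P : probability Omega R) (T : R) (T0 : 0 < T).
Implicit Types u v m x y : R -> Omega -> R.

Definition realized x y (n : nat) (w : Omega) : R :=
  T^-1 * \sum_(i < n) increment T n i (x^~ w) * increment T n i (y^~ w).

Lemma young (a b : R) : `|a * b| <= a ^+ 2 + b ^+ 2.
Proof.
have := sqr_ge0 (a - b); have := sqr_ge0 (a + b).
have := sqr_ge0 a; have := sqr_ge0 b.
by rewrite sqrrD sqrrB !mulr2n ler_norml => *; apply/andP; split; lra.
Qed.

Definition process_rv x : Prop :=
  forall t, t \in `[0, T] -> measurable_fun setT (x t).

Definition ae_smooth u : Prop :=
  {ae P, forall w, exists g, smooth_path T g (u^~ w)}.

Lemma increment_measurable x n i : process_rv x -> (i < n)%N ->
  measurable_fun setT (fun w => increment T n i (x^~ w)).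
Proof.
move=> mx i_n; apply: measurable_funB; apply: mx; apply: grid_itv => //.
exact: ltnW.
Qed.

Lemma measurable_sum_ord n (x : nat -> Omega -> R) :
  (forall i, (i < n)%N -> measurable_fun setT (x i)) ->
  measurable_fun setT (fun w => \sum_(i < n) x i w).
Proof.
elim: n => [|n ih] mx; first by under eq_fun do rewrite big_ord0; exact: measurable_cst.
under eq_fun do rewrite big_ord_recr /=.
by apply: measurable_funD; [apply: ih => i i_n; apply: mx; exact: ltnW|exact: mx].
Qed.

Lemma realized_measurable x y n : process_rv x -> process_rv y ->
  measurable_fun setT (realized x y n).
Proof.
move=> mx my; apply: measurable_funM => //.
apply: (measurable_sum_ord
  (x := fun i w => increment T n i (x^~ w) * increment T n i (y^~ w))) => i i_n.
by apply: measurable_funM; exact: increment_measurable.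
Qed.

Lemma smooth_cross_prob u v : process_rv u -> process_rv v ->
  ae_smooth u -> ae_smooth v ->
  cvg0_prob P (fun n w => Num.sqrt n%:R * realized u v n w).
Proof.
move=> mu mv su sv; apply: cvg0_prob_ae.
  by move=> n; apply: measurable_funM => //; exact: realized_measurable.
apply: filterS2 su sv => w [g gu] [g' gv]; exact: (smooth_cross T0 gu gv).
Qed.

(** The slope of u is split into its value frozen at the start of the block (sum A) and a deviation
    (sum C). A vanishes by [smooth_block]. For C, Young's inequality separates the mean squared
    deviation o, which vanishes by [smooth_oscillation], from the sum Q of squared noise increments,
    of expectation at most T s. *)
Lemma smooth_noise_prob u m (s : R) : process_rv u -> process_rv m ->
  ae_smooth u -> {ae P, forall w, {within `[0, T], continuous (m^~ w)}} ->
  (forall t t', 0 <= t -> t < t' ->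
     P.-integrable setT (EFin \o (fun w => (m t' w - m t w) ^+ 2)) /\
     \int[P]_w (m t' w - m t w) ^+ 2 = (t' - t) * s) ->
  cvg0_prob P (fun n w => Num.sqrt n%:R * realized u m n w).
Proof.
move=> mu mm su cm m2.
pose A n w := (Num.sqrt n%:R)^-1 * \sum_(i < n)
  slope T n (block_start R n i) (u^~ w) * increment T n i (m^~ w).
pose dev n i w := slope T n i (u^~ w) - slope T n (block_start R n i) (u^~ w).
pose C n w := (Num.sqrt n%:R)^-1 * \sum_(i < n) dev n i w * increment T n i (m^~ w).
pose o n w := n%:R^-1 * \sum_(i < n) dev n i w ^+ 2.
pose Q n w := \sum_(i < n) increment T n i (m^~ w) ^+ 2.
have start n i : (i < n)%N -> (block_start R n i < n)%N.
  by apply: leq_ltn_trans; exact: leq_divM.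
have mslope n i : (i < n)%N -> measurable_fun setT (fun w => slope T n i (u^~ w)).
  by move=> i_n; apply: measurable_funM => //; exact: increment_measurable.
have mA n : measurable_fun setT (A n).
  apply: measurable_funM => //; apply: (measurable_sum_ord (x := fun i w =>
    slope T n (block_start R n i) (u^~ w) * increment T n i (m^~ w))) => i i_n.
  by apply: measurable_funM; [apply: mslope; exact: start|exact: increment_measurable].
have mdev n i : (i < n)%N -> measurable_fun setT (dev n i).
  by move=> i_n; apply: measurable_funB; apply: mslope => //; exact: start.
have mC n : measurable_fun setT (C n).
  apply: measurable_funM => //; apply: (measurable_sum_ord (x := fun i w =>
    dev n i w * increment T n i (m^~ w))) => i i_n.
  by apply: measurable_funM; [exact: mdev|exact: increment_measurable].
have mo n : measurable_fun setT (o n).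
  apply: measurable_funM => //.
  apply: (measurable_sum_ord (x := fun i w => dev n i w ^+ 2)) => i i_n.
  by apply: measurable_funX; exact: mdev.
have E : (fun n w => Num.sqrt n%:R * realized u m n w) = (fun n w => A n w + C n w).
  apply/funext => n; apply/funext => w; rewrite /A /C -mulrDr -big_split /=.
  have [->|n0] := posnP n; first by rewrite /realized !big_ord0 !mulr0.
  have nR : 0 < n%:R :> R by rewrite ltr0n.
  rewrite /realized mulrA !mulr_sumr; apply: eq_bigr => i _.
  rewrite -mulrDl /dev addrC subrK slopeK//.
  have s0 : 0 < Num.sqrt n%:R :> R by rewrite sqrtr_gt0.
  have -> : T / n%:R = T / Num.sqrt n%:R ^+ 2 :> R by rewrite sqr_sqrtr// ler0n.
  by field; rewrite !gt_eqF.
have grid0 n i : 0 <= grid T n i by rewrite /grid mulr_ge0 ?divr_ge0 ?(ltW T0).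
have minc n i : (i < n)%N -> P.-integrable setT
    (EFin \o (fun w => increment T n i (m^~ w) ^+ 2)) /\
    \int[P]_w increment T n i (m^~ w) ^+ 2 = T / n%:R * s.
  move=> i_n; rewrite -(gridS T n i); apply: m2 => //.
  rewrite -subr_gt0 gridS divr_gt0// ltr0n; exact: leq_ltn_trans i_n.
have iQ n : P.-integrable setT (EFin \o Q n).
  by apply: integrable_sumr => i _; have [] := minc n i (ltn_ord i).
have s0 : 0 <= s.
  have [_ e] := m2 0 1 (lexx _) ltr01.
  rewrite subr0 mul1r in e; rewrite -e; apply: Rintegral_ge0 => w _; exact: sqr_ge0.
have QK n : \int[P]_w Q n w <= T * s.
  rewrite Rintegral_sum => [|i _]; last by have [] := minc n i (ltn_ord i).
  rewrite (eq_bigr (fun=> T / n%:R * s)) => [|i _]; last by have [] := minc n i (ltn_ord i).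
  rewrite sumr_const card_ord; have [->|n0] := posnP n; first by rewrite mulr_ge0// ltW.
  by rewrite -[leLHS]mulr_natl mulrA (mulrC n%:R) divfK// pnatr_eq0 -lt0n.
rewrite E; apply: cvg0_probD => //.
  apply: cvg0_prob_ae => //; apply: filterS2 su cm => w [g gu] cw.
  exact: (smooth_block T0 gu cw).
apply: (cvg0_prob_young (o := o) (Q := Q) (K := T * s)) => //.
- by move=> n w; apply: sumr_ge0 => i _; exact: sqr_ge0.
- move=> n w lam lam0; rewrite /C /o /Q !mulr_sumr -big_split /=.
  apply: le_trans (ler_norm_sum _ _ _) _; apply: ler_sum => i _.
  set a := dev _ _ _; set b := increment _ _ _ _.
  have sn : n%:R^-1 = (Num.sqrt n%:R)^-1 ^+ 2 :> R.
    by rewrite exprVn sqr_sqrtr// ler0n.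
  rewrite sn; set r := (Num.sqrt _)^-1.
  have h z : 0 < z -> `|r * (a * b)| <= z^-1 * (r ^+ 2 * a ^+ 2) + z * b ^+ 2.
    move=> z0; pose y := Num.sqrt z; have y0 : 0 < y by rewrite sqrtr_gt0.
    have -> : z = y ^+ 2 by rewrite sqr_sqrtr// ltW.
    have -> : r * (a * b) = (y^-1 * r * a) * (y * b) by field; rewrite gt_eqF.
    apply: le_trans (young _ _) _.
    by rewrite !exprMn exprVn mulrA.
  exact: h.
- apply: cvg0_prob_ae => //; apply: filterS su => w [g gu].
  exact: (smooth_oscillation T0 gu).
Qed.

(** By bilinearity with x = u + m and y = v + m', the difference is a smooth-smooth term plus two
    smooth-noise terms. *)
Lemma realized_drift (x m y m' : R -> Omega -> R) (s s' : R) :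
  process_rv x -> process_rv m -> process_rv y -> process_rv m' ->
  ae_smooth (fun t w => x t w - m t w) -> ae_smooth (fun t w => y t w - m' t w) ->
  {ae P, forall w, {within `[0, T], continuous (m^~ w)}} ->
  {ae P, forall w, {within `[0, T], continuous (m'^~ w)}} ->
  (forall t t', 0 <= t -> t < t' ->
     P.-integrable setT (EFin \o (fun w => (m t' w - m t w) ^+ 2)) /\
     \int[P]_w (m t' w - m t w) ^+ 2 = (t' - t) * s) ->
  (forall t t', 0 <= t -> t < t' ->
     P.-integrable setT (EFin \o (fun w => (m' t' w - m' t w) ^+ 2)) /\
     \int[P]_w (m' t' w - m' t w) ^+ 2 = (t' - t) * s') ->
  cvg0_prob P (fun n w => Num.sqrt n%:R * (realized x y n w - realized m m' n w)).
Proof.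
move=> mx mm my mm' sx sy cm cm' m2 m'2.
pose u t w := x t w - m t w; pose v t w := y t w - m' t w.
have mu : process_rv u by move=> t tT; apply: measurable_funB; [exact: mx|exact: mm].
have mv : process_rv v by move=> t tT; apply: measurable_funB; [exact: my|exact: mm'].
have -> : (fun n w => Num.sqrt n%:R * (realized x y n w - realized m m' n w)) =
  (fun n w => Num.sqrt n%:R * realized u v n w + (Num.sqrt n%:R * realized u m' n w
    + Num.sqrt n%:R * realized v m n w)).
  apply/funext => n; apply/funext => w; rewrite -!mulrDr; congr (_ * _).
  rewrite /realized -mulrBr; congr (_ * _).
  rewrite -sumrB -!big_split /=; apply: eq_bigr => i _.
  by rewrite /increment /u /v; ring.
have mr z z' : process_rv z -> process_rv z' ->
    forall n, measurable_fun setT (fun w => Num.sqrt n%:R * realized z z' n w).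
  by move=> mz mz' n; apply: measurable_funM => //; exact: realized_measurable.
apply: cvg0_probD; [exact: mr| | |apply: cvg0_probD; try exact: mr].
- by move=> n; apply: measurable_funD; exact: mr.
- exact: smooth_cross_prob.
- exact: smooth_noise_prob m'2.
- exact: smooth_noise_prob m2.
Qed.

End negligible_drift.

(** * Realized covariance of a Gaussian noise *)

Section indep_sum.
Context (R : realType) (d : measure_display) (Omega : measurableType d)
  (P : probability Omega R).

(** Each new term is centred and independent of the preceding partial sum, so the cross term
    integrates to 0. *)
Lemma indep_sum_sqr (x : nat -> Omega -> R) n :
  (forall i, (i < n)%N -> measurable_fun setT (x i)) ->
  (forall i, (i < n)%N -> indep2 P (fun w => \sum_(j < i) x j w) (x i)) ->
  (forall i, (i < n)%N -> P.-integrable setT (EFin \o x i)) ->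
  (forall i, (i < n)%N -> P.-integrable setT (EFin \o (fun w => x i w ^+ 2))) ->
  (forall i, (i < n)%N -> \int[P]_w x i w = 0) ->
  P.-integrable setT (EFin \o (fun w => (\sum_(i < n) x i w) ^+ 2)) /\
  \int[P]_w (\sum_(i < n) x i w) ^+ 2 = \sum_(i < n) \int[P]_w (x i w ^+ 2).
Proof.
elim: n => [|n ih] mx ix i1 i2 e1.
  rewrite big_ord0 (_ : (fun w => _) = fun _ => 0).
    by split; [exact: integrable_cst|rewrite Rintegral_cstT].
  by apply/funext => w; rewrite big_ord0 expr0n.
have [|||||iS eS] := ih.
- by move=> i i_n; apply: mx; exact: ltnW.
- by move=> i i_n; apply: ix; exact: ltnW.
- by move=> i i_n; apply: i1; exact: ltnW.
- by move=> i i_n; apply: i2; exact: ltnW.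
- by move=> i i_n; apply: e1; exact: ltnW.
pose S w := \sum_(i < n) x i w.
have mS : measurable_fun setT S.
  by apply: (measurable_sum_ord (x := x)) => i i_n; apply: mx; exact: ltnW.
have iS1 : P.-integrable setT (EFin \o S).
  by apply: integrable_sumr => i _; apply: i1; exact: leqW (ltn_ord i).
have [iSx eSx] := indep2_integrableM mS (mx _ (ltnSn n)) (ix _ (ltnSn n))
  iS1 (i1 _ (ltnSn n)).
rewrite e1// mulr0 in eSx.
have E w : (\sum_(i < n.+1) x i w) ^+ 2 = S w ^+ 2 + (2 * (S w * x n w) + x n w ^+ 2).
  by rewrite big_ord_recr /= -/(S w); ring.
have i2x : P.-integrable setT (EFin \o (fun w => 2 * (S w * x n w))).
  exact: integrable_scaler.
have i3x : P.-integrable setT (EFin \o (fun w => 2 * (S w * x n w) + x n w ^+ 2)).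
  by apply: integrable_addr => //; exact: i2.
rewrite (_ : (fun w => _) = fun w => S w ^+ 2 + (2 * (S w * x n w) + x n w ^+ 2)); last first.
  by apply/funext => w; exact: E.
split; first exact: integrable_addr.
rewrite (RintegralD measurableT iS i3x) (RintegralD measurableT i2x (i2 _ (ltnSn n))).
by rewrite RintegralZl// eSx mulr0 add0r eS big_ord_recr.
Qed.

End indep_sum.

Section gaussian_noise.
Context (R : realType) (d : measure_display) (Omega : measurableType d)
  (P : probability Omega R) (p : nat).

(** A process with independent Gaussian increments of covariance S per unit time. Independence is
    stated through two independent sigma-algebras, one carrying the past increments and one the
    current increment, to suit the sequential hypotheses of [cf_clt]. *)
Record gaussian_noise (S : 'M[R]_p) (M : R -> Omega -> 'cV[R]_p) : Prop := {
  noise_rv : forall t : R, 0 <= t -> random_vector (M t) ;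
  noise_normal : forall (a : 'cV[R]_p) (s t : R), 0 <= s -> s < t ->
    normal_rv P ((t - s) * (a^T *m S *m a) 0 0)
      (fun w => (a^T *m (M t w - M s w)) 0 0) ;
  noise_independent : forall (t : nat -> R) i, 0 <= t 0%N ->
    (forall i, t i <= t i.+1) -> exists H H' : set (set Omega),
    [/\ forall A B, <<s H >> A -> <<s H' >> B -> P (A `&` B) = (P A * P B)%E,
        forall j k, (j < i)%N ->
          measurable_wrt <<s H >> (fun w => (M (t j.+1) w - M (t j) w) k 0) &
        forall k, measurable_wrt <<s H' >> (fun w => (M (t i.+1) w - M (t i) w) k 0)]
}.

Context (T : R) (T0 : 0 < T).

Lemma realized_covE (X : R -> Omega -> 'cV[R]_p) n w i j :
  realized_cov T X n w i j =
  realized T (fun t w => X t w i 0) (fun t w => X t w j 0) n w.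
Proof.
rewrite mxE /realized summxE; congr (_ * _); apply: eq_bigr => k _.
by rewrite mxE big_ord1 !mxE.
Qed.

Lemma realized_cov_sym (X : R -> Omega -> 'cV[R]_p) n w :
  (realized_cov T X n w)^T = realized_cov T X n w.
Proof.
apply/matrixP => i j; rewrite mxE !realized_covE /realized; congr (_ * _).
by apply: eq_bigr => k _; rewrite mulrC.
Qed.

Context (r : nat) (W : R -> Omega -> 'cV[R]_r) (WP : wiener P W) (k0 : 'I_r).
Context (S : 'M[R]_p) (symS : S^T = S)
  (S_ge0 : forall a : 'cV[R]_p, 0 <= (a^T *m S *m a) 0 0).
Context (M : R -> Omega -> 'cV[R]_p) (MN : gaussian_noise S M).


Definition scaled_increment (n i : nat) (w : Omega) : 'cV[R]_p :=
  (Num.sqrt (T / n%:R))^-1 *: (M (grid T n i.+1) w - M (grid T n i) w).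

Lemma scaled_increment_normal n i : (0 < n)%N -> forall a : 'cV[R]_p,
  normal_rv P ((a^T *m S *m a) 0 0) (fun w => (a^T *m scaled_increment n i w) 0 0).
Proof.
move=> n0 a; have h0 : 0 < T / n%:R by rewrite divr_gt0// ltr0n.
have g0 : 0 <= grid T n i by rewrite /grid mulr_ge0// ltW.
have lt : grid T n i < grid T n i.+1 by rewrite -subr_gt0 gridS.
have := noise_normal MN ((Num.sqrt (T / n%:R))^-1 *: a) g0 lt.
rewrite gridS; set c := (Num.sqrt _)^-1.
have c2 : T / n%:R * (c * c) = 1.
  by rewrite /c -invfM -expr2 sqr_sqrtr ?(ltW h0)// divff// gt_eqF.
have -> : (T / n%:R) * ((c *: a)^T *m S *m (c *: a)) 0 0 = (a^T *m S *m a) 0 0.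
  rewrite [(c *: a)^T]linearZ /= -!scalemxAl -scalemxAr !mxE.
  by rewrite (mulrA c) (mulrA (T / _)) c2 mul1r.
congr normal_rv; apply/funext => w.
by rewrite /scaled_increment [(c *: a)^T]linearZ /= -scalemxAl -scalemxAr.
Qed.

Let z := scaled_increment.

Definition vech_error (X : R -> Omega -> 'cV[R]_p) (n : nat) (w : Omega) :
    'cV[R]_((p * p.+1)./2) :=
  Num.sqrt n%:R *: (vech (realized_cov T X n w) - vech S).

(** With A = [vech_form a], the i-th term of n^(-1/2) times the sum of z^T A z - tr(A S), where z is
    the normalized increment. *)
Definition summand (a : 'cV[R]_((p * p.+1)./2)) (n i : nat) (w : Omega) : R :=
  (Num.sqrt n%:R)^-1 *
    (qform (vech_form a) (z n i w) - qform_mean S (vech_form a)).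

Lemma realized_cov_scaled n w j k : (0 < n)%N ->
  n%:R * realized_cov T M n w j k = \sum_(i < n) z n i w j 0 * z n i w k 0.
Proof.
move=> n0; have nR : 0 < n%:R :> R by rewrite ltr0n.
have h0 : 0 < T / n%:R by rewrite divr_gt0.
rewrite realized_covE /realized mulrA mulr_sumr; apply: eq_bigr => i _.
rewrite /z /scaled_increment /increment !mxE [RHS]mulrACA -invfM -expr2.
by rewrite sqr_sqrtr ?(ltW h0)// invf_div.
Qed.

Lemma vech_error_sum a n w :
  (a^T *m vech_error M n w) 0 0 = \sum_(i < n) summand a n i w.
Proof.
(* For n = 0 both sides vanish, because of the factor sqrt 0. *)
have [->|n0] := posnP n.
  by rewrite big_ord0 /vech_error sqrtr0 scale0r mulmx0 mxE.
have nR : 0 < n%:R :> R by rewrite ltr0n.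
rewrite -scalemxAr mulmxBr [LHS]mxE [X in _ * X]mxE [X in _ + X]mxE.
rewrite !vech_formE ?realized_cov_sym//.
rewrite -mulr_sumr sumrB sumr_const card_ord -[qform_mean _ _ *+ n]mulr_natl.
have -> : \sum_(i < n) qform (vech_form a) (z n i w) =
    n%:R * \sum_j \sum_k vech_form a j k * realized_cov T M n w j k.
  rewrite mulr_sumr exchange_big /=; apply: eq_bigr => j _.
  rewrite mulr_sumr exchange_big /=; apply: eq_bigr => k _.
  by rewrite mulrCA realized_cov_scaled// mulr_sumr.
rewrite -mulrBr mulrA; congr (_ * _).
have s0 : 0 < Num.sqrt n%:R :> R by rewrite sqrtr_gt0.
by rewrite -{3}(sqr_sqrtr (ltW nR)) expr2 mulKf// gt_eqF.
Qed.

Lemma summand_measurable a n i : (i < n)%N -> measurable_fun setT (summand a n i).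
Proof.
move=> i_n; have n0 : (0 < n)%N by exact: leq_ltn_trans i_n.
apply: measurable_funM => //; apply: measurable_funB => //.
exact: (qform_measurable (vech_form a) (scaled_increment_normal i n0)).
Qed.

Lemma summand_indep a n i : (i < n)%N ->
  indep2 P (fun w => \sum_(j < i) summand a n j w) (summand a n i).
Proof.
move=> i_n.
have g0 : 0 <= grid T n 0 by rewrite /grid mul0r.
have gS j : grid T n j <= grid T n j.+1 by exact: ler_grid.
have [H [H' [HH mH mH']]] := noise_independent MN i g0 gS.
have coord (H0 : set (set Omega)) j :
    (forall k, measurable_wrt <<s H0 >>
       (fun w => (M (grid T n j.+1) w - M (grid T n j) w) k 0)) ->
    measurable_wrt <<s H0 >> (summand a n j).
  move=> mz; apply: measurable_wrtM; first exact: measurable_wrt_cst.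
  apply: measurable_wrtB; last exact: measurable_wrt_cst.
  have mzk k : measurable_wrt <<s H0 >> (fun w => z n j w k 0).
    rewrite (_ : (fun w => _) = fun w => (Num.sqrt (T / n%:R))^-1 *
        (M (grid T n j.+1) w - M (grid T n j) w) k 0); last first.
      by apply/funext => w; rewrite mxE.
    by apply: measurable_wrtM; first exact: measurable_wrt_cst.
  apply: measurable_wrt_sum => k _; apply: measurable_wrt_sum => l _.
  apply: measurable_wrtM; first exact: measurable_wrt_cst.
  exact: measurable_wrtM.
move=> A B mA mB; apply: HH; last by apply: coord => // k; exact: mH'.
suff mS : measurable_wrt <<s H >> (fun w => \sum_(j < i) summand a n j w) by exact: mS.
apply: measurable_wrt_sum => j _; by apply: coord => k; exact: mH.
Qed.

Let nz n i (i_n : (i < n)%N) :=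
  scaled_increment_normal i (leq_ltn_trans (leq0n i) i_n).

Let sym_form (a : 'cV[R]_((p * p.+1)./2)) i j : vech_form a i j = vech_form a j i.
Proof. exact: vech_form_sym. Qed.

Lemma summand_mean a n i : (i < n)%N ->
  P.-integrable setT (EFin \o summand a n i) /\ \int[P]_w summand a n i w = 0.
Proof.
move=> i_n; have [iU eU] := qform_centered WP k0 symS S_ge0 (vech_form a) (nz i_n).
split; first exact: integrable_scaler.
by rewrite RintegralZl// eU mulr0.
Qed.

Lemma summand_variance a n i : (i < n)%N ->
  P.-integrable setT (EFin \o (fun w => summand a n i w ^+ 2)) /\
  \int[P]_w (summand a n i w ^+ 2) = qform_var S (vech_form a) / n%:R.
Proof.
move=> i_n; have [iU eU] := qform_variance WP k0 symS S_ge0 (sym_form a) (nz i_n).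
rewrite (_ : (fun w => _) = fun w => n%:R^-1 *
  (qform (vech_form a) (z n i w) - qform_mean S (vech_form a)) ^+ 2); last first.
  by apply/funext => w; rewrite exprMn exprVn sqr_sqrtr.
split; first exact: integrable_scaler.
by rewrite RintegralZl// eU mulrC.
Qed.

Lemma summand_fourth a n i : (i < n)%N ->
  P.-integrable setT (EFin \o (fun w => summand a n i w ^+ 4)) /\
  \int[P]_w (summand a n i w ^+ 4) <= qform_bound S (vech_form a) / n%:R ^+ 2.
Proof.
move=> i_n; have [iU eU] := qform_fourth WP k0 S_ge0 (vech_form a) (nz i_n).
rewrite (_ : (fun w => _) = fun w => n%:R ^- 2 *
  (qform (vech_form a) (z n i w) - qform_mean S (vech_form a)) ^+ 4); last first.
  by apply/funext => w; rewrite exprMn exprVn (exprM _ 2 2) sqr_sqrtr.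
split; first exact: integrable_scaler.
by rewrite RintegralZl// mulrC ler_wpM2r// invr_ge0 sqr_ge0.
Qed.

Lemma vech_error_cf a th :
  \int[P]_w cos (th + (a^T *m vech_error M n w) 0 0) @[n --> \oo] -->
  expR (- (qform_var S (vech_form a) / 2)) * cos th.
Proof.
under eq_cvg do under eq_Rintegral do rewrite vech_error_sum.
apply: (cf_clt (X := summand a) (C := qform_bound S (vech_form a))) => n i i_n.
- exact: summand_measurable.
- exact: summand_indep.
- by case: (summand_mean a i_n).
- by case: (summand_variance a i_n).
- by case: (summand_fourth a i_n).
- by case: (summand_mean a i_n).
- by case: (summand_variance a i_n).
- by case: (summand_fourth a i_n).
Qed.

(** A second-moment bound uniform in n, which is the source of tightness. *)
Lemma vech_error_sqr a n :
  P.-integrable setT (EFin \o (fun w => (a^T *m vech_error M n w) 0 0 ^+ 2)) /\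
  \int[P]_w (a^T *m vech_error M n w) 0 0 ^+ 2 <= qform_var S (vech_form a).
Proof.
have [|||||iS eS] := @indep_sum_sqr _ _ _ P (summand a n) n.
- by move=> i i_n; exact: summand_measurable.
- by move=> i i_n; exact: summand_indep.
- by move=> i i_n; case: (summand_mean a i_n).
- by move=> i i_n; case: (summand_variance a i_n).
- by move=> i i_n; case: (summand_mean a i_n).
rewrite (_ : (fun w => _) = fun w => (\sum_(i < n) summand a n i w) ^+ 2); last first.
  by apply/funext => w; rewrite vech_error_sum.
split=> //; rewrite eS.
rewrite (eq_bigr (fun=> qform_var S (vech_form a) / n%:R)) => [|i _]; last first.
  by case: (summand_variance a (ltn_ord i)).
(* For n = 0 the left-hand side is 0, and the variance is nonnegative because it is the integral of
   a square. *)
rewrite sumr_const card_ord -[leLHS]mulr_natl; have [->|n0] := posnP n.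
  have [_ <-] := qform_variance WP k0 symS S_ge0 (sym_form a)
    (scaled_increment_normal 0 (ltn0Sn 0)).
  by rewrite mul0r; apply: Rintegral_ge0 => w _; exact: sqr_ge0.
by rewrite mulrC divfK// pnatr_eq0 -lt0n.
Qed.

Lemma noise_increment_sqr (b : 'I_p) (s t : R) : 0 <= s -> s < t ->
  P.-integrable setT (EFin \o (fun w => (M t w b 0 - M s w b 0) ^+ 2)) /\
  \int[P]_w (M t w b 0 - M s w b 0) ^+ 2 = (t - s) * S b b.
Proof.
move=> s0 st; pose e : 'cV[R]_p := delta_mx b 0.
have qE : (e^T *m S *m e) 0 0 = S b b by rewrite -mulmxA delta_mx_dot -colE mxE.
have := noise_normal MN e s0 st; rewrite qE.
under [X in normal_rv _ _ X]eq_fun do rewrite delta_mx_dot.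
move=> nb; have v0 : 0 <= (t - s) * S b b.
  by rewrite mulr_ge0 ?subr_ge0 ?(ltW st)// -qE.
rewrite (_ : (fun w => _) = fun w => (M t w - M s w) b 0 ^+ 2); last first.
  by apply/funext => w; rewrite !mxE.
split; first exact: (integrable_normal_pow WP k0 v0 nb 2).
rewrite (normal_moment_even WP k0 v0 nb 1) (@odd_prod_natr R 1 1) ?big_ord1//.
by rewrite mulr1 expr1.
Qed.

End gaussian_noise.

(** * Gaussian noise driven by independent Wiener processes *)

Lemma sigmaT (Omega : pointedType) (H : set (set Omega)) : <<s H >> setT.
Proof. exact: (@measurableT _ (g_sigma_algebraType H)). Qed.

Lemma sigma_setI (Omega : pointedType) (H : set (set Omega)) : setI_closed <<s H >>.
Proof. by move=> A B; exact: (@measurableI _ (g_sigma_algebraType H)). Qed.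

Section wiener_noise.
Context (R : realType) (d : measure_display) (Omega : measurableType d)
  (P : probability Omega R) (p : nat).
Context (r0 : nat) (W0 : R -> Omega -> 'cV[R]_r0) (W0P : wiener P W0) (k0 : 'I_r0).
Context (J : finType) (r : J -> nat) (W : forall j, R -> Omega -> 'cV[R]_(r j))
  (K : forall j, 'M[R]_(p, r j)).
Hypothesis WP : forall j, wiener P (W j).

Let G j := sigma_family `[0, +oo[ (W j).
Hypothesis indG : mutual_independence P G.

Let M t w := \sum_j K j *m W j t w.
Let S := \sum_j K j *m (K j)^T.

Let incr_measurable j (s t : R) k : 0 <= s -> 0 <= t ->
  measurable_wrt (G j) (fun w => (W j t w - W j s w) k 0).
Proof.
move=> s0 t0; under eq_fun do rewrite mxE [X in _ + X]mxE.
apply: measurable_wrtB => B mB; apply: sub_sigma_algebra.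
- by exists t, k, B; split=> //; rewrite /= in_itv /= t0.
- by exists s, k, B; split=> //; rewrite /= in_itv /= s0.
Qed.

Let Gm j : G j `<=` measurable.
Proof.
apply: smallest_sub; first exact: sigma_algebra_measurable.
move=> _ [t [k [B [t0 mB ->]]]]; rewrite /= in_itv /= andbT in t0.
by rewrite -[X in measurable X]setTI; exact: (wiener_rv (WP j) t0).
Qed.

(** An increment of M is a sum of independent normal variables, one per Wiener process, so
    [normal_rv_sum] gives its law. For independence in time, the increments of all the processes
    over all the cells form a mutually independent double array, whose past and current columns are
    grouped by [indep_fam_sigma]. *)
Lemma wiener_noise : gaussian_noise P S M.
Proof.
split.
- move=> t t0 i; rewrite (_ : (fun w => _) = fun w => \sum_j \sum_k K j i k * W j t w k 0).
    apply: measurable_sum => j; apply: measurable_sum => k.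
    by apply: measurable_funM => //; exact: (wiener_rv (WP j)).
  apply/funext => w; rewrite summxE; apply: eq_bigr => j _; by rewrite mxE.
- move=> a s t s0 st.
  pose b j : 'cV[R]_(r j) := (K j)^T *m a.
  have -> : (t - s) * (a^T *m S *m a) 0 0 =
      \sum_(j in [set: J]%SET) (t - s) * ((b j)^T *m b j) 0 0.
    rewrite -mulr_sumr; congr (_ * _).
    rewrite mulmx_sumr mulmx_suml summxE; apply: eq_big => [j|j _]; first by rewrite inE.
    by rewrite /b trmx_mul trmxK !mulmxA.
  rewrite (_ : (fun w => _) = fun w => \sum_(j in [set: J]%SET)
      ((b j)^T *m (W j t w - W j s w)) 0 0); last first.
    apply/funext => w; rewrite /M -sumrB mulmx_sumr summxE.
    apply: eq_big => [j|j _]; first by rewrite inE.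
    by rewrite /b trmx_mul trmxK -mulmxBr mulmxA.
  have nj j : normal_rv P ((t - s) * ((b j)^T *m b j) 0 0)
      (fun w => ((b j)^T *m (W j t w - W j s w)) 0 0).
    have [mW nW] := wiener_normal (WP j) s0 st.
    split; first exact: random_vector_dot.
    have e0 : ((b j)^T *m (0 : 'cV[R]_(r j))) 0 0 = 0 by rewrite mulmx0 mxE.
    have ev : ((b j)^T *m (t - s)%:M *m b j) 0 0 = (t - s) * ((b j)^T *m b j) 0 0.
      by rewrite mul_mx_scalar -scalemxAl mxE.
    by move=> A mA; have := nW (b j) A mA; rewrite e0 ev.
  apply: (normal_rv_sum (F := G) (x := fun j w => ((b j)^T *m (W j t w - W j s w)) 0 0)
    (v := fun j => (t - s) * ((b j)^T *m b j) 0 0) _ _ Gm indG k0 _ W0P) => //.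
  + by move=> j; exact: sigmaT.
  + by move=> j; exact: sigma_setI.
  + move=> j; rewrite mulr_ge0 ?subr_ge0 ?(ltW st)// mxE sumr_ge0// => k _.
    by rewrite mxE -expr2 sqr_ge0.
  + move=> j; rewrite (_ : (fun w => _) = fun w =>
        \sum_k b j k 0 * (W j t w - W j s w) k 0); last first.
      by apply/funext => w; rewrite mxE; apply: eq_bigr => k _; rewrite mxE.
    apply: measurable_wrt_sum => k _; apply: measurable_wrtM.
      exact: measurable_wrt_cst.
    by apply: incr_measurable => //; rewrite (le_trans s0)// ltW.
- move=> t i t0 tS.
  have t_ge0 j : 0 <= t j by elim: j => // j ih; exact: le_trans (tS j).
  (* The sigma-algebra of the increment of the j-th process over the k-th cell; cells 0 to i are
     needed. *)
  pose F (jk : J * 'I_i.+1) := sigma_family [set: unit]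
    (fun _ w => W jk.1 (t jk.2.+1) w - W jk.1 (t jk.2) w).
  have FG j k : F (j, k) `<=` G j.
    apply: smallest_sub; first exact: smallest_sigma_algebra.
    move=> _ [_ [c [B [_ mB ->]]]]; exact: incr_measurable mB.
  have indF : mutual_independence P F.
    apply: (mutual_independence_pair (G := G)) => //.
    - by move=> j; exact: sigmaT.
    - by move=> j; exact: sigma_setI.
    - by move=> j; exact: (wiener_independent (WP j)).
  have Fm jk : F jk `<=` measurable.
    by case: jk => j k; apply: subset_trans (FG j k) _; exact: Gm.
  have coord (I : {set J * 'I_i.+1}) (l : 'I_i.+1) k : (forall j, (j, l) \in I) ->
      measurable_wrt (fam_sigma F I) (fun w => (M (t l.+1) w - M (t l) w) k 0).
    move=> jI; rewrite (_ : (fun w => _) = fun w => \sum_j \sum_c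
        K j k c * (W j (t l.+1) w - W j (t l) w) c 0); last first.
      apply/funext => w; rewrite /M -sumrB summxE; apply: eq_bigr => j _.
      by rewrite -mulmxBr mxE.
    apply: measurable_wrt_sum => j _; apply: measurable_wrt_sum => c _.
    apply: measurable_wrtM; first exact: measurable_wrt_cst.
    apply: measurable_wrt_sub (fam_sigma_sub (jI j)) _ => B mB.
    by apply: sub_sigma_algebra; exists tt, c, B.
  (* [I1] holds the past cells of all processes, [I2] the current cell, whose index i is
     [ord_max]. *)
  pose I1 : {set J * 'I_i.+1} := [set jk : J * 'I_i.+1 | (jk.2 < i)%N]%SET.
  pose I2 : {set J * 'I_i.+1} := [set jk : J * 'I_i.+1 | jk.2 == ord_max]%SET.
  exists [set A | exists2 jk, jk \in I1 & F jk A], [set A | exists2 jk, jk \in I2 & F jk A].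
  split.
  + move=> A B HA HB; apply: (indep_fam_sigma (J := I1) (K := I2) _ _ Fm indF) => //.
    * by move=> jk; exact: sigmaT.
    * by move=> jk; exact: sigma_setI.
    * move=> [j k]; rewrite !inE /= => ki; apply/eqP => kE.
      by move: ki; rewrite kE ltnn.
  + move=> j k ji; have ji1 : (j < i.+1)%N by exact: leqW.
    apply: (coord I1 (Ordinal ji1) k) => j'; by rewrite inE.
  + by move=> k; apply: (coord I2 ord_max k) => j; rewrite inE.
Qed.

End wiener_noise.

(** * Stability under perturbations vanishing in probability *)

Lemma cos_lipschitz (R : realType) (a b : R) : `|cos a - cos b| <= `|a - b|.
Proof.
wlog ba : a b / b <= a.
  move=> h; have [/h//|/ltW/h] := leP b a.
  by rewrite distrC (distrC a).
have [c _ ->] := @MVT_segment R (@cos R) (fun x => - sin x) b a ba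
  (fun x _ => is_derive_cos x) (continuous_subspaceT (@continuous_cos R)).
by rewrite normrM ler_piMl// normrN ler_norml sin_geN1 sin_le1.
Qed.

Section perturbation.
Context (R : realType) (d : measure_display) (Omega : measurableType d)
  (P : probability Omega R).
Implicit Types x y : nat -> Omega -> R.

Lemma cvg0_prob_scale (c : R) x : cvg0_prob P x -> (forall n, measurable_fun setT (x n)) ->
  cvg0_prob P (fun n w => c * x n w).
Proof.
move=> cx mx e h e0 h0; have c0 : 0 < `|c| + 1 by rewrite ltr_wpDl.
have := cx _ _ (divr_gt0 e0 c0) h0; apply: filterS => n; apply: le_trans.
apply: le_prob; try exact: measurable_normr_gt.
  by apply: measurable_normr_gt; exact: measurable_funM.
move=> w /= ec; rewrite ltr_pdivrMr//; apply: (lt_le_trans ec).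
by rewrite normrM mulrC ler_wpM2l// lerDl.
Qed.

Lemma cvg0_prob_sum (I : Type) (s : seq I) (x : I -> nat -> Omega -> R) :
  (forall i n, measurable_fun setT (x i n)) -> (forall i, cvg0_prob P (x i)) ->
  cvg0_prob P (fun n w => \sum_(i <- s) x i n w).
Proof.
move=> mx cx; elim: s => [|i s ih].
  move=> e h e0 h0; apply: nearW => n.
  rewrite (_ : [set w | _] = set0) ?measure0 ?lee_fin ?ltW//.
  by apply/seteqP; split => w //=; rewrite big_nil normr0 ltNge (ltW e0).
rewrite (_ : (fun n w => _) = fun n w => x i n w + \sum_(j <- s) x j n w).
  by apply: cvg0_probD => // n; exact: measurable_sum.
by apply/funext => n; apply/funext => w; rewrite big_cons.
Qed.

(** Slutsky's lemma for characteristic functions: the two cosines differ by at most e/4 where |x| <=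
    e/4 and by at most 2 elsewhere, an event of probability at most e/4 for large n. *)
Lemma cos_perturbation x y (th : R) : (forall n, measurable_fun setT (x n)) ->
  (forall n, measurable_fun setT (y n)) -> cvg0_prob P x ->
  \int[P]_w cos (th + (y n w + x n w)) - \int[P]_w cos (th + y n w)
    @[n --> \oo] --> (0 : R).
Proof.
move=> mx my cx; apply/cvgr0Pnorm_le => e e0.
have e40 : 0 < e / 4 by rewrite divr_gt0.
have := cx _ _ e40 e40; apply: filterS => n hn.
have mA := measurable_normr_gt (e / 4) (mx n).
set A := [set w | _] in hn mA.
have mcst c : measurable_fun setT (fun _ : Omega => c : R) by exact: measurable_cst.
have i1 : P.-integrable setT (EFin \o (fun w => cos (th + (y n w + x n w)))).
  by apply: integrable_cos; apply: measurable_funD => //; exact: measurable_funD.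
have i2 : P.-integrable setT (EFin \o (fun w => cos (th + y n w))).
  by apply: integrable_cos; exact: measurable_funD.
have i12 := integrable_subr i1 i2.
have iA := integrable_indicator P mA.
have i2A := integrable_scaler 2 iA.
have ic := integrable_cst P (e / 4).
rewrite -(RintegralB measurableT i1 i2).
apply: (le_trans (le_normr_Rintegral measurableT i12)).
apply: (@le_trans _ _ (\int[P]_w (e / 4 + 2 * \1_A w))).
  apply: le_Rintegral => //.
  - exact: integrable_norm.
  - exact: integrable_addr.
  move=> w _ /=; have [wA|wA] := pselect (A w).
    rewrite indicE mem_set//= mulr1; apply: (@le_trans _ _ 2); last by rewrite lerDr ltW.
    apply: le_trans (ler_normB _ _) _.
    have := normr_cos_le1 (th + (y n w + x n w)).
    have := normr_cos_le1 (th + y n w); lra.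
  rewrite indicE memNset//= mulr0 addr0; apply: (le_trans (cos_lipschitz _ _)).
  by rewrite opprD addrACA subrr add0r addrAC subrr add0r leNgt; exact/negP.
rewrite (RintegralD measurableT ic i2A) RintegralZl// Rintegral_cstT Rintegral_indicator//.
have : fine (P A) <= e / 4 by rewrite -lee_fin fineK ?fin_num_measure.
lra.
Qed.

Lemma tail_perturbation x y (e c : R) : (forall n, measurable_fun setT (x n)) ->
  (forall n, measurable_fun setT (y n)) -> cvg0_prob P x -> 0 < e ->
  (\forall n \near \oo, (P [set w | (c < `|y n w|)%R] <= e%:E)%E) ->
  \forall n \near \oo, (P [set w | (c + 1 < `|y n w + x n w|)%R] <= (e + e)%:E)%E.
Proof.
move=> mx my cx e0; have := cx 1 e ltr01 e0; apply: filterS2 => n xn yn.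
apply: prob_normr_le2 yn xn => //; first exact: measurable_funD.
by move=> w yc x1; apply: (le_trans (ler_normD _ _)); rewrite lerD.
Qed.

End perturbation.

Lemma vech_errorE (R : realType) (d : measure_display) (Omega : measurableType d)
    (p : nat) (T : R) (S : 'M[R]_p) (X : R -> Omega -> 'cV[R]_p) n w k :
  vech_error T S X n w k 0 = Num.sqrt n%:R *
    (realized T (fun t w => X t w (tnth (vech_tuple p) k).1 0)
       (fun t w => X t w (tnth (vech_tuple p) k).2 0) n w -
     S (tnth (vech_tuple p) k).1 (tnth (vech_tuple p) k).2).
Proof.
rewrite -realized_covE /vech_error; move: (realized_cov T X n w) => Q.
by rewrite !mxE.
Qed.

Lemma vech_error_measurable (R : realType) (d : measure_display)
    (Omega : measurableType d) (p : nat) (T : R) (S : 'M[R]_p)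
    (X : R -> Omega -> 'cV[R]_p) : 0 < T ->
  (forall t, t \in `[0, T] -> random_vector (X t)) ->
  forall n, random_vector (vech_error T S X n).
Proof.
move=> T0 mX n k; under eq_fun do rewrite vech_errorE.
apply: measurable_funM => //; apply: measurable_funB => //.
by apply: realized_measurable => // t tT; exact: mX.
Qed.

(** * Realized covariance of the observed process *)

Section realized_covariance.
Context (R : realType) (d : measure_display) (Omega : measurableType d)
  (P : probability Omega R) (p : nat) (T : R) (T0 : 0 < T).
Context (r : nat) (W : R -> Omega -> 'cV[R]_r) (WP : wiener P W) (k0 : 'I_r).
Context (S : 'M[R]_p) (symS : S^T = S)
  (S_ge0 : forall a : 'cV[R]_p, 0 <= (a^T *m S *m a) 0 0).
Context (M : R -> Omega -> 'cV[R]_p) (MN : gaussian_noise P S M).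
Context (X : R -> Omega -> 'cV[R]_p).
Hypothesis mX : forall t, t \in `[0, T] -> random_vector (X t).
Hypothesis sX : forall a, ae_smooth P T (fun t w => X t w a 0 - M t w a 0).
Hypothesis cM : forall a,
  {ae P, forall w, {within `[0, T], continuous (fun t => M t w a 0)}}.

Let mM t : t \in `[0, T] -> random_vector (M t).
Proof. by rewrite in_itv /= => /andP[t0 _]; exact: (noise_rv MN t0). Qed.

Let pX a : process_rv T (fun t w => X t w a 0).
Proof. by move=> t tT; exact: mX. Qed.

Let pM a : process_rv T (fun t w => M t w a 0).
Proof. by move=> t tT; exact: mM. Qed.

Let drift i j := realized_drift T0 (pX i) (pM i) (pX j) (pM j) (sX i) (sX j)
  (cM i) (cM j) (noise_increment_sqr WP k0 S_ge0 MN i)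
  (noise_increment_sqr WP k0 S_ge0 MN j).

Let err n w k := vech_error T S X n w k 0 - vech_error T S M n w k 0.

Let noise_error_measurable n : random_vector (vech_error T S M n).
Proof. exact: vech_error_measurable. Qed.

Let err_measurable k n : measurable_fun setT (fun w => err n w k).
Proof. by apply: measurable_funB; exact: vech_error_measurable. Qed.

Let err_cvg0 k : cvg0_prob P (fun n w => err n w k).
Proof.
rewrite (_ : (fun n w => _) = fun n w => Num.sqrt n%:R *
  (realized T (fun t w => X t w (tnth (vech_tuple p) k).1 0)
     (fun t w => X t w (tnth (vech_tuple p) k).2 0) n w -
   realized T (fun t w => M t w (tnth (vech_tuple p) k).1 0)
     (fun t w => M t w (tnth (vech_tuple p) k).2 0) n w)); last first.
  by apply/funext => n; apply/funext => w; rewrite /err !vech_errorE; ring.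
exact: drift.
Qed.

(** a^T applied to the difference of the errors of X and M is a finite combination of coordinates
    that vanish in probability, so the limit for M carries over. *)
Lemma vech_error_cf_drift (a : 'cV[R]_((p * p.+1)./2)) (th : R) :
  \int[P]_w cos (th + (a^T *m vech_error T S X n w) 0 0) @[n --> \oo] -->
  expR (- (qform_var S (vech_form a) / 2)) * cos th.
Proof.
pose x n w := \sum_k a k 0 * err n w k.
pose y n w := (a^T *m vech_error T S M n w) 0 0.
have yx n w : (a^T *m vech_error T S X n w) 0 0 = y n w + x n w.
  rewrite /y /x ![(a^T *m _) 0 0]mxE -big_split; apply: eq_bigr => k _ /=.
  by rewrite ![a^T _ _]mxE -mulrDr /err addrC subrK.
have cx : cvg0_prob P x.
  apply: cvg0_prob_sum => [k n|k]; first exact: measurable_funM.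
  by apply: cvg0_prob_scale => // n; exact: err_measurable.
have mx n : measurable_fun setT (x n).
  by apply: measurable_sum => k; exact: measurable_funM.
have my n : measurable_fun setT (y n) by exact: random_vector_dot.
have cD := cos_perturbation th mx my cx.
have cM' : \int[P]_w cos (th + y n w) @[n --> \oo] -->
    expR (- (qform_var S (vech_form a) / 2)) * cos th
  by exact: (vech_error_cf T0 WP k0 symS S_ge0 MN).
have := cvgD cD cM'; rewrite add0r; under eq_cvg do rewrite /= subrK.
under [X in _ -> X]eq_cvg do under eq_Rintegral do rewrite yx.
exact.
Qed.

(** Chebyshev's inequality for the error of M, whose coordinates have bounded variance, followed by
    [tail_perturbation]. *)
Lemma tight_vech_error : tight P (vech_error T S X).
Proof.
move=> e e0; have e20 : 0 < e / 2 by rewrite divr_gt0.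
pose qv (k : 'I_((p * p.+1)./2)) := qform_var S (vech_form (delta_mx k 0 : 'cV[R]__)).
(* Dominates the variances of all coordinates at once; the 1 keeps V, and hence the threshold c,
   positive. *)
pose V := \sum_k `|qv k| + 1.
have V0 : 0 < V by rewrite ltr_wpDl// sumr_ge0.
pose c := Num.sqrt (V / (e / 2)).
have c0 : 0 < c by rewrite sqrtr_gt0 divr_gt0.
exists (c + 1); first by rewrite addr_gt0.
apply: filter_forall => k; rewrite [X in X%:E](splitr e).
have := tail_perturbation (c := c) (fun n => err_measurable k n)
  (fun n => noise_error_measurable n k) (err_cvg0 k) e20.
have h : \forall n \near \oo,
    (P [set w | (c < `|vech_error T S M n w k 0|)%R] <= (e / 2)%:E)%E.
  apply: nearW => n; apply: (le_trans (markov_sqr c0 (noise_error_measurable n k) _)).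
    have [i2 _] := vech_error_sqr T0 WP k0 symS S_ge0 MN (delta_mx k 0) n.
    by move: i2; congr (_.-integrable _ _); apply/funext => w /=; rewrite delta_mx_dot.
  have [_ e2] := vech_error_sqr T0 WP k0 symS S_ge0 MN (delta_mx k 0) n.
  rewrite lee_fin; move: e2; under eq_Rintegral do rewrite delta_mx_dot.
  move=> e2.
  rewrite ler_pdivrMl ?exprn_gt0//; apply: (le_trans e2).
  have -> : c ^+ 2 * (e / 2) = V.
    by rewrite sqr_sqrtr ?(divr_ge0 (ltW V0) (ltW e20))// divfK ?gt_eqF.
  apply: (le_trans (ler_norm _)); rewrite -/(qv k) /V (bigD1 k)//= -addrA lerDl.
  by rewrite addr_ge0 ?sumr_ge0.
move=> /(_ h); apply: filterS => n; congr (P _ <= _)%E; apply/funext => w /=.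
by rewrite /err [_ + (_ - _)]addrC subrK.
Qed.

(** If all coordinates of the scaled error are at most c, the entries of Q - S are at most c /
    sqrt(n), and the Frobenius norm is at most p c / sqrt(n), which is at most e for large n. By
    tightness and a union bound the complementary event has probability at most h. *)
Lemma cvg_probability_realized_cov : cvg_probability P (realized_cov T X) S.
Proof.
move=> e e0.
pose s n w := \sum_i \sum_j (realized_cov T X n w - S) i j ^+ 2.
have s0 n w : 0 <= s n w.
  by apply: sumr_ge0 => i _; apply: sumr_ge0 => j _; exact: sqr_ge0.
have sE n w : (e < enorm (realized_cov T X n w - S)) = (e ^+ 2 < `|s n w|).
  rewrite (ger0_norm (s0 n w)) -[in RHS](sqr_sqrtr (s0 n w)).
  by rewrite ltr_pXn2r ?nnegrE ?sqrtr_ge0 ?(ltW e0).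
have mA n : measurable [set w | e < enorm (realized_cov T X n w - S)].
  rewrite (_ : [set w | _] = [set w | e ^+ 2 < `|s n w|]); last first.
    by apply/funext => w; rewrite /= sE.
  apply: measurable_normr_gt; apply: measurable_sum => i; apply: measurable_sum => j.
  apply: measurable_funX.
  rewrite (_ : (fun w => _) = fun w => realized T (fun t w => X t w i 0)
    (fun t w => X t w j 0) n w - S i j); last first.
    by apply/funext => w; rewrite -realized_covE !mxE.
  by apply: measurable_funD => //; exact: realized_measurable.
under eq_cvg do rewrite -[P _]fineK ?fin_num_measure//.
apply: cvg_EFin; first exact: nearW.
apply/cvgr0Pnorm_le => h h0.
pose q := ((p * p.+1)./2).
have hq : 0 < h / (q%:R + 1) by rewrite divr_gt0// ltr_wpDl.
have [c c0 tc] := tight_vech_error hq.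
near=> n.
have n0 : (0 < n)%N by near: n; exact: nbhs_infty_gt.
have nR : 0 < n%:R :> R by rewrite ltr0n.
have cn : p%:R ^+ 2 * c ^+ 2 / e ^+ 2 <= n%:R.
  by near: n; exact: nbhs_infty_ger.
have tn k : (P [set w | (c < `|vech_error T S X n w k 0|)%R] <= (h / (q%:R + 1))%:E)%E.
  by move: k; near: n.
rewrite /= ger0_norm ?fine_ge0// -(Rintegral_indicator P (mA n)).
pose A k := [set w | c < `|vech_error T S X n w k 0|].
have mAk k : measurable (A k) by apply: measurable_normr_gt; exact: vech_error_measurable.
apply: (@le_trans _ _ (\int[P]_w \sum_k \1_(A k) w)).
  apply: le_Rintegral => //.
  - exact: integrable_indicator.
  - by apply: integrable_sumr => k _; exact: integrable_indicator.
  move=> w _; rewrite indicE; case: (boolP (w \in _)) => [|_]; last first.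
    by apply: sumr_ge0 => k _; rewrite indicE.
  rewrite inE /= sE (ger0_norm (s0 n w)) => es.
  have [hk|/existsNP[k hk]] := pselect (forall k, `|vech_error T S X n w k 0| <= c).
    exfalso; move: es; apply/negP; rewrite -leNgt.
    rewrite ler_pdivrMr ?exprn_gt0// in cn.
    have ij i j : (realized_cov T X n w - S) i j ^+ 2 <= c ^+ 2 / n%:R.
      (* By symmetry the entry may be taken in the lower triangle, where it is a coordinate of
         vech. *)
      wlog ji : i j / (j <= i)%N.
        move=> H; have [/H//|/ltnW/H] := leqP j i.
        have DT : (realized_cov T X n w - S)^T = realized_cov T X n w - S.
          by rewrite linearB /= realized_cov_sym symS.
        by rewrite -[in X in _ -> X]DT [(_^T) i j]mxE.
      have /tnthP[k kE] : (i, j) \in vech_tuple p by rewrite mem_vech_pos.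
      have := hk k; rewrite vech_errorE -kE /= -realized_covE => hk1.
      rewrite ler_pdivlMr// mulrC -[n%:R](sqr_sqrtr (ltW nR)) -exprMn.
      rewrite -[X in X <= _]real_normK ?num_real// lerXn2r ?nnegrE ?(ltW c0)//.
      by move: hk1; move: (realized_cov T X n w) => Q; rewrite !mxE.
    apply: (@le_trans _ _ (\sum_(i < p) \sum_(j < p) c ^+ 2 / n%:R)).
      by apply: ler_sum => i _; apply: ler_sum => j _; exact: ij.
    rewrite !sumr_const !card_ord -mulrnA -[leLHS]mulr_natl natrM.
    by rewrite -expr2 mulrA ler_pdivrMr// [leRHS]mulrC.
  rewrite (bigD1 k)//= indicE mem_set; last first.
    by rewrite /A /= ltNge; apply/negP.
  by rewrite lerDl sumr_ge0// => l _; rewrite indicE.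
rewrite Rintegral_sum => [|k _]; last exact: integrable_indicator.
apply: (@le_trans _ _ (\sum_(k < q) (h / (q%:R + 1)))).
  apply: ler_sum => k _; rewrite Rintegral_indicator// -lee_fin fineK ?fin_num_measure//.
  exact: tn.
rewrite sumr_const card_ord -[leLHS]mulr_natl mulrA ler_pdivrMr ?ltr_wpDl//.
by rewrite mulrC ler_wpM2l ?(ltW h0)// lerDl.
Unshelve. all: by end_near. Qed.


End realized_covariance.

(** * The Gaussian limit vector and the central limit theorem *)

Section gaussian_vector.
Context (R : realType) (d : measure_display) (Omega : measurableType d)
  (P : probability Omega R).
Context (r : nat) (W : R -> Omega -> 'cV[R]_r) (WP : wiener P W) (k0 : 'I_r).

(** Increments of one coordinate of W over successive unit intervals: a sequence of independent
    standard normal variables. *)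
Let G i w : R := W i.+1%:R w k0 0 - W i%:R w k0 0.

Let G_normal i (c : R) : normal_rv P (c ^+ 2) (fun w => c * G i w).
Proof.
have i0 : 0 <= i%:R :> R by [].
have ii : i%:R < i.+1%:R :> R by rewrite ltr_nat.
have [mW nW] := wiener_normal WP i0 ii.
have dE (v : 'cV[R]_r) : ((c *: delta_mx k0 0 : 'cV[R]_r)^T *m v) 0 0 = c * v k0 0.
  by rewrite [(_ *: _)^T]linearZ /= -scalemxAl trmx_delta -rowE !mxE.
have GE w : G i w = (W i.+1%:R w - W i%:R w) k0 0 by rewrite !mxE.
have mG : measurable_fun setT (G i).
  by have := mW k0; congr measurable_fun; apply/funext => w; rewrite GE.
split; first exact: measurable_funM.
have e0 : ((c *: delta_mx k0 0 : 'cV[R]_r)^T *m (0 : 'cV[R]_r)) 0 0 = 0.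
  by rewrite dE mxE mulr0.
have ev : ((c *: delta_mx k0 0 : 'cV[R]_r)^T *m (i.+1%:R - i%:R)%:M *m
    (c *: delta_mx k0 0 : 'cV[R]_r)) 0 0 = c ^+ 2.
  rewrite -mulmxA dE mul_scalar_mx mxE [(_ *: delta_mx _ _) _ _]mxE.
  by rewrite [delta_mx _ _ _ _]mxE eqxx mulr1 mulrSr addrAC subrr add0r mul1r expr2.
move=> A mA; have := nW (c *: delta_mx k0 0) A mA; rewrite e0 ev.
by move=> <-; congr (P _); apply/funext => w; rewrite /preimage /= dE GE.
Qed.

(** F applied to N independent standard normal variables [G]; the limit law is thus realized on the
    original probability space. *)
Lemma normal_vector_exists (q N : nat) (F : 'M[R]_(q, N)) :
  exists Y : Omega -> 'cV[R]_q, normal_vector P Y 0 (F *m F^T).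
Proof.
pose Y w : 'cV[R]_q := F *m \col_i G i w.
pose t (i : nat) : R := i%:R.
have tS i : t i <= t i.+1 by rewrite ler_nat.
have indF := wiener_independent WP (m := N) (t := t) (lexx _) tS.
set H := (fun i : 'I_N => _) in indF.
have Hm i : H i `<=` measurable.
  apply: smallest_sub; first exact: sigma_algebra_measurable.
  move=> _ [_ [c [B [_ mB ->]]]]; rewrite -[X in measurable X]setTI.
  have ii : t i < t i.+1 by rewrite ltr_nat.
  by have [mW _] := wiener_normal WP (ler0n _ i) ii; exact: mW.
have nY (a : 'cV[R]_q) : normal_rv P ((a^T *m (F *m F^T) *m a) 0 0)
    (fun w => (a^T *m Y w) 0 0).
  pose b := F^T *m a.
  have bT : b^T = a^T *m F by rewrite trmx_mul trmxK.
  rewrite (_ : (a^T *m _ *m a) 0 0 = \sum_(i in [set: 'I_N]%SET) b i 0 ^+ 2); last first.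
    rewrite mulmxA -mulmxA -bT mxE; apply: eq_big => [i|i _]; first by rewrite inE.
    by rewrite [b^T _ _]mxE expr2.
  rewrite (_ : (fun w => _) = fun w => \sum_(i in [set: 'I_N]%SET) b i 0 * G i w); last first.
    apply/funext => w; rewrite /Y mulmxA -bT mxE.
    apply: eq_big => [i|i _]; first by rewrite inE.
    by rewrite [b^T _ _]mxE [X in _ * X]mxE.
  apply: (normal_rv_sum (F := H) (x := fun (i : 'I_N) w => b i 0 * G i w)
    (v := fun i : 'I_N => b i 0 ^+ 2) _ _ Hm indF k0 _ WP) => //.
  - by move=> i; exact: sigmaT.
  - by move=> i; exact: sigma_setI.
  - by move=> i; exact: sqr_ge0.
  - move=> i; apply: measurable_wrtM; first exact: measurable_wrt_cst.
    move=> B mB; apply: sub_sigma_algebra; exists tt, k0, B; split=> //.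
    by apply/funext => w; rewrite /preimage /= /G /t !mxE.
exists Y; split.
  move=> i; have [+ _] := nY (delta_mx i 0); congr measurable_fun.
  by apply/funext => w; rewrite delta_mx_dot.
by move=> a A mA; rewrite mulmx0 [X in normal_law X]mxE; have [_ /(_ A mA)] := nY a.
Qed.

Lemma normal_vector_dot (q : nat) (Y : Omega -> 'cV[R]_q) (V : 'M[R]_q) :
  normal_vector P Y 0 V -> forall a : 'cV[R]_q,
  normal_rv P ((a^T *m V *m a) 0 0) (fun w => (a^T *m Y w) 0 0).
Proof.
move=> [mY nY] a; split; first exact: random_vector_dot.
have e0 : (a^T *m (0 : 'cV[R]_q)) 0 0 = 0 by rewrite mulmx0 mxE.
by move=> A mA; have := nY a A mA; rewrite e0.
Qed.

Lemma tight_normal_vector (q : nat) (Y : Omega -> 'cV[R]_q) (V : 'M[R]_q) :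
  (forall a : 'cV[R]_q, 0 <= (a^T *m V *m a) 0 0) ->
  normal_vector P Y 0 V -> tight P (fun=> Y).
Proof.
move=> V_ge0 nY e e0; have [mY _] := nY.
pose s := \sum_k `|((delta_mx k 0 : 'cV[R]_q)^T *m V *m (delta_mx k 0 : 'cV[R]_q)) 0 0| + 1.
have s0 : 0 < s by rewrite ltr_wpDl// sumr_ge0.
pose c := Num.sqrt (s / e).
have c0 : 0 < c by rewrite sqrtr_gt0 divr_gt0.
have cE : c ^+ 2 * e = s.
  by rewrite sqr_sqrtr ?(divr_ge0 (ltW s0) (ltW e0))// divfK ?gt_eqF.
exists c => //; apply: nearW => _ k.
have nk := normal_vector_dot nY (delta_mx k 0); have vk := V_ge0 (delta_mx k 0).
have i2 := integrable_normal_pow WP k0 vk nk 2.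
have e2 := normal_moment_even WP k0 vk nk 1.
rewrite (@odd_prod_natr R 1 1) ?big_ord1// mulr1 expr1 in e2.
have E : (fun w => ((delta_mx k 0 : 'cV[R]_q)^T *m Y w) 0 0 ^+ 2) = fun w => Y w k 0 ^+ 2.
  by apply/funext => w; rewrite delta_mx_dot.
rewrite E in i2; apply: (le_trans (markov_sqr c0 (mY k) i2)).
rewrite lee_fin ler_pdivrMl ?exprn_gt0// cE.
rewrite [leLHS](_ : _ = \int[P]_w (((delta_mx k 0 : 'cV[R]_q)^T *m Y w) 0 0 ^+ 2)); last first.
  by apply: eq_Rintegral => w _; rewrite delta_mx_dot.
rewrite e2; apply: (le_trans (ler_norm _)).
by rewrite /s (bigD1 k)//= -addrA lerDl addr_ge0 ?sumr_ge0.
Qed.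

End gaussian_vector.

Lemma gram_ge0 (R : realType) (q N : nat) (F : 'M[R]_(q, N)) (a : 'cV[R]_q) :
  0 <= (a^T *m (F *m F^T) *m a) 0 0.
Proof.
have -> : a^T *m (F *m F^T) *m a = (F^T *m a)^T *m (F^T *m a).
  by rewrite trmx_mul trmxK !mulmxA.
by rewrite mxE sumr_ge0// => i _; rewrite mxE -expr2 sqr_ge0.
Qed.

Section central_limit.
Context (R : realType) (d : measure_display) (Omega : measurableType d)
  (P : probability Omega R) (p N : nat) (T : R) (T0 : 0 < T).
Context (r : nat) (W : R -> Omega -> 'cV[R]_r) (WP : wiener P W) (k0 : 'I_r).
Context (F : 'M[R]_(p, N)).
Let S := F *m F^T.
Context (M : R -> Omega -> 'cV[R]_p) (MN : gaussian_noise P S M).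
Context (X : R -> Omega -> 'cV[R]_p).
Hypothesis mX : forall t, t \in `[0, T] -> random_vector (X t).
Hypothesis sX : forall a, ae_smooth P T (fun t w => X t w a 0 - M t w a 0).
Hypothesis cM : forall a,
  {ae P, forall w, {within `[0, T], continuous (fun t => M t w a 0)}}.

(** [cvg_distribution_cf] applied to [vech_error_cf_drift], whose limit matches [normal_cf] for the
    limit vector by [vech_form_cov]. *)
Lemma cvg_normal_vech_error : cvg_normal P (vech_error T S X) 0
  (2 *: (mpinvmx (duplication_mx R p) *m (S *t S) *m (mpinvmx (duplication_mx R p))^T)).
Proof.
set Dp := mpinvmx _.
have symS : S^T = S by rewrite /S trmx_mul trmxK.
have S_ge0 := gram_ge0 F.
(* The limit covariance is E E^T, because the Kronecker product of F F^T with itself factors through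
   that of F with itself; such a factor yields both the limit vector and positivity. *)
pose E := Num.sqrt 2 *: (Dp *m (F *t F)).
have VE : 2 *: (Dp *m (S *t S) *m Dp^T) = E *m E^T.
  rewrite /E linearZ /= -scalemxAl -scalemxAr scalerA -expr2 sqr_sqrtr//.
  by rewrite trmx_mul trmx_tens /S -tensmx_mul !mulmxA.
have [Y nY] := normal_vector_exists WP k0 E.
exists d, Omega, P, Y; rewrite VE; split=> //.
have [mY _] := nY.
apply: cvg_distribution_cf => //.
- by move=> n; exact: vech_error_measurable.
- move=> a th.
  rewrite (normal_cf WP k0 (gram_ge0 E a) (normal_vector_dot nY a)) -VE vech_form_cov.
  exact: (vech_error_cf_drift T0 WP k0 symS S_ge0 MN).
- exact: (tight_vech_error T0 WP k0 symS S_ge0 MN).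
- exact: (tight_normal_vector WP k0 (gram_ge0 E) nY).
Qed.

End central_limit.

(** * From stochastic differential equations to smooth paths *)

Section lipschitz.
Context (R : realType).

Lemma ler_coord_enorm (k : nat) (x : 'cV[R]_k) i : `|x i 0| <= enorm x.
Proof.
rewrite -sqrtr_sqr ler_wsqrtr// (bigD1 i)//= big_ord1 lerDl sumr_ge0// => j _.
by rewrite big_ord1 sqr_ge0.
Qed.

Lemma enorm_le (k : nat) (x : 'cV[R]_k) (m : R) : 0 <= m ->
  (forall i, `|x i 0| <= m) -> enorm x <= Num.sqrt k%:R * m.
Proof.
move=> m0 xm; rewrite -[X in _ * X](ger0_norm m0) -sqrtr_sqr -sqrtrM// ler_wsqrtr//.
rewrite mulr_natl -[X in _ *+ X](card_ord k) -sumr_const; apply: ler_sum => i _.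
by rewrite big_ord1 -[leLHS]real_normK ?num_real// lerXn2r ?nnegrE.
Qed.

(** The Lipschitz bound is Euclidean and the topology that of the maximum norm; they are compared by
    |x_i| <= [enorm] x <= sqrt(k) max |x_i|. *)
Lemma lipschitz_continuous (k l : nat) (B : 'cV[R]_k -> 'cV[R]_l) i :
  lipschitz_map B -> continuous (fun x => B x i 0).
Proof.
move=> [L LB] x; apply/(@cvgrPdist_le _ _ _ (nbhs x) (nbhs_filter x)) => e e0.
pose c := `|L| * Num.sqrt k%:R + 1.
have c0 : 0 < c by rewrite ltr_wpDl// mulr_ge0// sqrtr_ge0.
have ec : 0 < e / c by rewrite divr_gt0.
apply/nbhs_ballP; exists (e / c) => //= y [_ xy].
have : enorm (x - y) <= Num.sqrt k%:R * (e / c).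
  by apply: enorm_le => [|j]; [exact: ltW|rewrite !mxE; exact: ltW (xy j 0)].
move=> h; apply: (@le_trans _ _ (enorm (B x - B y))).
  by apply: le_trans (ler_coord_enorm _ i); rewrite !mxE.
apply: (le_trans (LB x y)); apply: (@le_trans _ _ (`|L| * (Num.sqrt k%:R * (e / c)))).
  by apply: (le_trans (ler_wpM2r (sqrtr_ge0 _) (ler_norm L))); exact: ler_wpM2l.
apply: (@le_trans _ _ (c * (e / c))); first by rewrite mulrA ler_wpM2r ?(ltW ec)// lerDl.
by rewrite mulrC divfK ?gt_eqF.
Qed.

End lipschitz.

Section smooth_sums.
Context (R : realType) (T : R) (T0 : 0 < T).

Lemma continuous_itv_integrable (g : R -> R) (t : R) :
  {within `[0, T], continuous g} -> t \in `[0, T] ->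
  (@lebesgue_measure R).-integrable `[0, t] (EFin \o g).
Proof.
move=> cg; rewrite in_itv /= => /andP[t0 tT].
have iT : (@lebesgue_measure R).-integrable `[0, T] (EFin \o g).
  by apply: continuous_compact_integrable => //; exact: segment_compact.
by apply: integrableS iT => //; apply: subset_itvl; rewrite bnd_simp.
Qed.

Lemma smooth_path_cst (c : R) : smooth_path T (fun _ => 0) (fun _ => c).
Proof.
split; first by apply: continuous_subspaceT => x; exact: cst_continuous.
by exists c => t tT; rewrite /Rintegral integral0 addr0.
Qed.

Lemma smooth_pathD (g h u v : R -> R) : smooth_path T g u -> smooth_path T h v ->
  smooth_path T (fun t => g t + h t) (fun t => u t + v t).
Proof.
move=> [cg [c uE]] [ch [c' vE]]; split.
  by move=> x; apply: continuousD; [exact: cg|exact: ch].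
exists (c + c') => t tT; rewrite uE// vE// addrACA; congr (_ + _).
by rewrite RintegralD//; exact: continuous_itv_integrable.
Qed.

Lemma smooth_pathZ (k : R) (g u : R -> R) : smooth_path T g u ->
  smooth_path T (fun t => k * g t) (fun t => k * u t).
Proof.
move=> [cg [c uE]]; split.
  by move=> x; apply: continuousM; [exact: cst_continuous|exact: cg].
exists (k * c) => t tT; rewrite uE// mulrDr; congr (_ + _).
by rewrite RintegralZl//; exact: continuous_itv_integrable.
Qed.

Lemma smooth_path_sum (I : Type) (s : seq I) (u : I -> R -> R) :
  (forall i, exists g, smooth_path T g (u i)) ->
  exists g, smooth_path T g (fun t => \sum_(i <- s) u i t).
Proof.
move=> su; elim: s => [|i s [h ih]].
  have -> : (fun t => \sum_(i <- [::]) u i t) = fun=> 0.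
    by apply/funext => t; rewrite big_nil.
  by exists (fun=> 0); exact: smooth_path_cst.
have [g gu] := su i; exists (fun t => g t + h t).
have -> : (fun t => \sum_(j <- i :: s) u j t) = fun t => u i t + \sum_(j <- s) u j t.
  by apply/funext => t; rewrite big_cons.
exact: smooth_pathD.
Qed.

Lemma eq_smooth_path (g u v : R -> R) : (forall t, t \in `[0, T] -> u t = v t) ->
  smooth_path T g v -> smooth_path T g u.
Proof. by move=> uv [cg [c vE]]; split=> //; exists c => t tT; rewrite uv// vE. Qed.

Lemma smooth_path_mulmx (k l : nat) (L : 'M[R]_(l, k)) (u : R -> 'cV[R]_k) a :
  (forall i, exists g, smooth_path T g (fun t => u t i 0)) ->
  exists g, smooth_path T g (fun t => (L *m u t) a 0).
Proof.
move=> su; have [|g gs] := @smooth_path_sum _ (index_enum 'I_k) (fun i t => L a i * u t i 0).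
  by move=> i; have [g gu] := su i; exists (fun t => L a i * g t); exact: smooth_pathZ.
by exists g; apply: eq_smooth_path gs => t _; rewrite mxE.
Qed.

(** Subtracting the noise from the equation leaves the constant c - S W_0 plus the integral of B(Y),
    whose integrand is continuous as B is Lipschitz and Y continuous. *)
Lemma sde_smooth_path (k r : nat) (B : 'cV[R]_k -> 'cV[R]_k) (S : 'M[R]_(k, r))
    (c : 'cV[R]_k) (W : R -> 'cV[R]_r) (Y : R -> 'cV[R]_k) i :
  lipschitz_map B -> {within `[0, T], continuous Y} ->
  (forall t, t \in `[0, T] -> Y t =
     c + \col_i (\int[lebesgue_measure]_(s in `[0, t]) (B (Y s) i 0))
     + S *m (W t - W 0)) ->
  exists g, smooth_path T g (fun t => (Y t - S *m W t) i 0).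
Proof.
move=> LB cY YE; exists (fun t => B (Y t) i 0); split.
  move=> x; apply: (@continuous_comp (subspace `[0, T]) _ _ Y (fun y => B y i 0)).
    exact: cY.
  exact: lipschitz_continuous.
exists (c i 0 - (S *m W 0) i 0) => t tT; rewrite YE// mulmxBr.
by move: (S *m W t) (S *m W 0) => a b; rewrite !mxE; ring.
Qed.

End smooth_sums.

Section wiener_paths.
Context (R : realType) (d : measure_display) (Omega : measurableType d)
  (P : probability Omega R) (T : R).

Lemma continuous_sum_within (I : Type) (s : seq I) (A : set R) (u : I -> R -> R) :
  (forall i, {within A, continuous (u i)}) ->
  {within A, continuous (fun t => \sum_(i <- s) u i t)}.
Proof.
move=> cu; elim: s => [|i s ih].
  have -> : (fun t => \sum_(i <- [::]) u i t) = fun=> 0.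
    by apply/funext => t; rewrite big_nil.
  by apply: continuous_subspaceT => x; exact: cst_continuous.
have -> : (fun t => \sum_(j <- i :: s) u j t) = fun t => u i t + \sum_(j <- s) u j t.
  by apply/funext => t; rewrite big_cons.
by move=> x; apply: continuousD; [exact: cu|exact: ih].
Qed.

Lemma wiener_mulmx_continuous (p r : nat) (W : R -> Omega -> 'cV[R]_r)
    (K : 'M[R]_(p, r)) a : wiener P W ->
  {ae P, forall w, {within `[0, T], continuous (fun t => (K *m W t w) a 0)}}.
Proof.
move=> WP; apply: filterS (wiener_continuous WP) => w cW.
have -> : (fun t => (K *m W t w) a 0) = fun t => \sum_i K a i * W t w i 0.
  by apply/funext => t; rewrite mxE.
apply: continuous_sum_within => i x; apply: continuousM; first exact: cst_continuous.
apply: (@continuous_comp (subspace `[0, T]) _ _ (fun t => W t w) (fun y => y i 0)).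
  move: x; apply: continuous_subspaceW cW; apply: subset_itvl; by rewrite bnd_simp.
exact: coord_continuous.
Qed.

End wiener_paths.

(** * The model with four Wiener processes *)

Section four_wiener_processes.
Context (R : realType) (d : measure_display) (Omega : measurableType d)
  (P : probability Omega R) (p r1 r2 r3 r4 : nat).
Context (W1 : R -> Omega -> 'cV[R]_r1) (W2 : R -> Omega -> 'cV[R]_r2)
  (W3 : R -> Omega -> 'cV[R]_r3) (W4 : R -> Omega -> 'cV[R]_r4).
Context (K1 : 'M[R]_(p, r1)) (K2 : 'M[R]_(p, r2)) (K3 : 'M[R]_(p, r3))
  (K4 : 'M[R]_(p, r4)).

(** Defined by matching on the underlying natural number, so that the dimension of each process
    reduces when the index is a concrete value. *)
Let r (j : nat) : nat :=
  match j with 0 => r1 | 1 => r2 | 2 => r3 | _ => r4 end.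

Let W (j : 'I_4) : R -> Omega -> 'cV[R]_(r j) :=
  match val j as k return R -> Omega -> 'cV[R]_(r k) with
  | 0 => W1 | 1 => W2 | 2 => W3 | _ => W4 end.

Let K (j : 'I_4) : 'M[R]_(p, r j) :=
  match val j as k return 'M[R]_(p, r k) with
  | 0 => K1 | 1 => K2 | 2 => K3 | _ => K4 end.

Lemma four_wiener_noise (i1 : 'I_r1) :
  wiener P W1 -> wiener P W2 -> wiener P W3 -> wiener P W4 ->
  mutual_independence P (tnth [tuple
     sigma_family `[0, +oo[ W1; sigma_family `[0, +oo[ W2;
     sigma_family `[0, +oo[ W3; sigma_family `[0, +oo[ W4]) ->
  let F := row_mx (row_mx K1 K2) (row_mx K3 K4) in
  gaussian_noise P (F *m F^T)
    (fun t w => K1 *m W1 t w + K2 *m W2 t w + K3 *m W3 t w + K4 *m W4 t w).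
Proof.
move=> P1 P2 P3 P4 indW F.
have WP j : wiener P (W j) by case: j => [[|[|[|[|//]]]] ?].
have indG : mutual_independence P (fun j => sigma_family `[0, +oo[ (W j)).
  move: indW; congr mutual_independence; apply/funext => j.
  by case: j => [[|[|[|[|//]]]] ?].
have := wiener_noise P1 i1 K WP indG.
congr gaussian_noise.
  rewrite 4!big_ord_recl big_ord0 addr0 /F !tr_row_mx !mul_row_col.
  by rewrite !addrA.
apply/funext => t; apply/funext => w.
by rewrite 4!big_ord_recl big_ord0 addr0 !addrA.
Qed.

End four_wiener_processes.

(** The block columns of F are the coefficients of the four noises in X once eta is eliminated as
    Psi^(-1) (Gamma xi + zeta). Expanding F F^T by blocks gives the covariance. *)
Lemma model_covE (R : realType) (p1 p2 k1 k2 r1 r2 r3 r4 : nat)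
    (Lambda1 : 'M[R]_(p1, k1)) (Lambda2 : 'M[R]_(p2, k2))
    (Gamma : 'M[R]_(k2, k1)) (Psi : 'M[R]_k2)
    (S1 : 'M[R]_(k1, r1)) (S2 : 'M[R]_(p1, r2))
    (S3 : 'M[R]_(p2, r3)) (S4 : 'M[R]_(k2, r4)) :
  let F := row_mx
    (row_mx (col_mx Lambda1 (Lambda2 *m invmx Psi *m Gamma) *m S1) (col_mx S2 0))
    (row_mx (col_mx 0 S3) (col_mx 0 (Lambda2 *m invmx Psi) *m S4)) in
  model_cov Lambda1 Lambda2 Gamma Psi
    (S1 *m S1^T) (S2 *m S2^T) (S3 *m S3^T) (S4 *m S4^T) = F *m F^T.
Proof.
rewrite /model_cov /= !mul_col_mx !tr_row_mx !mul_row_col !tr_col_mx !mul_col_row.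
rewrite !add_block_mx !trmx0 !mul0mx !mulmx0 !addr0 !add0r.
congr block_mx.
- by rewrite !trmx_mul !mulmxA.
- by rewrite !trmx_mul !mulmxA.
- by rewrite !trmx_mul !trmxK trmx0 mulmx0 addr0 !mulmxA.
- by rewrite !(mulmxDr, mulmxDl) !trmx_mul !mulmxA -addrA [X in _ + X]addrC.
Qed.

Theorem theorem1 (R : realType) (d : measure_display)
  (Omega : measurableType d) (P : probability Omega R)
  (p1 p2 k1 k2 r1 r2 r3 r4 : nat)
  (p1_gt0 : (0 < p1)%N) (p2_gt0 : (0 < p2)%N)
  (k1_gt0 : (0 < k1)%N) (k2_gt0 : (0 < k2)%N)
  (r1_gt0 : (0 < r1)%N) (r2_gt0 : (0 < r2)%N)
  (r3_gt0 : (0 < r3)%N) (r4_gt0 : (0 < r4)%N)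
  (k1_le_p1 : (k1 <= p1)%N) (k2_le_p2 : (k2 <= p2)%N)
  (T : R) (T_gt0 : 0 < T)
  (* the driving Wiener processes *)
  (W1 : R -> Omega -> 'cV[R]_r1) (W2 : R -> Omega -> 'cV[R]_r2)
  (W3 : R -> Omega -> 'cV[R]_r3) (W4 : R -> Omega -> 'cV[R]_r4)
  (W1_wiener : wiener P W1) (W2_wiener : wiener P W2)
  (W3_wiener : wiener P W3) (W4_wiener : wiener P W4)
  (W_independent : mutual_independence P (tnth [tuple
     sigma_family `[0, +oo[ W1; sigma_family `[0, +oo[ W2;
     sigma_family `[0, +oo[ W3; sigma_family `[0, +oo[ W4]))
  (* the latent processes *)
  (B1 : 'cV[R]_k1 -> 'cV[R]_k1) (B2 : 'cV[R]_p1 -> 'cV[R]_p1)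
  (B3 : 'cV[R]_p2 -> 'cV[R]_p2) (B4 : 'cV[R]_k2 -> 'cV[R]_k2)
  (S1 : 'M[R]_(k1, r1)) (S2 : 'M[R]_(p1, r2))
  (S3 : 'M[R]_(p2, r3)) (S4 : 'M[R]_(k2, r4))
  (c1 : 'cV[R]_k1) (c2 : 'cV[R]_p1) (c3 : 'cV[R]_p2) (c4 : 'cV[R]_k2)
  (xi : R -> Omega -> 'cV[R]_k1) (delta : R -> Omega -> 'cV[R]_p1)
  (eps : R -> Omega -> 'cV[R]_p2) (zeta : R -> Omega -> 'cV[R]_k2)
  (xi_sde : sde_solution P T B1 S1 c1 W1 xi)
  (delta_sde : sde_solution P T B2 S2 c2 W2 delta)
  (eps_sde : sde_solution P T B3 S3 c3 W3 eps)
  (zeta_sde : sde_solution P T B4 S4 c4 W4 zeta)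
  (S2_posdef : posdefmx (S2 *m S2^T)) (S3_posdef : posdefmx (S3 *m S3^T))
  (* the structural equations *)
  (Lambda1 : 'M[R]_(p1, k1)) (Lambda2 : 'M[R]_(p2, k2))
  (Gamma : 'M[R]_(k2, k1)) (B : 'M[R]_k2)
  (Lambda1_rank : \rank Lambda1 = k1)
  (B_diag : forall i, B i i = 0) (Psi_unit : 1%:M - B \in unitmx)
  (eta : R -> Omega -> 'cV[R]_k2) (X : R -> Omega -> 'cV[R]_(p1 + p2))
  (eta_def : forall (t : R) w, t \in `[0, T] ->
     eta t w = B *m eta t w + Gamma *m xi t w + zeta t w)
  (X_def : forall (t : R) w, t \in `[0, T] ->
     X t w = col_mx (Lambda1 *m xi t w + delta t w)
                    (Lambda2 *m eta t w + eps t w))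
  (* the assumptions on the drifts and on the moments *)
  (B1_regular : regular_drift B1) (B2_regular : regular_drift B2)
  (B3_regular : regular_drift B3) (B4_regular : regular_drift B4)
  (xi_moments : bounded_moments P T xi)
  (delta_moments : bounded_moments P T delta)
  (eps_moments : bounded_moments P T eps)
  (zeta_moments : bounded_moments P T zeta) :
  let Sigma := model_cov Lambda1 Lambda2 Gamma (1%:M - B)
    (S1 *m S1^T) (S2 *m S2^T) (S3 *m S3^T) (S4 *m S4^T) in
  let Dplus := mpinvmx (duplication_mx R (p1 + p2)) in
  cvg_probability P (realized_cov T X) Sigma /\
  cvg_normal P
    (fun n w => Num.sqrt n%:R *: (vech (realized_cov T X n w) - vech Sigma))
    0 (2 *: (Dplus *m (Sigma *t Sigma) *m Dplus^T)).
Proof.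
move=> Sigma Dplus.
(* [L1] to [L4] are the loadings of xi, delta, eps and zeta in X after elimination of eta; [K1] to
   [K4] are those of the Wiener processes. *)
pose L1 := col_mx Lambda1 (Lambda2 *m invmx (1%:M - B) *m Gamma).
pose L2 : 'M[R]_(p1 + p2, p1) := col_mx 1%:M 0.
pose L3 : 'M[R]_(p1 + p2, p2) := col_mx 0 1%:M.
pose L4 : 'M[R]_(p1 + p2, k2) := col_mx 0 (Lambda2 *m invmx (1%:M - B)).
pose K1 := L1 *m S1; pose K2 : 'M[R]_(p1 + p2, r2) := col_mx S2 0.
pose K3 : 'M[R]_(p1 + p2, r3) := col_mx 0 S3; pose K4 := L4 *m S4.
pose F := row_mx (row_mx K1 K2) (row_mx K3 K4).
have SigmaE : Sigma = F *m F^T by exact: model_covE.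
pose M t w := K1 *m W1 t w + K2 *m W2 t w + K3 *m W3 t w + K4 *m W4 t w.
have MN : gaussian_noise P (F *m F^T) M.
  exact: (four_wiener_noise K1 K2 K3 K4 (Ordinal r1_gt0)).
have XE t w : t \in `[0, T] ->
    X t w = L1 *m xi t w + L2 *m delta t w + L3 *m eps t w + L4 *m zeta t w.
  move=> tT; rewrite X_def//.
  have -> : eta t w = invmx (1%:M - B) *m (Gamma *m xi t w + zeta t w).
    have e := eta_def t w tT.
    rewrite -[eta t w](mulKmx Psi_unit) mulmxBl mul1mx {1}e.
    by rewrite -(addrA (B *m eta t w)) addrAC subrr add0r.
  rewrite /L1 /L2 /L3 /L4 !mul_col_mx !add_col_mx !mul1mx !mul0mx !addr0.
  by rewrite !mulmxDr !mulmxA addrAC.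
have [mxi xiE] := xi_sde; have [mdelta deltaE] := delta_sde.
have [meps epsE] := eps_sde; have [mzeta zetaE] := zeta_sde.
have mX t : t \in `[0, T] -> random_vector (X t).
  move=> tT i.
  rewrite (_ : (fun w => _) = fun w => (L1 *m xi t w) i 0 + (L2 *m delta t w) i 0 +
      (L3 *m eps t w) i 0 + (L4 *m zeta t w) i 0); last first.
    by apply/funext => w; rewrite XE// 3![(_ + _ : 'cV_ _) i 0]mxE.
  have mL (k : nat) (L : 'M[R]_(p1 + p2, k)) (Y : Omega -> 'cV[R]_k) : random_vector Y ->
      measurable_fun setT (fun w => (L *m Y w) i 0).
    move=> mY; under eq_fun do rewrite mxE.
    by apply: measurable_sum => j; exact: measurable_funM.
  apply: measurable_funD; last exact/mL/mzeta.
  apply: measurable_funD; last exact/mL/meps.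
  by apply: measurable_funD; apply: mL; [exact: mxi|exact: mdelta].
(* X - M is the sum of the loadings applied to each latent process minus its own noise, and each
   such difference is a smooth path on a common almost sure event. *)
have sX a : ae_smooth P T (fun t w => X t w a 0 - M t w a 0).
  apply: filterS3 xiE deltaE (filterI epsE zetaE) => w [d1 e1] [d2 e2] [[d3 e3] [d4 e4]].
  have [g1 h1] := smooth_path_mulmx L1 a (fun i => sde_smooth_path i B1_regular.1 d1 e1).
  have [g2 h2] := smooth_path_mulmx L2 a (fun i => sde_smooth_path i B2_regular.1 d2 e2).
  have [g3 h3] := smooth_path_mulmx L3 a (fun i => sde_smooth_path i B3_regular.1 d3 e3).
  have [g4 h4] := smooth_path_mulmx L4 a (fun i => sde_smooth_path i B4_regular.1 d4 e4).
  have h := smooth_pathD (smooth_pathD (smooth_pathD h1 h2) h3) h4.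
  eexists; apply: eq_smooth_path h => t tT; rewrite XE// /M.
  have -> : K2 = L2 *m S2 by rewrite /L2 mul_col_mx mul1mx mul0mx.
  have -> : K3 = L3 *m S3 by rewrite /L3 mul_col_mx mul1mx mul0mx.
  rewrite !mulmxBr !mulmxA -/K1 -/K4.
  move: (L1 *m xi t w) (L2 *m delta t w) (L3 *m eps t w) (L4 *m zeta t w).
  move: (K1 *m _) (_ *m W2 _ _) (_ *m W3 _ _) (K4 *m _) => n1 n2 n3 n4 y1 y2 y3 y4.
  by rewrite !mxE; ring.
have cM a : {ae P, forall w, {within `[0, T], continuous (fun t => M t w a 0)}}.
  have cW1 := wiener_mulmx_continuous T K1 a W1_wiener.
  have cW2 := wiener_mulmx_continuous T K2 a W2_wiener.
  have cW3 := wiener_mulmx_continuous T K3 a W3_wiener.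
  have cW4 := wiener_mulmx_continuous T K4 a W4_wiener.
  apply: filterS3 cW1 cW2 (filterI cW3 cW4) => w cont1 cont2 [cont3 cont4].
  rewrite (_ : (fun t => _) = fun t => (K1 *m W1 t w) a 0 + (K2 *m W2 t w) a 0 +
      (K3 *m W3 t w) a 0 + (K4 *m W4 t w) a 0); last first.
    apply/funext => t; rewrite /M.
    by move: (K1 *m _) (K2 *m _) (K3 *m _) (K4 *m _) => n1 n2 n3 n4; rewrite !mxE.
  have cD (u v : R -> R) : {within `[0, T], continuous u} ->
      {within `[0, T], continuous v} -> {within `[0, T], continuous (fun t => u t + v t)}.
    by move=> cu cv x; apply: continuousD; [exact: cu|exact: cv].
  exact: cD (cD _ _ (cD _ _ cont1 cont2) cont3) cont4.
rewrite SigmaE; split.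
  apply: (cvg_probability_realized_cov T_gt0 W1_wiener (Ordinal r1_gt0) _
    (gram_ge0 F) MN mX sX cM).
  by rewrite trmx_mul trmxK.
exact: (cvg_normal_vech_error T_gt0 W1_wiener (Ordinal r1_gt0) MN mX sX cM).
Qed.
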